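(* Let $(M,F)$ be a Finsler manifold, let $m\ge 1$ be an integer and let $\kappa_1,\dots,\kappa_m$ be real constants. Let $D$ be the Cartan-type connection on $\pi^*TM$ with constants $\kappa_1,\dots,\kappa_m$, i.e. the Finsler connection with compatible tensors $S=A+\kappa_1\dot A+\cdots+\kappa_m\overset{m}{A}$ and $T=A$. Then the hv-curvature of $D$ vanishes identically if and only if $F$ is a Landsberg metric.
   Context: **Finsler structure.** $M$ is an $n$-dimensional $C^\infty$ manifold, $TM_0=TM\setminus\{0\}$, $\pi:TM_0\to M$ the projection. A Finsler structure is a function $F:TM\to[0,\infty)$ that is $C^\infty$ on $TM_0$, positively 1-homogeneous on the fibers, and such that $g_{ij}(x,y)=\frac12[F^2]_{y^iy^j}$ is positive definite on $TM_0$. $\pi^*TM$ is the pull-back of $TM$ over $TM_0$ (fiber over $v\in T_xM\setminus\{0\}$ is a copy of $T_xM$), with local frame $\partial_i|_v=(v,\partial/\partial x^i|_x)$ and canonical section $\ell_v=(v,v)/F(v)$. $g$ is the bundle metric on $\pi^*TM$ with $g(\partial_i,\partial_j)=g_{ij}$. The Cartan tensor $A$ is the symmetric trilinear form on $\pi^*TM$ with components $A_{ijk}=\frac14F\,[F^2]_{y^iy^jy^k}$. **Finsler connections.** $\rho:T(TM_0)\to\pi^*TM$ is the linear bundle map with $\rho(\partial/\partial x^i)=\partial_i$, $\rho(\partial/\partial y^i)=0$; the vertical space is $V_zTM=\ker\rho_z$. For a linear connection $D$ on the bundle $\pi^*TM$ put $\mu(\hat X)=D_{\hat X}(F\ell)$.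 $D$ is a Finsler connection if $\mu_z$ restricted to $V_zTM$ is an isomorphism onto the fiber of $\pi^*TM$ for every $z\in TM_0$; then $T_zTM_0=H_zTM\oplus V_zTM$ with horizontal space $H_zTM=\ker\mu_z$, and $\hat X=H\hat X+V\hat X$ denotes the decomposition. **Derivatives of $A$.** Let $\bar\ell$ be the horizontal vector field with $\rho(\bar\ell)=\ell$. Put $\overset{0}{A}=A$ and $$\overset{j+1}{A}(X,Y,Z)=\bar\ell\,\overset{j}{A}(X,Y,Z)-\overset{j}{A}(D_{\bar\ell}X,Y,Z)-\overset{j}{A}(X,D_{\bar\ell}Y,Z)-\overset{j}{A}(X,Y,D_{\bar\ell}Z);$$ write $\dot A=\overset{1}{A}$, $\ddot A=\overset{2}{A}$. $F$ is a Landsberg metric if $\dot A=0$. **Connection with compatible tensors $S,T$.** $S,T$ are symmetric trilinear forms on $\pi^*TM$; define $T(X,Y)\in\pi^*TM$ by $g(T(X,Y),Z)=T(X,Y,Z)$. $D$ is the Finsler connection with compatible tensors $S,T$ if for all $\hat X,\hat Y,\hat Z$ tangent to $TM_0$ and sections $X,Y$ of $\pi^*TM$: (i) $D_{\hat X}\rho(\hat Y)-D_{\hat Y}\rho(\hat X)-\rho[\hat X,\hat Y]=F^{-1}T(\mu(\hat X),\rho(\hat Y))-F^{-1}T(\mu(\hat Y),\rho(\hat X))$; (ii) $(D_{\hat Z}g)(X,Y)=2A(\rho(\hat Z),X,Y)+2F^{-1}A(\mu(\hat Z),X,Y)-2S(\rho(\hat Z),X,Y)-2F^{-1}T(\mu(\hat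 Z),X,Y)$. (Such a connection exists and is unique for the $S,T$ considered here.) When $S$ involves $\overset{j}{A}$, these are formed with $D$ itself. **hv-curvature.** With $\Omega(\hat X,\hat Y)Z=D_{\hat X}D_{\hat Y}Z-D_{\hat Y}D_{\hat X}Z-D_{[\hat X,\hat Y]}Z$, the hv-curvature of $D$ is $P=\Omega(H\hat X,V\hat Y)$; it vanishes if $\Omega(H\hat X,V\hat Y)Z=0$ for all $\hat X,\hat Y,Z$. *)

(* Defs.v *)
From HB Require Import structures.
From mathcomp Require Import all_boot all_order all_algebra.
From mathcomp Require Import all_classical all_reals all_analysis.

Set Implicit Arguments.
Unset Strict Implicit.
Unset Printing Implicit Defensive.

Import Order.TTheory GRing.Theory Num.Theory.
Import numFieldNormedType.Exports.

Local Open Scope classical_set_scope.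
Local Open Scope ring_scope.

(* C^oo in finite dimension: all iterated directional derivatives exist and are
   Frechet differentiable at every point of [U].  Meant for open [U]. *)
Fixpoint ndifferentiable (R : realType) (V W : normedModType R) (k : nat)
    (U : set V) (f : V -> W) : Prop :=
  if k is k'.+1 then
    (forall a, U a -> differentiable f a) /\
    (forall v : V, ndifferentiable k' U (fun a => 'D_v f a))
  else True.

Definition smooth_on (R : realType) (V W : normedModType R)
    (U : set V) (f : V -> W) : Prop :=
  forall k, ndifferentiable k U f.

(* An atlas modelled on [V], as plain data.  [ch_at x] is a preferred chart
   around [x]; it is used to represent every tangent vector at [x] by its
   component vector in that chart, so that T_xM is [V] itself, with its vector
   space structure, and TM is [M * V].  The manifold is the union of the
   chart domains, which may be a proper subset of the carrier type. *)
Record charts (R : realType) (V : normedModType R) (M : Type) := Charts {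
  ch_idx : Type;
  ch_at  : M -> ch_idx;
  ch_dom : ch_idx -> set M;
  ch_map : ch_idx -> M -> V;
  ch_inv : ch_idx -> V -> M
}.
Arguments ch_dom {R V M} c i _.
Arguments ch_map {R V M} c i _.
Arguments ch_inv {R V M} c i _.

Section Charts.
Context {R : realType} {V : normedModType R} {M : Type}.
Variable C : charts V M.

Definition ch_pts : set M := \bigcup_i ch_dom C i.

Definition ch_open (W : set M) : Prop :=
  W `<=` ch_pts /\ forall i, open (ch_map C i @` (W `&` ch_dom C i)).

(* The component vector in chart [i] of the tangent vector [v] at [x]. *)
Definition tcoord (i : ch_idx C) (x : M) (v : V) : V :=
  'D_v (fun a => ch_map C i (ch_inv C (ch_at C x) a)) (ch_map C (ch_at C x) x).

Definition smooth_fun (E : normedModType R) (W : set M) (f : M -> E) : Prop :=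
  forall i, smooth_on (ch_map C i @` (W `&` ch_dom C i))
                      (fun a => f (ch_inv C i a)).

Definition smooth_field (W : set M) (X : M -> V) : Prop :=
  forall i, smooth_on (ch_map C i @` (W `&` ch_dom C i))
                      (fun a => tcoord i (ch_inv C i a) (X (ch_inv C i a))).

Definition fun_at (f : M -> R) (x : M) : Prop :=
  exists W, [/\ ch_open W, W x & smooth_fun W f].

Definition field_at (X : M -> V) (x : M) : Prop :=
  exists W, [/\ ch_open W, W x & smooth_field W X].

Definition der (E : normedModType R) (x : M) (v : V) (f : M -> E) : E :=
  'D_v (fun a => f (ch_inv C (ch_at C x) a)) (ch_map C (ch_at C x) x).

Definition bracket (X Y : M -> V) (x : M) : V :=
  let i := ch_at C x in
  der x (X x) (fun p => tcoord i p (Y p)) - der x (Y x) (fun p => tcoord i p (X p)).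

End Charts.

Record manifold (R : realType) (n : nat) (M : topologicalType)
    (C : charts 'rV[R]_n M) : Prop := Manifold {
  mfd_at : forall x, ch_dom C (ch_at C x) x;
  mfd_dom : forall i, open (ch_dom C i);
  mfd_img : forall i, open (ch_map C i @` ch_dom C i);
  mfd_mapK : forall i x, ch_dom C i x -> ch_inv C i (ch_map C i x) = x;
  mfd_map : forall i, {within ch_dom C i, continuous (ch_map C i)};
  mfd_inv : forall i,
    {within ch_map C i @` ch_dom C i, continuous (ch_inv C i)};
  mfd_smooth : forall i j,
    smooth_on (ch_map C i @` (ch_dom C i `&` ch_dom C j))
              (fun a => ch_map C j (ch_inv C i a));
  mfd_hausdorff : hausdorff_space M;
  mfd_countable : @second_countable M
}.

(* The slit tangent bundle: the natural coordinates of (x, v) in the chart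
   induced by [i] are the coordinates of [x] and the components of [v]. *)
Definition TM0 (R : realType) (V : normedModType R) (M : Type)
    (C : charts V M) : charts (V * V)%type (M * V)%type :=
  @Charts R (V * V)%type (M * V)%type (ch_idx C)
    (fun z => ch_at C z.1)
    (fun i => [set z | ch_dom C i z.1 /\ z.2 != 0])
    (fun i z => (ch_map C i z.1, tcoord i z.1 z.2))
    (fun i a => let x := ch_inv C i a.1 in
       (x, 'D_(a.2) (fun b => ch_map C (ch_at C x) (ch_inv C i b)) a.1)).

Section Finsler.
Context {R : realType} {V : normedModType R} {M : Type}.
Variable C : charts V M.
Notation P := (M * V)%type.

(* The fibre of the pull-back bundle over z = (x, v) is T_xM, that is [V];
   T_z(TM_0) is [V * V], in the natural coordinates of the preferred chart at
   [x].  Sections of the pull-back bundle are functions [P -> V]. *)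
Definition smooth_section (W : set P) (X : P -> V) : Prop :=
  forall i, smooth_on (ch_map (TM0 C) i @` (W `&` ch_dom (TM0 C) i))
    (fun a => let z := ch_inv (TM0 C) i a in tcoord (C := C) i z.1 (X z)).

Definition section_at (X : P -> V) (z : P) : Prop :=
  exists W, [/\ ch_open (TM0 C) W, W z & smooth_section W X].

(* Derivative along the fibres: for [w] the k-th basis vector this is the
   partial derivative with respect to y^k in the preferred chart. *)
Definition vder (w : V) (f : P -> R) (z : P) : R :=
  'D_w (fun y => f (z.1, y)) z.2.

Definition metric (F : P -> R) (z : P) (u w : V) : R :=
  2%:R^-1 * vder u (vder w (fun p => F p ^+ 2)) z.

Definition cartan (F : P -> R) (z : P) (u v w : V) : R :=
  4%:R^-1 * F z * vder u (vder v (vder w (fun p => F p ^+ 2))) z.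

Record finsler (F : P -> R) : Prop := Finsler {
  fin_ge0 : forall z, 0 <= F z;
  fin_smooth : smooth_fun (TM0 C) (ch_pts (TM0 C)) F;
  fin_homo : forall x y (t : R), 0 < t -> F (x, t *: y) = t * F (x, y);
  fin_pos : forall z w, ch_pts (TM0 C) z -> w != 0 -> 0 < metric F z w w
}.

Definition ell (F : P -> R) (z : P) : V := (F z)^-1 *: z.2.

(* d/dx^i |-> d_i, d/dy^i |-> 0 in natural coordinates *)
Definition rho (z : P) (u : V * V) : V := u.1.

(* A linear connection on the pull-back bundle, acting on local sections:
   [D z u X] is the derivative at [z] of a section [X] smooth near [z] along
   the tangent vector [u] at [z].  The Leibniz rule for functions smooth near
   [z] forces [D z u X] to depend only on the germ of [X] at [z]; the values
   of [D] on other arguments are irrelevant. *)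
Definition connection := P -> V * V -> (P -> V) -> V.

Definition cov (D : connection) (X : P -> V * V) (Y : P -> V) : P -> V :=
  fun z => D z (X z) Y.

Record is_connection (D : connection) : Prop := IsConnection {
  con_lin : forall z (a : R) u v X, ch_pts (TM0 C) z -> section_at X z ->
    D z (a *: u + v) X = a *: D z u X + D z v X;
  con_add : forall z u X Y, ch_pts (TM0 C) z ->
    section_at X z -> section_at Y z ->
    D z u (fun p => X p + Y p) = D z u X + D z u Y;
  con_leibniz : forall z u (f : P -> R) X, ch_pts (TM0 C) z ->
    fun_at (TM0 C) f z -> section_at X z ->
    D z u (fun p => f p *: X p) = der (TM0 C) z u f *: X z + f z *: D z u X;
  con_smooth : forall z X Y, ch_pts (TM0 C) z ->
    field_at (TM0 C) X z -> section_at Y z -> section_at (cov D X Y) z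
}.

Definition mu (F : P -> R) (D : connection) (z : P) (u : V * V) : V :=
  D z u (fun p => F p *: ell F p).

Definition finsler_connection (F : P -> R) (D : connection) : Prop :=
  is_connection D /\
  forall z, ch_pts (TM0 C) z ->
    set_bij [set u | rho z u = 0] [set: V] (mu F D z).

(* Projections of T_z(TM_0) onto the vertical and the horizontal space. *)
Definition vproj (F : P -> R) (D : connection) (z : P) (u : V * V) : V * V :=
  xget 0 [set v | rho z v = 0 /\ mu F D z (u - v) = 0].

Definition hproj (F : P -> R) (D : connection) (z : P) (u : V * V) : V * V :=
  u - vproj F D z u.

Definition lbar (F : P -> R) (D : connection) (z : P) : V * V :=
  xget 0 [set u | mu F D z u = 0 /\ rho z u = ell F z].

(* Trilinear forms on the pull-back bundle, as operations on sections. *)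
Definition triform := (P -> V) -> (P -> V) -> (P -> V) -> P -> R.

Definition cartan_form (F : P -> R) : triform :=
  fun X Y Z z => cartan F z (X z) (Y z) (Z z).

Fixpoint cartan_dot (F : P -> R) (D : connection) (j : nat) : triform :=
  if j is k.+1 then fun X Y Z z =>
    let B := cartan_dot F D k in
    der (TM0 C) z (lbar F D z) (B X Y Z)
      - B (cov D (lbar F D) X) Y Z z
      - B X (cov D (lbar F D) Y) Z z
      - B X Y (cov D (lbar F D) Z) z
  else cartan_form F.

Definition landsberg (F : P -> R) (D : connection) : Prop :=
  forall X Y Z z, ch_pts (TM0 C) z ->
    section_at X z -> section_at Y z -> section_at Z z ->
    cartan_dot F D 1 X Y Z z = 0.

(* The section T(X, Y) with g(T(X, Y), Z) = T(X, Y, Z). *)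
Definition sharp (F : P -> R) (T : triform) (X Y : P -> V) (z : P) : V :=
  xget 0 [set w | forall Z, section_at Z z -> metric F z w (Z z) = T X Y Z z].

Record compatible (F : P -> R) (D : connection) (S T : triform) : Prop :=
  Compatible {
  cmp_torsion : forall X Y z, ch_pts (TM0 C) z ->
    field_at (TM0 C) X z -> field_at (TM0 C) Y z ->
    let rhof X p := rho p (X p) in
    let muf X p := mu F D p (X p) in
    cov D X (rhof Y) z - cov D Y (rhof X) z - rhof (bracket (TM0 C) X Y) z
    = (F z)^-1 *: sharp F T (muf X) (rhof Y) z
      - (F z)^-1 *: sharp F T (muf Y) (rhof X) z;
  cmp_metric : forall Z X Y z, ch_pts (TM0 C) z ->
    field_at (TM0 C) Z z -> section_at X z -> section_at Y z ->
    let rhoZ p := rho p (Z p) in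
    let muZ p := mu F D p (Z p) in
    let A := cartan_form F in
    der (TM0 C) z (Z z) (fun p => metric F p (X p) (Y p))
      - metric F z (cov D Z X z) (Y z) - metric F z (X z) (cov D Z Y z)
    = 2%:R * A rhoZ X Y z + 2%:R * (F z)^-1 * A muZ X Y z
      - 2%:R * S rhoZ X Y z - 2%:R * (F z)^-1 * T muZ X Y z
}.

(* [kappa i] is the constant written kappa_(i+1) in the usual 1-based
   numbering. *)
Definition cartan_type_S (F : P -> R) (D : connection) (m : nat)
    (kappa : 'I_m -> R) : triform :=
  fun X Y Z z => cartan_form F X Y Z z
    + \sum_(i < m) kappa i * cartan_dot F D i.+1 X Y Z z.

Definition cartan_type (F : P -> R) (D : connection) (m : nat)
    (kappa : 'I_m -> R) : Prop :=
  finsler_connection F D /\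
  compatible F D (cartan_type_S F D kappa) (cartan_form F).

Definition curvature (D : connection) (X Y : P -> V * V) (Z : P -> V) (z : P) :
    V :=
  cov D X (cov D Y Z) z - cov D Y (cov D X Z) z
  - cov D (bracket (TM0 C) X Y) Z z.

Definition hv_curvature (F : P -> R) (D : connection)
    (X Y : P -> V * V) (Z : P -> V) (z : P) : V :=
  curvature D (fun p => hproj F D p (X p)) (fun p => vproj F D p (Y p)) Z z.

Definition hv_curvature_vanishes (F : P -> R) (D : connection) : Prop :=
  forall X Y Z z, ch_pts (TM0 C) z ->
    field_at (TM0 C) X z -> field_at (TM0 C) Y z -> section_at Z z ->
    hv_curvature F D X Y Z z = 0.

End Finsler.

(* Main.v *)
(* In a chart write g for the metric, c for the Cartan tensor (A = F c), N for the
   nonlinear connection of D, delta_u = (u, -N u) for the horizontal lift, Gamma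
   for the horizontal coefficients of D and C for the vertical ones.  The torsion
   condition makes Gamma symmetric with Gamma(u, y) = N u, and g(C(u, w), x) =
   c(u, w, x).  Since T = A, the metric condition is (D_{delta_u} g)(v, w) =
   -2 b(u, v, w) with b the sum of the kappa_j times the j-th derivatives of A.
   As D_lbar y = 0, b vanishes when its first slot is y.

   Put L(u, v) = d_v N(u) - Gamma(u, v) and let c|_u be the horizontal covariant
   derivative of c.  The first derivative of A is c|_y, and the hv-curvature P
   satisfies P(u, v) y = - L(u, v) and, when b(u, ., .) = 0,
     g(P(u, v) w, x) = c|_u(v, w, x) - g(d_v Gamma(u, w), x) - c(L(u, v), w, x).
   If P = 0, then L = 0, and u = y gives c|_y(v, w, x) = g(L(w, v), x) = 0.
   Conversely, if c|_y = 0, then all higher derivatives of A and hence b vanish.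
   Differentiating the metric condition along the fibres gives
     2 c|_u(v, w, x) - 2 c(L(u, v), w, x) =
       g(d_v Gamma(u, w), x) + g(d_v Gamma(u, x), w),
   which first yields L = 0.  Then d_v Gamma(u, w) = d_v d_w N(u) is totally
   symmetric, so c|_u(v, w, x) = g(d_v Gamma(u, w), x) and P = 0. *)
From HB Require Import structures.
Require Import Defs.
From mathcomp Require Import all_boot all_order all_algebra.
From mathcomp Require Import all_classical all_reals all_analysis.
From mathcomp Require Import ring lra.

Set Implicit Arguments.
Unset Strict Implicit.
Unset Printing Implicit Defensive.

Import Order.TTheory GRing.Theory Num.Theory.
Import numFieldNormedType.Exports.

Local Open Scope classical_set_scope.
Local Open Scope ring_scope.

(** * Calculus in normed spaces with a finite frame *)

Section Differential.
Context {R : realType}.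
Implicit Types E W : normedModType R.

(** The obstacle is that [D] is only implicitly determined: its own iterated derivatives of A enter
    S, so the horizontal coefficients of [D] have no closed formula to compute with. The proof
    therefore never solves for [D]. For arbitrary constants it relies on the torsion condition, in
    which S does not occur, and on the parallelism of g along vectors lying over y; parallelism
    along all vectors becomes available only once A is known to be constant along [lbar].

    Using c instead of A removes F from the formulas: the fibre derivative of g is exactly 2c, the
    torsion condition contains F^-1 A = c, and the factor F^-1 of [lbar] compensates the F in A
    because F is constant along the horizontal lift of y.

    The given [D] is an operator on local sections, and [sharp], [lbar] and [vproj] are choices with
    default values. These are first replaced by explicit functions on an open subset of V * V, where
    the tensor computations are pure calculus. The model space stays abstract and carries a finite
    frame, because vectors tangent to TM_0 live in V * V and both spaces need the same calculus. *)

Lemma near_eq_differentiable E W (f g : E -> W) a :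
  {near a, f =1 g} -> differentiable f a -> differentiable g a.
Proof.
move=> fg df.
have ga : g a = f a by rewrite (nbhs_singleton fg).
have e0 : g \o shift a = cst (g a) + 'd f a +o_ 0 id.
  apply/eqaddoP => e e0.
  have /eqaddoP/(_ e e0) h := diff_locally df.
  have fg0 : \forall y \near 0, f (y + a) = g (y + a).
    by move: fg; rewrite (near_shift 0 a)/=; apply: filterS => y; rewrite /= subr0.
  apply: filterS2 h fg0 => y.
  rewrite -[(_ - _) y]/(f (y + a) - (f a + 'd f a y)).
  by rewrite -[(_ - (cst (g a) + _)) y]/(g (y + a) - (g a + 'd f a y)) ga => + <-.
have dg : 'd g a = 'd f a :> (_ -> _).
  by apply: diff_unique => //; exact: diff_continuous.
by apply/diff_locallyP; rewrite dg; split => //; exact: diff_continuous.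
Qed.

Lemma open_near E (U : set E) (P : E -> Prop) a : open U -> U a ->
  (forall b, U b -> P b) -> \forall b \near a, P b.
Proof. by move=> oU Ua h; apply: filterS (open_nbhs_nbhs (conj oU Ua)). Qed.

Lemma eq_open_derive E W (U : set E) (f g : E -> W) a v : open U -> U a ->
  (forall b, U b -> f b = g b) -> 'D_v f a = 'D_v g a.
Proof. by move=> oU Ua h; apply: near_eq_derive; exact: open_near oU Ua h. Qed.

Lemma derive_lin E W (f : E -> W) a c u v : differentiable f a ->
  'D_(c *: u + v) f a = c *: 'D_u f a + 'D_v f a.
Proof. by move=> df; rewrite !deriveE// linearP. Qed.

Lemma derive_comp E E' W (f : E -> E') (g : E' -> W) a v :
  differentiable f a -> differentiable g (f a) ->
  'D_v (fun x => g (f x)) a = 'D_('D_v f a) g (f a).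
Proof.
move=> df dg; rewrite deriveE; last exact: differentiable_comp.
by rewrite [X in X v]diff_comp//= -!deriveE.
Qed.

Lemma derive_linear E W (f : {linear E -> W}) a v : continuous f ->
  'D_v f a = f v.
Proof.
move=> cf; rewrite deriveE; last exact: linear_differentiable.
by rewrite diff_lin.
Qed.

(** Lets scalar multiplication be packed as a bilinear map; differentiability of [f *: g] and the
    product rule then both come from the differential of a bilinear map. *)
Lemma scale_is_bilinear W :
  bilinear_for
    (GRing.Scale.Law.clone _ _ *:%R _) (GRing.Scale.Law.clone _ _ *:%R _)
    (fun (c : R) (w : W) => c *: w).
Proof.
split=> [u'|u] a x y /=.
- by rewrite scalerDl scalerA.
- by rewrite scalerDr !scalerA mulrC.
Qed.

Lemma differentiable_scale E W (f : E -> R) (g : E -> W) a :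
  differentiable f a -> differentiable g a ->
  differentiable (fun x => f x *: g x) a.
Proof.
move=> df dg.
pose bM := bilinear_isBilinear.Build R R W W _ _ _ (@scale_is_bilinear W).
pose b : {bilinear R -> W -> W} := HB.pack (fun (c : R) (w : W) => c *: w) bM.
apply: (@differentiable_comp _ _ _ _ (fun x => (f x, g x)) (fun p => b p.1 p.2)).
  exact: differentiable_pair.
by apply: differentiable_bilin => p; apply: scale_continuous.
Qed.

Lemma derive_scale E W (f : E -> R) (g : E -> W) a v :
  differentiable f a -> differentiable g a ->
  'D_v (fun x => f x *: g x) a = 'D_v f a *: g a + f a *: 'D_v g a.
Proof.
move=> df dg; rewrite deriveE; last exact: differentiable_scale.
pose bM := bilinear_isBilinear.Build R R W W _ _ _ (@scale_is_bilinear W).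
pose b : {bilinear R -> W -> W} := HB.pack (fun (c : R) (w : W) => c *: w) bM.
have cb : continuous (fun p => b p.1 p.2) by move=> p; apply: scale_continuous.
rewrite [X in X v](@diff_comp _ _ _ _ (fun x => (f x, g x)) (fun p => b p.1 p.2)); last 2 first.
- exact: differentiable_pair.
- exact: differentiable_bilin.
rewrite -[LHS]/('d (fun p => b p.1 p.2) (f a, g a) ('d (fun x => (f x, g x)) a v)).
by rewrite diff_bilin// diff_pair//= addrC !deriveE.
Qed.

Lemma derive_pair E W W' (f : E -> W) (g : E -> W') a v :
  differentiable f a -> differentiable g a ->
  'D_v (fun x => (f x, g x)) a = ('D_v f a, 'D_v g a).
Proof.
move=> df dg; rewrite deriveE; last exact: differentiable_pair.
by rewrite diff_pair// !deriveE.
Qed.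

Lemma differentiable_bigsum E W (I : Type) (r : seq I) (f : I -> E -> W) a :
  (forall i, differentiable (f i) a) ->
  differentiable (fun x => \sum_(i <- r) f i x) a.
Proof.
move=> df; elim: r => [|i r IH].
  by under eq_fun do rewrite big_nil; exact: differentiable_cst.
by under eq_fun do rewrite big_cons; exact: differentiableD.
Qed.

Lemma derive_bigsum E W (I : Type) (r : seq I) (f : I -> E -> W) a v :
  (forall i, differentiable (f i) a) ->
  'D_v (fun x => \sum_(i <- r) f i x) a = \sum_(i <- r) 'D_v (f i) a.
Proof.
move=> df; elim: r => [|i r IH].
  by under eq_fun do rewrite big_nil; rewrite big_nil derive_cst.
under eq_fun do rewrite big_cons.
rewrite big_cons -IH -[LHS]/('D_v (f i \+ (fun x => \sum_(j <- r) f j x)) a).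
by rewrite deriveD//; apply: diff_derivable => //; exact: differentiable_bigsum.
Qed.

(** Stands in for finite dimension: continuous linear coordinates that reproduce every vector from
    finitely many fixed ones. Both [V] and [V * V] carry such a family, so moving directions and
    moving arguments reduce to fixed ones. *)
Record frame E := Frame {
  fr_idx : finType;
  fr_vec : fr_idx -> E;
  fr_co : fr_idx -> {linear E -> R};
  fr_cont : forall k, continuous (fr_co k);
  frE : forall x, x = \sum_k fr_co k x *: fr_vec k
}.

Definition row_co n (k : 'I_n) (x : 'rV[R]_n) : R := x 0 k.

Fact row_co_is_linear n k : linear (@row_co n k).
Proof. by move=> c x y; rewrite /row_co !mxE. Qed.
HB.instance Definition _ n k :=
  GRing.isLinear.Build R 'rV[R]_n R _ (@row_co n k) (@row_co_is_linear n k).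

Definition row_frame n : frame 'rV[R]_n.
Proof.
exists 'I_n (fun k => delta_mx 0 k) (fun k => @row_co n k : {linear 'rV[R]_n -> R}).
- by move=> k x; apply: coord_continuous.
- exact: row_sum_delta.
Defined.

Definition pair_co E E' (B : frame E) (B' : frame E') (k : fr_idx B + fr_idx B')
    (x : E * E') : R :=
  match k with inl k => fr_co k x.1 | inr k => fr_co k x.2 end.

Fact pair_co_is_linear E E' (B : frame E) (B' : frame E') k :
  linear (@pair_co E E' B B' k).
Proof. by case: k => k c x y; rewrite /= linearP. Qed.
HB.instance Definition _ E E' (B : frame E) (B' : frame E') k :=
  GRing.isLinear.Build R (E * E')%type R _ (@pair_co E E' B B' k)
    (@pair_co_is_linear E E' B B' k).

Definition pair_frame E E' (B : frame E) (B' : frame E') : frame (E * E')%type.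
Proof.
exists (fr_idx B + fr_idx B')%type
  (fun k => match k with inl k => (fr_vec k, 0) | inr k => (0, fr_vec k) end)
  (fun k => pair_co k : {linear (E * E')%type -> R}).
- case=> k x /=.
    by apply: (@continuous_comp _ _ _ fst (fr_co k)); [exact: cvg_fst|exact: fr_cont].
  by apply: (@continuous_comp _ _ _ snd (fr_co k)); [exact: cvg_snd|exact: fr_cont].
- move=> [x1 x2]; rewrite big_sumType/= {1}(frE B x1) {1}(frE B' x2).
  rewrite [RHS]surjective_pairing; congr pair.
    rewrite (raddfD fst)/= !(raddf_sum fst)/= [X in _ + X]big1 ?addr0// => k _.
    by rewrite scaler0.
  rewrite (raddfD snd)/= !(raddf_sum snd)/= [X in X + _]big1 ?add0r// => k _.
  by rewrite scaler0.
Defined.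

Lemma frame_linear_continuous E W (B : frame E) (f : {linear E -> W}) : continuous f.
Proof.
have -> : (f : E -> W) = (fun x => \sum_k fr_co k x *: f (fr_vec (f:=B) k)).
  apply/funext => x; rewrite {1}(frE B x) linear_sum.
  by apply: eq_bigr => k _; rewrite linearZ.
move=> x; apply: differentiable_continuous; apply: differentiable_bigsum => k.
apply: differentiableZl; apply: linear_differentiable; exact: fr_cont.
Qed.

Lemma derive_frame E W (B : frame E) (f : E -> W) a v : differentiable f a ->
  'D_v f a = \sum_k fr_co k v *: 'D_(fr_vec (f:=B) k) f a.
Proof.
move=> df; rewrite deriveE// {1}(frE B v) linear_sum.
by apply: eq_bigr => k _; rewrite linearZ deriveE.
Qed.

End Differential.

(** * Closure properties of smooth maps *)

Section Smooth.
Context {R : realType}.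
Implicit Types E W : normedModType R.

Lemma ndiff_sub k E W (U U' : set E) (f : E -> W) :
  U' `<=` U -> ndifferentiable k U f -> ndifferentiable k U' f.
Proof.
elim: k f => //= k IH f sU [df dDf]; split; first by move=> a /sU; exact: df.
by move=> v; apply: IH.
Qed.

(** The conditions are imposed point by point, so the set may vary with the point. This glues the
    local smoothness that a connection provides. *)
Lemma ndiff_local k E W (U : set E) (f : E -> W) :
  (forall a, U a -> exists2 U', U' a & ndifferentiable k U' f) ->
  ndifferentiable k U f.
Proof.
elim: k f => //= k IH f h; split=> [a /h [U' U'a [df _]]|v]; first exact: df.
by apply: IH => a /h [U' U'a [_ dDf]]; exists U'.
Qed.

(** Openness turns equality on [U] into equality of germs, so the directional derivatives also agree
    on [U] and the induction goes on. *)
Lemma ndiff_eq k E W (U : set E) (f g : E -> W) : open U ->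
  (forall b, U b -> f b = g b) -> ndifferentiable k U f -> ndifferentiable k U g.
Proof.
move=> oU; elim: k f g => //= k IH f g fg [df dDf]; split=> [a Ua|v].
  by apply: near_eq_differentiable (df _ Ua); exact: open_near oU Ua fg.
by apply: IH (dDf v) => b Ub; exact: eq_open_derive fg.
Qed.

Lemma ndiffW k E W (U : set E) (f : E -> W) :
  ndifferentiable k.+1 U f -> ndifferentiable k U f.
Proof.
elim: k f => // k IH f [df dDf]; split=> // v.
exact: IH (dDf v).
Qed.

Lemma ndiff_cst k E W (U : set E) (w : W) : ndifferentiable k U (fun _ => w).
Proof.
elim: k w => //= k IH w; split=> [a _|v]; first exact: differentiable_cst.
by under eq_fun do rewrite derive_cst; exact: IH.
Qed.

Lemma ndiffD k E W (U : set E) (f g : E -> W) : open U ->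
  ndifferentiable k U f -> ndifferentiable k U g ->
  ndifferentiable k U (fun a => f a + g a).
Proof.
move=> oU; elim: k f g => //= k IH f g [df dDf] [dg dDg]; split=> [a Ua|v].
  by apply: differentiableD; [exact: df|exact: dg].
apply: (ndiff_eq (f := fun a => 'D_v f a + 'D_v g a)) => // [b Ub|]; last exact: IH.
by rewrite -deriveD//; apply: diff_derivable; [exact: df|exact: dg].
Qed.

Lemma ndiff_sum k E W (U : set E) (I : Type) (r : seq I) (f : I -> E -> W) :
  open U -> (forall i, ndifferentiable k U (f i)) ->
  ndifferentiable k U (fun a => \sum_(i <- r) f i a).
Proof.
move=> oU df; elim: r => [|i r IH].
  by under eq_fun do rewrite big_nil; exact: ndiff_cst.
by under eq_fun do rewrite big_cons; exact: ndiffD.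
Qed.

Lemma ndiff_lin k E W W' (U : set E) (l : {linear W -> W'}) (f : E -> W) :
  continuous l -> open U -> ndifferentiable k U f ->
  ndifferentiable k U (fun a => l (f a)).
Proof.
move=> cl oU; elim: k f => //= k IH f [df dDf]; split=> [a Ua|v].
  by apply: differentiable_comp; [exact: df|exact: linear_differentiable].
apply: (ndiff_eq (f := fun a => l ('D_v f a))) => // [b Ub|]; last exact: IH.
rewrite (derive_comp (g := l)) ?derive_linear//; first exact: df.
exact: linear_differentiable.
Qed.

Lemma ndiff_linear k E W (U : set E) (l : {linear E -> W}) :
  continuous l -> ndifferentiable k U l.
Proof.
move=> cl; case: k => //= k; split=> [a _|v]; first exact: linear_differentiable.
by under eq_fun do rewrite derive_linear//; exact: ndiff_cst.
Qed.

Lemma ndiffZ k E W (U : set E) (f : E -> R) (g : E -> W) : open U ->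
  ndifferentiable k U f -> ndifferentiable k U g ->
  ndifferentiable k U (fun a => f a *: g a).
Proof.
move=> oU; elim: k f g => // k IH f g nf ng; split=> [a Ua|v].
  by apply: differentiable_scale; [exact: (nf.1)|exact: (ng.1)].
apply: (ndiff_eq (f := fun a => 'D_v f a *: g a + f a *: 'D_v g a)) => // [b Ub|].
  by rewrite derive_scale//; [exact: (nf.1)|exact: (ng.1)].
apply: ndiffD => //; apply: IH; [exact: (nf.2)|exact: ndiffW|exact: ndiffW|exact: (ng.2)].
Qed.

Lemma ndiff_pair k E W W' (U : set E) (f : E -> W) (g : E -> W') : open U ->
  ndifferentiable k U f -> ndifferentiable k U g ->
  ndifferentiable k U (fun a => (f a, g a)).
Proof.
move=> oU; elim: k f g => //= k IH f g [df dDf] [dg dDg]; split=> [a Ua|v].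
  by apply: differentiable_pair; [exact: df|exact: dg].
apply: (ndiff_eq (f := fun a => ('D_v f a, 'D_v g a))) => // [b Ub|]; last exact: IH.
by rewrite derive_pair//; [exact: df|exact: dg].
Qed.

Lemma ndiff_inv k E (U : set E) (f : E -> R) : open U ->
  (forall a, U a -> f a != 0) ->
  ndifferentiable k U f -> ndifferentiable k U (fun a => (f a)^-1).
Proof.
move=> oU f0; elim: k f f0 => // k IH f f0 nf.
have df a : U a -> differentiable f a by apply: nf.1.
split=> [a Ua|v]; first by apply: differentiableV; [exact: df|exact: f0].
(* The derivative of [1 / f] is again built from [1 / f], which the induction hypothesis covers at
   one order less. *)
apply: (ndiff_eq (f := fun a => (- 1) *: (((f a)^-1 *: (f a)^-1) *: 'D_v f a))) => //.
  move=> b Ub; rewrite [RHS]deriveV ?f0//; last exact/diff_derivable/df.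
  by rewrite scaleN1r scaleNr expr2 invfM.
apply: ndiffZ => //; first exact: ndiff_cst.
have nV := IH _ f0 (ndiffW nf).
apply: ndiffZ; [exact: oU| exact: ndiffZ|exact: nf.2].
Qed.

(** The chain rule differentiates [g] in the moving direction ['D_v f], whereas [ndifferentiable]
    speaks of fixed directions. The frame expands the former into the latter with smooth
    coefficients. *)
Lemma ndiff_comp k E E' W (B : frame E') (U : set E) (U' : set E')
    (f : E -> E') (g : E' -> W) : open U -> open U' ->
  (forall a, U a -> U' (f a)) ->
  ndifferentiable k U f -> ndifferentiable k U' g ->
  ndifferentiable k U (fun a => g (f a)).
Proof.
move=> oU oU' fU; elim: k f g fU => // k IH f g fU nf ng; split=> [a Ua|v].
  by apply: differentiable_comp; [exact: nf.1|apply: ng.1; exact: fU].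
apply: (ndiff_eq (f := fun a => \sum_k fr_co k ('D_v f a) *:
                        'D_(fr_vec (f:=B) k) g (f a))) => // [b Ub|].
  have dg : differentiable g (f b) by apply: ng.1; exact: fU.
  have df : differentiable f b by exact: nf.1.
  by rewrite (derive_comp _ df dg) (derive_frame B).
apply: ndiff_sum => // i; apply: ndiffZ => //.
  by apply: ndiff_lin => //; [exact: fr_cont|exact: nf.2].
apply: (IH f ('D_(fr_vec i) g)) => //; [exact: ndiffW|exact: ng.2].
Qed.

(** * Families of linear maps depending on a point *)

Section FiberwiseLinear.
Variables (E E' W : normedModType R) (B : frame E') (U : set E).
Variables (L : E -> E' -> W).
Hypothesis oU : open U.
Hypothesis linL : forall a, U a -> linear (L a).

Lemma fiber_linear_frame a x : U a ->
  L a x = \sum_k fr_co k x *: L a (fr_vec (f:=B) k).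
Proof.
move=> Ua.
pose lM := GRing.isLinear.Build _ _ _ _ _ (linL Ua).
pose l : {linear E' -> W} := HB.pack (L a) lM.
rewrite -[L a]/(l : _ -> _) {1}(frE B x) linear_sum.
by apply: eq_bigr => k _; rewrite linearZ.
Qed.

Lemma ndiff_fiber_linear k (f : E -> E') :
  (forall w, ndifferentiable k U (fun a => L a w)) ->
  ndifferentiable k U f -> ndifferentiable k U (fun a => L a (f a)).
Proof.
move=> nL nf.
apply: (ndiff_eq (f := fun a => \sum_k fr_co k (f a) *: L a (fr_vec (f:=B) k))) => //.
  by move=> b Ub; rewrite -fiber_linear_frame.
by apply: ndiff_sum => // i; apply: ndiffZ => //; apply: ndiff_lin => //; exact: fr_cont.
Qed.

Lemma differentiable_fiber_linear (f : E -> E') a : U a ->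
  (forall w, differentiable (fun b => L b w) a) ->
  differentiable f a -> differentiable (fun b => L b (f b)) a.
Proof.
move=> Ua dL df.
apply: (@near_eq_differentiable _ _ _
  (fun b => \sum_k fr_co k (f b) *: L b (fr_vec (f:=B) k))).
  by apply: open_near oU Ua _ => b Ub; rewrite -fiber_linear_frame.
apply: differentiable_bigsum => i; apply: differentiable_scale => //.
by apply: differentiable_comp => //; apply: linear_differentiable; exact: fr_cont.
Qed.

(** Expanding [f] in the frame reduces this to the scalar product rule. It serves for metrics,
    trilinear forms and connection forms, and also for derivatives in a moving direction, which are
    linear in that direction. *)
Lemma derive_fiber_linear (f : E -> E') a v : U a ->
  (forall w, differentiable (fun b => L b w) a) ->
  differentiable f a ->
  'D_v (fun b => L b (f b)) a = 'D_v (fun b => L b (f a)) a + L a ('D_v f a).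
Proof.
move=> Ua dL df.
have dc i x : differentiable (fr_co (f:=B) i) x.
  by apply: linear_differentiable; exact: fr_cont.
have dcf i : differentiable (fun b => fr_co (f:=B) i (f b)) a.
  exact: differentiable_comp.
rewrite (@eq_open_derive _ _ _ U _
  (fun b => \sum_k fr_co k (f b) *: L b (fr_vec (f:=B) k)))//; last first.
  by move=> b Ub; rewrite -fiber_linear_frame.
rewrite derive_bigsum => [|i]; last exact: differentiable_scale.
transitivity (\sum_k (fr_co k ('D_v f a) *: L a (fr_vec (f:=B) k) +
    fr_co k (f a) *: 'D_v (fun b => L b (fr_vec (f:=B) k)) a)).
  apply: eq_bigr => i _; rewrite derive_scale// (derive_comp v df (dc i _)).
  by rewrite derive_linear//; exact: fr_cont.
rewrite big_split/= -fiber_linear_frame// addrC; congr (_ + _).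
rewrite (@eq_open_derive _ _ _ U (fun b => L b (f a))
  (fun b => \sum_k fr_co k (f a) *: L b (fr_vec (f:=B) k)))//; last first.
  by move=> b Ub; rewrite -fiber_linear_frame.
rewrite derive_bigsum => [|i]; last exact: differentiableZ.
by apply: eq_bigr => i _; rewrite [RHS]deriveZ//; exact: diff_derivable.
Qed.

End FiberwiseLinear.

End Smooth.

(** * Symmetry of second derivatives *)

Section Schwarz.
Context {R : realType}.
Implicit Types E W : normedModType R.

Lemma derive_line E W (f : E -> W) (a w : E) (s : R) : differentiable f (a + s *: w) ->
  is_derive s 1 (fun r : R => f (a + r *: w)) ('D_w f (a + s *: w)).
Proof.
move=> df.
have dl : is_diff s (fun r : R => a + r *: w) (fun r => 0 + r *: w) by exact: is_diffD.
have dlw : 'D_1 (fun r : R => a + r *: w) s = w.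
  by rewrite deriveE// diff_val/= scale1r add0r.
have dc : differentiable (fun r : R => f (a + r *: w)) s.
  by apply: (@differentiable_comp _ _ _ _ (fun r : R => a + r *: w) f).
apply: DeriveDef; first exact: diff_derivable.
by rewrite (@derive_comp _ _ _ _ (fun r : R => a + r *: w) f) ?dlw.
Qed.

Lemma mean_value E (f : E -> R) (a w : E) (t : R) : 0 < t ->
  (forall s, 0 <= s <= t -> differentiable f (a + s *: w)) ->
  exists2 s, 0 <= s <= t & f (a + t *: w) - f a = t * 'D_w f (a + s *: w).
Proof.
move=> t0 df.
have [|x|s] := @MVT R (fun r => f (a + r *: w)) (fun r => 'D_w f (a + r *: w)) 0 t t0.
- move=> x; rewrite in_itv/= => /andP[x0 xt]; apply: derive_line; apply: df.
  by rewrite !ltW.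
- apply: derivable_within_continuous => {}x; rewrite in_itv/= => xt.
  by have /@ex_derive := derive_line (df _ xt).
- rewrite in_itv/= => /andP[s0 st]; rewrite scale0r addr0 subr0 => e.
  by exists s; [rewrite !ltW|rewrite e mulrC].
Qed.

(** The mean value theorem is used along [v] for the difference [f (x + t u) - f x], and then along
    [u] for ['D_v f]. *)
Lemma mean_value2 E (f : E -> R) (a u v : E) (t : R) (U : set E) : 0 < t ->
  open U -> ndifferentiable 2 U f ->
  (forall s r, 0 <= s <= t -> 0 <= r <= t -> U (a + s *: u + r *: v)) ->
  exists s r, [/\ 0 <= s <= t, 0 <= r <= t &
    f (a + t *: u + t *: v) - f (a + t *: u) - f (a + t *: v) + f a
    = t ^+ 2 * 'D_u ('D_v f) (a + s *: u + r *: v)].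
Proof.
move=> t0 oU [df dDf] box.
have tt : 0 <= t <= t by rewrite lexx ltW.
have t00 : 0 <= (0 : R) <= t by rewrite lexx ltW.
pose g x := f (x + t *: u) - f x.
have dsh (x w z : E) : differentiable f (x + w) ->
    differentiable (fun y => f (y + w)) x /\
    'D_z (fun y => f (y + w)) x = 'D_z f (x + w).
  move=> dfx.
  have ds : is_diff x (fun y : E => y + w) (fun y => y + 0) by exact: is_diffD.
  split; first exact: (@differentiable_comp _ _ _ _ (fun y : E => y + w) f).
  rewrite (@derive_comp _ _ _ _ (fun y : E => y + w) f)//.
  by congr ('D_ _ f _); rewrite deriveE// diff_val/= addr0.
have dfa s r : 0 <= s <= t -> 0 <= r <= t -> differentiable f (a + s *: u + r *: v).
  by move=> hs hr; apply: df; exact: box.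
have dfav r : 0 <= r <= t -> differentiable f (a + r *: v).
  by move=> hr; have := dfa 0 r t00 hr; rewrite scale0r addr0.
have dfavt r : 0 <= r <= t -> differentiable f (a + r *: v + t *: u).
  by move=> hr; have := dfa t r tt hr; rewrite addrAC.
have [|r hr e1] := @mean_value E g a v t t0.
  move=> r hr; apply: differentiableB; last exact: dfav.
  by have [] := dsh (a + r *: v) (t *: u) 0 (dfavt _ hr).
have [|s hs e2] := @mean_value E ('D_v f) (a + r *: v) u t t0.
  move=> s hs; apply: (dDf v).1; rewrite addrAC; exact: box.
exists s, r; split; [exact: hs|exact: hr|].
have -> : f (a + t *: u + t *: v) - f (a + t *: u) - f (a + t *: v) + f a =
          g (a + t *: v) - g a.
  by rewrite /g [a + t *: v + t *: u]addrAC; ring.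
rewrite e1 expr2 -mulrA; congr (_ * _).
rewrite [a + s *: u + _]addrAC -e2.
have [d1 d2] := dsh (a + r *: v) (t *: u) v (dfavt _ hr).
by rewrite -d2; apply: deriveB; apply: diff_derivable => //; exact: dfav.
Qed.

(** The second difference over a small parallelogram is symmetric in [u] and [v], so the two mixed
    derivatives take a common value at two points close to [a], and continuity at [a] concludes.
    Order 3 makes the mixed derivatives differentiable, hence continuous. *)
Lemma derive_commute_real E (U : set E) (f : E -> R) a u v : open U -> U a ->
  ndifferentiable 3 U f -> 'D_u ('D_v f) a = 'D_v ('D_u f) a.
Proof.
move=> oU Ua nf.
have c1 : {for a, continuous ('D_u ('D_v f))}.
  by apply: differentiable_continuous; have [_ /(_ v)[_ /(_ u)[+ _]]] := nf; exact.
have c2 : {for a, continuous ('D_v ('D_u f))}.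
  by apply: differentiable_continuous; have [_ /(_ u)[_ /(_ v)[+ _]]] := nf; exact.
apply/eqP; rewrite -subr_eq0 -normr_le0; apply/ler_addgt0Pl => e e0; rewrite addr0.
have e2 : 0 < e / 2 by rewrite divr_gt0.
have tri (x y z : R) : `|x - z| < e / 2 -> `|y - z| < e / 2 -> `|x - y| <= e.
  move=> h1 h2; rewrite [leRHS]splitr; apply: le_trans (ler_distD z _ _) _.
  by rewrite [`|z - _|]distrC ltW// ltrD.
have /nbhs_ballP[d /= d0 hd] : \forall b \near a,
    [/\ U b, `|'D_u ('D_v f) a - 'D_u ('D_v f) b| < e / 2 &
        `|'D_v ('D_u f) a - 'D_v ('D_u f) b| < e / 2].
  have h1 := open_nbhs_nbhs (conj oU Ua).
  have h2 : \forall b \near a, `|'D_u ('D_v f) a - 'D_u ('D_v f) b| < e / 2.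
    exact: (cvgrPdist_lt _ _).1 c1 _ e2.
  have h3 : \forall b \near a, `|'D_v ('D_u f) a - 'D_v ('D_u f) b| < e / 2.
    exact: (cvgrPdist_lt _ _).1 c2 _ e2.
  apply: filterS (filterI h1 (filterI h2 h3)) => b [Ub [hb1 hb2]].
  by split; [exact: Ub|exact: hb1|exact: hb2].
(* The summand 1 keeps [M] positive when [u = v = 0]; with side [d / (2 M)] the parallelogram stays
   inside the ball of radius [d]. *)
pose M := `|u| + `|v| + 1.
have M0 : 0 < M by rewrite ltr_wpDl// addr_ge0.
pose t := d / (2 * M).
have t0 : 0 < t by rewrite divr_gt0// mulr_gt0.
have inball s r : 0 <= s <= t -> 0 <= r <= t -> ball a d (a + s *: u + r *: v).
  move=> /andP[s0 st] /andP[r0 rt]; rewrite -ball_normE /= -addrA opprD addrA subrr add0r normrN.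
  rewrite (le_lt_trans (ler_normD _ _))// !normrZ !ger0_norm//.
  apply: (@le_lt_trans _ _ (t * (`|u| + `|v|))).
    by rewrite mulrDr lerD// ler_wpM2r.
  apply: (@le_lt_trans _ _ (t * M)).
    by rewrite ler_wpM2l ?ltW// /M ltrDl.
  by rewrite /t invfM mulrA divfK ?gt_eqF// ltr_pdivrMr// ltr_pMr// ltr1n.
have nf2 : ndifferentiable 2 U f by exact: ndiffW.
have boxU s r : 0 <= s <= t -> 0 <= r <= t -> U (a + s *: u + r *: v).
  by move=> hs hr; have [] := hd _ (inball _ _ hs hr).
have [s [r [hs hr e3]]] := mean_value2 t0 oU nf2 boxU.
have boxU' r' s' : 0 <= r' <= t -> 0 <= s' <= t -> U (a + r' *: v + s' *: u).
  by move=> hr' hs'; rewrite addrAC; exact: boxU.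
have [r' [s' [hr' hs' e4]]] := mean_value2 t0 oU nf2 boxU'.
have e5 : 'D_u ('D_v f) (a + s *: u + r *: v) = 'D_v ('D_u f) (a + r' *: v + s' *: u).
  apply: (@mulfI _ (t ^+ 2)); first by rewrite expf_neq0// gt_eqF.
  apply: etrans (esym e3) _; apply: etrans _ e4.
  by rewrite [a + t *: v + t *: u]addrAC; ring.
have [_ h1 _] := hd _ (inball _ _ hs hr).
have [_ _] := hd _ (inball _ _ hs' hr').
rewrite [a + s' *: u + _]addrAC -e5; move: h1.
exact: tri.
Qed.

Lemma derive_commute E W (B : frame W) (U : set E) (f : E -> W) a u v :
  open U -> U a -> ndifferentiable 3 U f -> 'D_u ('D_v f) a = 'D_v ('D_u f) a.
Proof.
move=> oU Ua nf.
have co k w w' : fr_co (f:=B) k ('D_w ('D_w' f) a)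
    = 'D_w ('D_w' (fun x => fr_co (f:=B) k (f x))) a.
  have dco x : differentiable (fr_co (f:=B) k) x.
    by apply: linear_differentiable; exact: fr_cont.
  have dD : differentiable ('D_w' f) a by apply: (nf.2 w').1.
  transitivity ('D_w (fun x => fr_co (f:=B) k ('D_w' f x)) a).
    by rewrite (derive_comp _ dD (dco _)) derive_linear//; exact: fr_cont.
  apply: (eq_open_derive _ oU) => // x Ux.
  have df : differentiable f x by apply: nf.1.
  by rewrite (derive_comp _ df (dco _)) derive_linear//; exact: fr_cont.
have comm k : fr_co (f:=B) k ('D_u ('D_v f) a) = fr_co (f:=B) k ('D_v ('D_u f) a).
  apply: etrans (co _ _ _) _; apply: etrans _ (esym (co _ _ _)).
  apply: (derive_commute_real _ _ oU Ua).
  by apply: ndiff_lin => //; exact: fr_cont.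
apply: etrans (frE B _) _; apply: etrans _ (esym (frE B _)).
by apply: eq_bigr => k _; rewrite comm.
Qed.

End Schwarz.
(** * Charts *)

Section Atlas.
Context {R : realType} {V : normedModType R} {M : Type}.
Variables (B : frame V) (C : charts V M).

(** The smooth structure expressed in the model space alone, so that it can be verified for [TM0 C]
    without a topology on [M * V]. The field [at_dom] is restricted to [ch_pts], because zero
    vectors lie in no chart of [TM0 C]. *)
Record atlas : Prop := Atlas {
  at_dom : forall x, ch_pts C x -> ch_dom C (ch_at C x) x;
  at_mapK : forall i x, ch_dom C i x -> ch_inv C i (ch_map C i x) = x;
  at_open : forall i j, open (ch_map C i @` (ch_dom C i `&` ch_dom C j));
  at_smooth : forall i j,
    smooth_on (ch_map C i @` (ch_dom C i `&` ch_dom C j))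
              (fun a => ch_map C j (ch_inv C i a))
}.

Hypothesis hC : atlas.

Definition overlap (i j : ch_idx C) : set V :=
  ch_map C i @` (ch_dom C i `&` ch_dom C j).
Definition trans (i j : ch_idx C) (a : V) : V := ch_map C j (ch_inv C i a).

Lemma ch_pts_dom i x : ch_dom C i x -> ch_pts C x.
Proof. by move=> ix; exists i. Qed.

Lemma at_dom' i x : ch_dom C i x -> ch_dom C (ch_at C x) x.
Proof. by move=> /ch_pts_dom; exact: at_dom. Qed.

Lemma overlapP i j x : ch_dom C i x -> ch_dom C j x -> overlap i j (ch_map C i x).
Proof. by move=> ix jx; exists x. Qed.

Lemma overlap_inv i j a : overlap i j a ->
  exists x, [/\ ch_dom C i x, ch_dom C j x, ch_map C i x = a & ch_inv C i a = x].
Proof. by case=> x [ix jx] <-; exists x; split=> //; exact: at_mapK. Qed.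

Lemma overlap_open i j : open (overlap i j). Proof. exact: at_open. Qed.

Lemma trans_map i j x : ch_dom C i x -> trans i j (ch_map C i x) = ch_map C j x.
Proof. by move=> ix; rewrite /trans at_mapK. Qed.

Lemma inv_trans i j a : overlap i j a -> ch_inv C j (trans i j a) = ch_inv C i a.
Proof.
by case/overlap_inv => x [ix jx <- _]; rewrite trans_map// !at_mapK.
Qed.

Lemma trans_smooth i j : smooth_on (overlap i j) (trans i j).
Proof. exact: at_smooth. Qed.

Lemma trans_differentiable i j a : overlap i j a -> differentiable (trans i j) a.
Proof. by move=> ija; exact: (trans_smooth i j 1).1. Qed.

Definition jac (i j : ch_idx C) (a : V) (v : V) : V := 'D_v (trans i j) a.

Lemma tcoordE i x v : tcoord i x v = jac (ch_at C x) i (ch_map C (ch_at C x) x) v.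
Proof. by []. Qed.

Lemma jac_linear i j a : overlap i j a -> linear (jac i j a).
Proof. by move=> ija c u v; rewrite /jac derive_lin//; exact: trans_differentiable. Qed.

Lemma jac_smooth i j w : smooth_on (overlap i j) (fun a => jac i j a w).
Proof. by move=> k; exact: (trans_smooth i j k.+1).2. Qed.

Lemma jac_id i x v : ch_dom C i x -> jac i i (ch_map C i x) v = v.
Proof.
move=> ix; rewrite /jac (@eq_open_derive _ _ _ (overlap i i) _ id).
- exact: derive_id.
- exact: overlap_open.
- exact: overlapP.
- by move=> b /overlap_inv [y [iy _ <- _]]; exact: trans_map.
Qed.

Lemma jac_comp i j k x v : ch_dom C i x -> ch_dom C j x -> ch_dom C k x ->
  jac j k (ch_map C j x) (jac i j (ch_map C i x) v) = jac i k (ch_map C i x) v.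
Proof.
move=> ix jx kx; rewrite /jac.
have dij : differentiable (trans i j) (ch_map C i x).
  by apply: trans_differentiable; exact: overlapP.
have djk : differentiable (trans j k) (trans i j (ch_map C i x)).
  by rewrite trans_map//; apply: trans_differentiable; exact: overlapP.
rewrite -(trans_map j ix) -(derive_comp v dij djk).
apply: (@eq_open_derive _ _ _ (overlap i j `&` overlap i k)).
- by apply: openI; exact: overlap_open.
- by split; exact: overlapP.
- move=> b [/overlap_inv [y [iy jy <- _]] _].
  by rewrite (trans_map j)// !trans_map.
Qed.

Lemma tcoord_jac i j x v : ch_dom C i x -> ch_dom C j x ->
  tcoord j x v = jac i j (ch_map C i x) (tcoord i x v).
Proof. by move=> ix jx; rewrite !tcoordE jac_comp//; exact: at_dom' ix. Qed.

Lemma tcoord_at x v : ch_pts C x -> tcoord (ch_at C x) x v = v.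
Proof. by move=> px; rewrite tcoordE jac_id//; exact: at_dom. Qed.

Lemma tcoord_linear i x : ch_dom C i x -> linear (tcoord (C:=C) i x).
Proof.
move=> ix c u v; rewrite !tcoordE (jac_linear _)//.
by apply: overlapP => //; exact: at_dom' ix.
Qed.

(** Inverse of [tcoord i x]: the Jacobian of the transition back to the preferred chart. *)
Definition uncoord (i : ch_idx C) (x : M) (w : V) : V :=
  jac i (ch_at C x) (ch_map C i x) w.

Lemma uncoordK i x : ch_dom C i x -> cancel (uncoord i x) (tcoord (C:=C) i x).
Proof.
by move=> ix w; rewrite tcoordE /uncoord jac_comp// ?jac_id//; exact: at_dom' ix.
Qed.

Lemma tcoordK i x : ch_dom C i x -> cancel (tcoord (C:=C) i x) (uncoord i x).
Proof.
move=> ix w; rewrite tcoordE /uncoord jac_comp//; [|exact: at_dom' ix..].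
by rewrite jac_id//; exact: at_dom' ix.
Qed.

Lemma tcoord_inj i x : ch_dom C i x -> injective (tcoord (C:=C) i x).
Proof. by move=> ix; apply: can_inj (tcoordK ix). Qed.

Lemma tcoord0 i x : ch_dom C i x -> tcoord i x 0 = 0 :> V.
Proof. by move=> ix; rewrite tcoordE /jac derive0. Qed.

Lemma tcoordD i x u v : ch_dom C i x -> tcoord i x (u + v) = tcoord i x u + tcoord i x v.
Proof. by move=> ix; have := tcoord_linear ix 1 u v; rewrite !scale1r. Qed.

Lemma tcoordZ i x c v : ch_dom C i x -> tcoord i x (c *: v) = c *: tcoord i x v.
Proof. by move=> ix; have := tcoord_linear ix c v 0; rewrite !addr0 tcoord0 ?addr0. Qed.

Lemma tcoordB i x u v : ch_dom C i x -> tcoord i x (u - v) = tcoord i x u - tcoord i x v.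
Proof. by move=> ix; rewrite -scaleN1r tcoordD// tcoordZ// scaleN1r. Qed.

Lemma tcoord_sum (I : Type) (r : seq I) i x (f : I -> V) : ch_dom C i x ->
  tcoord i x (\sum_(k <- r) f k) = \sum_(k <- r) tcoord i x (f k).
Proof.
move=> ix; elim: r => [|k r IH]; first by rewrite !big_nil tcoord0.
by rewrite !big_cons tcoordD// IH.
Qed.

Definition img i : set V := overlap i i.

Lemma imgP i x : ch_dom C i x -> img i (ch_map C i x).
Proof. by move=> ix; exact: overlapP. Qed.

Lemma img_inv i a : img i a ->
  exists x, [/\ ch_dom C i x, ch_map C i x = a & ch_inv C i a = x].
Proof. by case/overlap_inv => x [ix _ e1 e2]; exists x. Qed.

Lemma img_open i : open (img i). Proof. exact: overlap_open. Qed.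

(** The derivative [der] is taken in the preferred chart; the chain rule along a transition map
    moves it to an arbitrary one. *)
Lemma der_chart (E : normedModType R) i x v (f : M -> E) : ch_dom C i x ->
  differentiable (fun a => f (ch_inv C i a)) (ch_map C i x) ->
  der C x v f = 'D_(tcoord i x v) (fun a => f (ch_inv C i a)) (ch_map C i x).
Proof.
move=> ix df; have ax := at_dom' ix; rewrite /der tcoordE /jac.
have dt : differentiable (trans (ch_at C x) i) (ch_map C (ch_at C x) x).
  by apply: trans_differentiable; exact: overlapP.
rewrite -(trans_map i ax) in df *.
rewrite -(derive_comp v dt df).
apply: (@eq_open_derive _ _ _ (overlap (ch_at C x) i)); first exact: overlap_open.
- exact: overlapP.
- by move=> b ob; rewrite inv_trans.
Qed.

Lemma open_preimage (E E' : normedModType R) (U : set E) (O : set E') (f : E -> E') :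
  open U -> (forall a, U a -> {for a, continuous f}) -> open O ->
  open (U `&` f @^-1` O).
Proof.
rewrite !openE => oU cf oO a [Ua Ofa]; rewrite /interior.
apply: filterI; first exact: oU.
by apply: cf => //; exact: oO.
Qed.

Lemma chart_open i (O : set V) : open O ->
  ch_open C [set x | ch_dom C i x /\ O (ch_map C i x)].
Proof.
move=> oO; split=> [x [ix _]|j]; first by exists i.
rewrite (_ : _ @` _ = overlap j i `&` trans j i @^-1` O).
  apply: open_preimage => //; first exact: overlap_open.
  by move=> a ja; apply: differentiable_continuous; exact: trans_differentiable.
apply/seteqP; split=> a.
  move=> [x [[ix Oix] jx] <-]; split; first exact: overlapP.
  by rewrite /= trans_map.
move=> [/overlap_inv [x [jx ix <- _]]]; rewrite /= trans_map// => Oix.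
by exists x.
Qed.

Lemma ch_openI W W' : ch_open C W -> ch_open C W' -> ch_open C (W `&` W').
Proof.
move=> [sW oW] [sW' oW']; split=> [x [/sW]//|i].
rewrite (_ : _ @` _ = (ch_map C i @` (W `&` ch_dom C i)) `&`
                      (ch_map C i @` (W' `&` ch_dom C i))); first exact: openI.
apply/seteqP; split=> [a [x [[Wx W'x] ix] <-]|a [[x [Wx ix] <-] [y [Wy iy] e]]].
  by split; exists x.
exists x => //; split=> //; split=> //.
by rewrite -(at_mapK hC ix) -e (at_mapK hC iy).
Qed.

Lemma ch_dom_open i : ch_open C (ch_dom C i).
Proof.
have := @chart_open i setT openT.
by congr (ch_open C _); apply/seteqP; split=> [x []//|x ix]; split.
Qed.

Lemma ch_open_img i W x : ch_open C W -> W x -> ch_dom C i x ->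
  [/\ open (ch_map C i @` (W `&` ch_dom C i)),
      (ch_map C i @` (W `&` ch_dom C i)) (ch_map C i x),
      ch_map C i @` (W `&` ch_dom C i) `<=` img i &
      forall a, (ch_map C i @` (W `&` ch_dom C i)) a -> W (ch_inv C i a)].
Proof.
move=> [sW oW] Wx ix; split=> //; first by exists x.
- by move=> _ [y [Wy iy] <-]; exact: imgP.
- by move=> _ [y [Wy iy] <-]; rewrite at_mapK.
Qed.

(* [Phi] gives fibre coordinates and [J] the cocycle: [J] is the identity for
   functions, the Jacobian [jac] for vector fields, and the Jacobian at the base
   point for sections of the pull-back bundle. *)
Section Bundle.
Variables (E : normedModType R) (BE : frame E).
Variables (Phi : ch_idx C -> M -> E -> E) (J : ch_idx C -> ch_idx C -> V -> E -> E).
Hypothesis J_linear : forall i j a, overlap i j a -> linear (J i j a).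
Hypothesis J_smooth : forall i j w, smooth_on (overlap i j) (fun a => J i j a w).
Hypothesis Phi_J : forall i j x w, ch_dom C i x -> ch_dom C j x ->
  Phi j x w = J i j (ch_map C i x) (Phi i x w).

Definition bundle_smooth (W : set M) (X : M -> E) : Prop :=
  forall i, smooth_on (ch_map C i @` (W `&` ch_dom C i))
    (fun a => Phi i (ch_inv C i a) (X (ch_inv C i a))).

(** In another chart the representative is the cocycle applied to the given one, precomposed with a
    transition map; this is smooth by composition and fibrewise linearity. *)
Lemma bundle_smooth_chart i (O : set V) (X : M -> E) : open O ->
  smooth_on (O `&` img i) (fun a => Phi i (ch_inv C i a) (X (ch_inv C i a))) ->
  bundle_smooth [set x | ch_dom C i x /\ O (ch_map C i x)] X.
Proof.
move=> oO sX j k.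
have [sW oW] := @chart_open i O oO.
set W := [set x | _] in sW oW *.
have WP b : (ch_map C j @` (W `&` ch_dom C j)) b ->
    overlap j i b /\ (O `&` img i `&` overlap i j) (trans j i b).
  move=> [x [[ix Ox] jx] <-]; rewrite trans_map//; split; first exact: overlapP.
  by split; [split=> //; exact: imgP|exact: overlapP].
apply: (ndiff_eq (f := fun b => J i j (trans j i b)
  (Phi i (ch_inv C i (trans j i b)) (X (ch_inv C i (trans j i b)))))) => //.
  move=> _ [x [[ix Ox] jx] <-]; rewrite trans_map// at_mapK// at_mapK//.
  by rewrite -Phi_J.
have oO' : open (O `&` img i `&` overlap i j).
  by apply: openI; [apply: openI => //; exact: img_open|exact: overlap_open].
apply: (ndiff_comp B (U' := O `&` img i `&` overlap i j)
  (f := trans j i) (g := fun a => J i j a (Phi i (ch_inv C i a) (X (ch_inv C i a))))) => //.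
- by move=> b /WP[].
- by apply: ndiff_sub (trans_smooth j i k) => b /WP[].
- apply: (ndiff_fiber_linear BE) => //.
  + by move=> a [_ oa]; exact: J_linear.
  + by move=> w; apply: ndiff_sub (J_smooth i j w k) => a [].
  + by apply: ndiff_sub (sX k) => a [].
Qed.

Lemma bundle_smooth_at i x (O : set V) (X : M -> E) : ch_dom C i x -> open O ->
  O (ch_map C i x) ->
  smooth_on (O `&` img i) (fun a => Phi i (ch_inv C i a) (X (ch_inv C i a))) ->
  exists W, [/\ ch_open C W, W x & bundle_smooth W X].
Proof.
move=> ix oO Ox sX; exists [set x | ch_dom C i x /\ O (ch_map C i x)].
by split=> //; [exact: chart_open|exact: bundle_smooth_chart].
Qed.

Lemma bundle_at_chart i x (X : M -> E) : ch_dom C i x ->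
  (exists W, [/\ ch_open C W, W x & bundle_smooth W X]) ->
  exists O, [/\ open O, O (ch_map C i x), O `<=` img i &
    smooth_on O (fun a => Phi i (ch_inv C i a) (X (ch_inv C i a)))].
Proof.
move=> ix [W [oW Wx sX]]; have [h1 h2 h3 _] := ch_open_img oW Wx ix.
by exists (ch_map C i @` (W `&` ch_dom C i)).
Qed.

End Bundle.

Lemma fun_at_of_chart (E : normedModType R) (BE : frame E) i x (O : set V) (f : M -> E) :
  ch_dom C i x -> open O -> O (ch_map C i x) ->
  smooth_on (O `&` img i) (fun a => f (ch_inv C i a)) ->
  exists W, [/\ ch_open C W, W x & smooth_fun C W f].
Proof.
move=> ix oO Ox sf.
apply: (@bundle_smooth_at E BE (fun _ _ w => w) (fun _ _ _ w => w) _ _ _ i x O) => //.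
by move=> ? ? ? ?; exact: ndiff_cst.
Qed.

Lemma field_at_of_chart i x (O : set V) (X : M -> V) :
  ch_dom C i x -> open O -> O (ch_map C i x) ->
  smooth_on (O `&` img i) (fun a => tcoord i (ch_inv C i a) (X (ch_inv C i a))) ->
  field_at C X x.
Proof.
move=> ix oO Ox sX.
apply: (@bundle_smooth_at V B (fun i x w => tcoord i x w) jac _ _ _ i x O) => //.
- exact: jac_linear.
- exact: jac_smooth.
- by move=> *; exact: tcoord_jac.
Qed.

Lemma field_at_chart i x (X : M -> V) : ch_dom C i x -> field_at C X x ->
  exists O, [/\ open O, O (ch_map C i x), O `<=` img i &
    smooth_on O (fun a => tcoord i (ch_inv C i a) (X (ch_inv C i a)))].
Proof. exact: (@bundle_at_chart _ (fun i x w => tcoord i x w)). Qed.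

End Atlas.
(** The topology of [M] enters through the openness of overlaps: an overlap is the preimage of an
    open chart domain under an inverse chart that is continuous on an open set. *)
Lemma manifold_atlas (R : realType) n (M : topologicalType)
    (C : charts 'rV[R]_n M) : manifold C -> atlas C.
Proof.
move=> hM; split=> [x _|i x|i j|]; [exact: mfd_at|exact: mfd_mapK| |exact: mfd_smooth].
rewrite (_ : _ @` _ = (ch_map C i @` ch_dom C i) `&` ch_inv C i @^-1` ch_dom C j).
  have oi := @mfd_img _ _ _ _ hM i; have oj := @mfd_dom _ _ _ _ hM j.
  have ci := @mfd_inv _ _ _ _ hM i.
  rewrite continuous_open_subspace// in ci.
  move: oi oj; rewrite !openE => oi oj a [ia ja]; rewrite /interior; apply: filterI.
    exact: oi.
  by apply: ci; [rewrite inE|exact: oj].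
apply/seteqP; split=> a.
  by move=> [x [ix jx] <-]; split; [exists x|rewrite /= (mfd_mapK hM)].
move=> [[x ix <-]]; rewrite /= (mfd_mapK hM)// => jx.
by exists x.
Qed.

(** * The natural atlas of the slit tangent bundle *)

Section TangentAtlas.
Context {R : realType} {V : normedModType R} {M : Type}.
Variables (B : frame V) (C : charts V M).
Hypothesis hC : atlas C.
Notation P := (M * V)%type.
Notation TC := (TM0 C).
Implicit Types i j : ch_idx C.

Lemma TM0_invE i x (y : V) : ch_dom C i x ->
  ch_inv TC i (ch_map C i x, y) = (x, uncoord i x y).
Proof. by move=> ix; rewrite /= (at_mapK hC ix). Qed.

Lemma tcoord_neq0 i x (v : V) : ch_dom C i x -> (tcoord i x v != 0) = (v != 0).
Proof.
move=> ix; congr negb; apply/eqP/eqP => [e|->]; last exact: tcoord0.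
by apply: (tcoord_inj hC ix); rewrite e (tcoord0 ix).
Qed.

Lemma TM0_overlap i j :
  ch_map TC i @` (ch_dom TC i `&` ch_dom TC j) =
  [set a | overlap i j a.1 /\ a.2 != 0].
Proof.
apply/seteqP; split=> a.
  move=> [z [[iz z0] [jz _]] <-]; split; first by exists z.1.
  by rewrite /= tcoord_neq0.
case: a => a1 a2 /= [[x [ix jx] <-] a20].
exists (x, uncoord i x a2); last by rewrite /= uncoordK.
by rewrite /= -(tcoord_neq0 _ ix) uncoordK.
Qed.

Lemma TM0_img_open i j : open (ch_map TC i @` (ch_dom TC i `&` ch_dom TC j)).
Proof.
rewrite TM0_overlap.
have -> : [set a : V * V | overlap i j a.1 /\ a.2 != 0] =
  (fst @^-1` overlap i j) `&` (snd @^-1` [set v : V | v != 0]) by [].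
apply: openI.
  by apply: open_comp; [move=> x _; exact: cvg_fst|exact: overlap_open].
apply: open_comp; first by move=> x _; exact: cvg_snd.
rewrite (_ : [set v : V | v != 0] = ~` [set 0]).
  by apply: closed_openC; exact: accessible_closed_set1 (hausdorff_accessible (@norm_hausdorff _ V)) 0.
by apply/seteqP; split=> v /eqP.
Qed.

Lemma continuous_fst (E E' : normedModType R) : continuous (fst : E * E' -> E).
Proof. by move=> x; exact: cvg_fst. Qed.

Lemma continuous_snd (E E' : normedModType R) : continuous (snd : E * E' -> E').
Proof. by move=> x; exact: cvg_snd. Qed.

Lemma ndiff_fst k (E E' : normedModType R) (U : set (E * E')) :
  ndifferentiable k U (fst : E * E' -> E).
Proof. exact: (ndiff_linear (l := fst) _ _ (@continuous_fst E E')). Qed.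

Lemma ndiff_snd k (E E' : normedModType R) (U : set (E * E')) :
  ndifferentiable k U (snd : E * E' -> E').
Proof. exact: (ndiff_linear (l := snd) _ _ (@continuous_snd E E')). Qed.

(** An induced transition is the tangent map of the base transition, which makes its smoothness
    visible. *)
Lemma TM0_transE i j a : overlap i j a.1 ->
  ch_map TC j (ch_inv TC i a) = (trans i j a.1, jac i j a.1 a.2).
Proof.
case: a => a1 a2 /= [x [ix jx] <-].
rewrite (trans_map hC j ix) (at_mapK hC ix) /=; congr pair.
by rewrite -[X in tcoord _ _ X]/(uncoord i x a2) (tcoord_jac hC _ ix jx) uncoordK.
Qed.

Lemma TM0_trans_smooth i j :
  smooth_on (ch_map TC i @` (ch_dom TC i `&` ch_dom TC j))
            (fun a => ch_map TC j (ch_inv TC i a)).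
Proof.
move=> k; have oU := @TM0_img_open i j.
apply: (ndiff_eq (f := fun a => (trans i j a.1, jac i j a.1 a.2))) => //.
  by move=> a; rewrite TM0_overlap => -[oa _]; rewrite TM0_transE.
have sub a : (ch_map TC i @` (ch_dom TC i `&` ch_dom TC j)) a -> overlap i j a.1.
  by rewrite TM0_overlap => -[].
apply: ndiff_pair => //.
  apply: (ndiff_comp B (f := fst) (g := trans i j)) (oU) (overlap_open hC i j) sub _ _.
    exact: ndiff_fst.
  exact: trans_smooth.
apply: (ndiff_fiber_linear B (L := fun a v => jac i j a.1 v)) => //.
- by move=> a oa; apply: jac_linear => //; exact: sub.
- move=> w.
  apply: (ndiff_comp B (f := fst) (g := fun b => jac i j b w)) (oU) (overlap_open hC i j) sub _ _.
    exact: ndiff_fst.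
  exact: jac_smooth.
- exact: ndiff_snd.
Qed.

Lemma TM0_atlas : atlas TC.
Proof.
split.
- move=> z [i _ [iz z0]]; split=> //; apply: at_dom => //; exact: ch_pts_dom iz.
- move=> i [x y] [/= ix y0]; rewrite (at_mapK hC ix); congr pair.
  by have := tcoordK hC ix y; rewrite /uncoord/jac.
- exact: TM0_img_open.
- exact: TM0_trans_smooth.
Qed.

(** The first component of an induced transition depends on the base point alone. Hence [rho] is the
    first projection in every natural chart. *)
Lemma tcoord_TM0_fst i z (u : V * V) : ch_dom TC i z ->
  (tcoord (C := TC) i z u).1 = tcoord (C := C) i z.1 u.1.
Proof.
move=> iz; have az := at_dom' TM0_atlas iz.
have oT := overlapP az iz.
have oT' : overlap (ch_at C z.1) i (ch_map C (ch_at C z.1) z.1).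
  by apply: overlapP; [exact: az.1|exact: iz.1].
have dT := trans_differentiable TM0_atlas oT.
set T := trans _ _ in dT.
rewrite tcoordE /jac -/T.
have -> : ('D_u T (ch_map TC (ch_at TC z) z)).1 =
          'D_u (fun a => (T a).1) (ch_map TC (ch_at TC z) z).
  rewrite (derive_comp (g := fst) _ dT); last first.
    by apply: linear_differentiable; exact: continuous_fst.
  by rewrite derive_linear//; exact: continuous_fst.
rewrite (@eq_open_derive _ _ _ _ _ (fun a => trans (ch_at C z.1) i a.1) _ _
  (overlap_open TM0_atlas _ _) oT); last first.
  by move=> a; rewrite /overlap TM0_overlap => -[oa _]; rewrite /T/trans TM0_transE.
rewrite (derive_comp (f := fst) (g := trans (ch_at C z.1) i)).
- by rewrite derive_linear//; exact: continuous_fst.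
- by apply: linear_differentiable; exact: continuous_fst.
- exact: trans_differentiable.
Qed.

End TangentAtlas.
Fact mulr_lin (R : realType) (k c x y : R) : k * (c *: x + y) = c *: (k * x) + k * y.
Proof. by rewrite /GRing.scale/=; ring. Qed.

(** The normalisations 1/2 of g and 1/4 of c are what makes the fibre derivative of g equal to
    2c. *)
Fact half_quarter (R : realType) (x : R) : 2^-1 *: x = 2 * (4^-1 * x).
Proof. by rewrite /GRing.scale/=; field. Qed.

Fact chart_key : unit. Proof. exact: tt. Qed.

(** * Homogeneous functions on a cone *)

Section Homogeneous.
Context {R : realType} {V : normedModType R}.
Variables (U : set (V * V)%type).
Hypothesis oU : open U.
Hypothesis coneU : forall a (t : R), U a -> 0 < t -> U (a.1, t *: a.2).

Definition homogeneous (k : nat) (f : V * V -> R) : Prop :=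
  forall a (t : R), U a -> 0 < t -> f (a.1, t *: a.2) = t ^+ k * f a.

Lemma fibre_scale_diff (t : R) (a : V * V) :
  is_diff a (fun b : V * V => (b.1, t *: b.2)) (fun b => (b.1, t *: b.2)).
Proof.
have d1 : is_diff a (fst : V * V -> V) fst.
  apply: DiffDef; first exact: linear_differentiable (@continuous_fst _ _ _).
  by rewrite diff_lin//; exact: continuous_fst.
have d2 : is_diff a (snd : V * V -> V) snd.
  apply: DiffDef; first exact: linear_differentiable (@continuous_snd _ _ _).
  by rewrite diff_lin//; exact: continuous_snd.
exact: is_diff_pair.
Qed.

(** The fibre derivative of [b |-> f (b.1, t b.2)] is computed by the chain rule and by homogeneity;
    the chain rule contributes the factor [t] that lowers the degree. *)
Lemma homogeneous_derive k f w : (forall a, U a -> differentiable f a) ->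
  homogeneous k.+1 f -> homogeneous k ('D_(0, w) f).
Proof.
move=> df hf a t Ua t0.
have Ut := coneU Ua t0.
have ds := fibre_scale_diff t a.
have e1 : 'D_(0, w) (fun b => f (b.1, t *: b.2)) a = t * 'D_(0, w) f (a.1, t *: a.2).
  rewrite (@derive_comp _ _ _ _ (fun b : V * V => (b.1, t *: b.2)) f)//; last exact: df.
  have -> : 'D_(0, w) (fun b : V * V => (b.1, t *: b.2)) a = t *: (0, w) + 0.
    by rewrite deriveE// diff_val/= addr0; congr pair; rewrite /= scaler0.
  by rewrite derive_lin ?derive0 ?addr0//; exact: df.
have e2 : 'D_(0, w) (fun b => f (b.1, t *: b.2)) a = t ^+ k.+1 * 'D_(0, w) f a.
  rewrite (@eq_open_derive _ _ _ _ _ (t ^+ k.+1 *: f) _ _ oU Ua); last first.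
    by move=> b Ub; rewrite hf.
  by rewrite deriveZ//; apply: diff_derivable; exact: df.
apply: (@mulfI _ t); first by rewrite gt_eqF.
by rewrite -e1 e2 mulrA -exprS.
Qed.

(** Along the ray [(1 + s) y] homogeneity turns [f] into [(1 + s)^k f a], whose derivative at
    [s = 0] is immediate. *)
Lemma euler k f a : U a -> differentiable f a -> homogeneous k f ->
  'D_(0, a.2) f a = k%:R * f a.
Proof.
move=> Ua df hf.
have lineE s : a + s *: ((0, a.2) : V * V) = (a.1, (1 + s) *: a.2).
  by case: (a) => x y; congr pair; rewrite /= ?scaler0 ?addr0// scalerDl scale1r.
have df0 : differentiable f (a + 0 *: ((0, a.2) : V * V)) by rewrite scale0r addr0.
have := derive_line df0; rewrite scale0r addr0 => h.
rewrite -(derive_val (is_derive := h)).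
rewrite (@near_eq_derive _ _ _ _ (fun s : R => (1 + s) ^+ k *: f a)); last first.
  (* Homogeneity concerns positive factors only, hence the restriction to [|s| < 1]. *)
  have : \forall s \near (0 : R), 0 < 1 + s.
    have : \forall s \near (0 : R), `|s| < 1 by apply: nbhs0_lt; exact: ltr01.
    by apply: filterS => s; rewrite ltr_norml => /andP[]; lra.
  by apply: filterS => s s0; rewrite lineE hf.
have dk : is_derive (0 : R) 1 (fun s : R => (1 + s) ^+ k) k%:R.
  have d1 : is_derive (0 : R) (1 : R) (fun s : R => 1 + s) (0 + 1) by exact: is_deriveD.
  have e : (fun s : R => (1 + s) ^+ k) = (fun s : R => 1 + s) ^+ k by rewrite exprfctE.
  rewrite e; apply: is_derive_eq.
  by rewrite /GRing.scale/= addr0 expr1n add0r !mulr1.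
rewrite derive_scale ?(derive_val (is_derive := dk)); last 2 first.
- exact: (derivable1_diffP _ _).1.
- exact: differentiable_cst.
have dc : 'D_1 (fun _ : R => f a) 0 = 0 by exact: derive_cst.
by rewrite dc scaler0 addr0 /GRing.scale.
Qed.

Variable G : V * V -> R.
Hypothesis sG : smooth_on U G.
Hypothesis hG : homogeneous 2 G.

(* Locked, because a failing unification would otherwise unfold the limits. *)
Definition fmetric : V * V -> V -> V -> R :=
  locked_with chart_key (fun a u w => 2^-1 * 'D_(0, u) ('D_(0, w) G) a).
Definition fcartan : V * V -> V -> V -> V -> R :=
  locked_with chart_key (fun a u v w => 4^-1 * 'D_(0, u) ('D_(0, v) ('D_(0, w) G)) a).

Lemma fmetricE a u w : fmetric a u w = 2^-1 * 'D_(0, u) ('D_(0, w) G) a.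
Proof. by rewrite /fmetric unlock. Qed.

Lemma fcartanE a u v w :
  fcartan a u v w = 4^-1 * 'D_(0, u) ('D_(0, v) ('D_(0, w) G)) a.
Proof. by rewrite /fcartan unlock. Qed.

Lemma fibre_lin (c : R) (u v : V) : ((0, c *: u + v) : V * V) = c *: (0, u) + (0, v).
Proof. by congr pair; rewrite /= ?scaler0 ?addr0. Qed.

Let sD (f : V * V -> R) w : smooth_on U f -> smooth_on U ('D_(0, w) f).
Proof. by move=> sf k; exact: (sf k.+1).2. Qed.

Lemma smooth_on_diff (f : V * V -> R) a : smooth_on U f -> U a -> differentiable f a.
Proof. by move=> sf; exact: (sf 1).1. Qed.

Let sDD u w : smooth_on U ('D_(0, u) ('D_(0, w) G)).
Proof. by do 2!apply: sD. Qed.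

Let commD (f : V * V -> R) u w : smooth_on U f -> forall a, U a ->
  'D_(0, u) ('D_(0, w) f) a = 'D_(0, w) ('D_(0, u) f) a.
Proof. by move=> sf a Ua; apply: (derive_commute_real _ _ oU Ua); exact: sf. Qed.

Lemma fmetric_sym a u w : U a -> fmetric a u w = fmetric a w u.
Proof. by move=> Ua; rewrite !fmetricE; exact: (congr1 (fun r => 2^-1 * r) (commD _ _ sG Ua)). Qed.

Lemma fcartan_sym12 a u v w : U a -> fcartan a u v w = fcartan a v u w.
Proof.
move=> Ua; rewrite !fcartanE.
exact: (congr1 (fun r => 4^-1 * r) (commD _ _ (@sD G w sG) Ua)).
Qed.

Lemma fcartan_sym23 a u v w : U a -> fcartan a u v w = fcartan a u w v.
Proof.
move=> Ua; rewrite !fcartanE; apply: (congr1 (fun r => 4^-1 * r)).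
by apply: (eq_open_derive _ oU Ua) => b Ub; exact: commD.
Qed.

Lemma fmetric_smooth u w : smooth_on U (fun a => fmetric a u w).
Proof.
under eq_fun do rewrite fmetricE.
by move=> k; apply: ndiffZ => //; [exact: ndiff_cst|exact: sDD].
Qed.

Lemma fcartan_smooth u v w : smooth_on U (fun a => fcartan a u v w).
Proof.
under eq_fun do rewrite fcartanE.
by move=> k; apply: ndiffZ => //; [exact: ndiff_cst|apply: sD; exact: sDD].
Qed.

Lemma fmetric_linl a w : U a -> linear (fmetric a ^~ w : V -> R).
Proof.
move=> Ua c u v; rewrite !fmetricE fibre_lin derive_lin; last exact/smooth_on_diff/Ua/sD.
exact: mulr_lin.
Qed.

Lemma fmetric_linr a u : U a -> linear (fmetric a u : V -> R).
Proof.
by move=> Ua c v w; rewrite !(fmetric_sym u)// fmetric_linl.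
Qed.

Lemma fcartan_lin1 a v w : U a -> linear (fun u => fcartan a u v w : R).
Proof.
move=> Ua c u u'; rewrite !fcartanE fibre_lin derive_lin; last exact/smooth_on_diff/Ua/sDD.
exact: mulr_lin.
Qed.

Lemma fcartan_lin2 a u w : U a -> linear (fun v => fcartan a u v w : R).
Proof. by move=> Ua c v v'; rewrite !(fcartan_sym12 u)// fcartan_lin1. Qed.

Lemma fcartan_lin3 a u v : U a -> linear (fun w => fcartan a u v w : R).
Proof. by move=> Ua c w w'; rewrite !(fcartan_sym23 u v)// fcartan_lin2. Qed.

Lemma derive_fmetric a u v w : U a ->
  'D_(0, v) (fun b => fmetric b u w) a = 2 * fcartan a v u w.
Proof.
move=> Ua; under eq_fun do rewrite fmetricE.
rewrite [LHS]deriveZ ?fcartanE; last exact/diff_derivable/smooth_on_diff/Ua/sDD.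
exact: half_quarter.
Qed.

Lemma fmetric_homog u w : homogeneous 0 (fun a => fmetric a u w).
Proof.
move=> a t Ua t0; rewrite !fmetricE.
have h1 : homogeneous 1 ('D_(0, w) G).
  by apply: homogeneous_derive => // b Ub; exact: smooth_on_diff Ub.
have h0 : homogeneous 0 ('D_(0, u) ('D_(0, w) G)).
  by apply: homogeneous_derive => // b Ub; apply: smooth_on_diff Ub; exact: sD.
by rewrite h0// expr0 !mul1r.
Qed.

(** The metric is homogeneous of degree 0, so by Euler its derivative along y vanishes, and this
    derivative is 2c with y in the first slot. *)
Lemma fcartan_radial a u w : U a -> fcartan a a.2 u w = 0.
Proof.
move=> Ua.
have d : differentiable (fun b => fmetric b u w) a.
  by apply: smooth_on_diff Ua; exact: fmetric_smooth.
have := euler Ua d (@fmetric_homog u w); rewrite mul0r derive_fmetric//.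
by move/eqP; rewrite mulf_eq0 pnatr_eq0/= => /eqP.
Qed.

(** Euler is used in degrees 1 and 2; the resulting factor 2 cancels the 1/2 in the metric. *)
Lemma fmetric_radial a : U a -> fmetric a a.2 a.2 = G a.
Proof.
move=> Ua; rewrite !fmetricE.
have h1 : homogeneous 1 ('D_(0, a.2) G).
  by apply: homogeneous_derive => // b Ub; exact: smooth_on_diff Ub.
rewrite (euler Ua _ h1); last by apply: smooth_on_diff Ua; exact: sD.
rewrite mul1r (euler Ua _ hG); last exact: smooth_on_diff Ua.
by rewrite mulrA mulVf ?mul1r.
Qed.

End Homogeneous.
(** * Finsler structures in charts *)

Section FinslerChart.
Context {R : realType} {V : normedModType R} {M : Type}.
Variables (B : frame V) (C : charts V M).
Hypothesis hC : atlas C.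
Hypothesis full : forall x, ch_pts C x.
Notation P := (M * V)%type.
Notation TC := (TM0 C).
Implicit Types i j : ch_idx C.
Let hT : atlas TC := TM0_atlas B hC.
Notation U i := (img (C := TC) i).

Lemma TM0_img a i : U i a <-> img (C := C) i a.1 /\ a.2 != 0.
Proof. by rewrite /img/overlap (TM0_overlap hC). Qed.

Lemma TM0_imgP i a : U i a -> exists z, [/\ ch_dom TC i z, ch_map TC i z = a & ch_inv TC i a = z].
Proof. exact: img_inv. Qed.

Lemma TM0_img_cone i a (t : R) : U i a -> 0 < t -> U i (a.1, t *: a.2).
Proof.
move=> /TM0_img[ia a0] t0; apply/TM0_img; split=> //.
by rewrite scaler_eq0 negb_or gt_eqF.
Qed.

Lemma uncoordZ i x c (w : V) : ch_dom C i x -> uncoord i x (c *: w) = c *: uncoord i x w.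
Proof.
by move=> ix; apply: (tcoord_inj hC ix); rewrite (tcoordZ hC)// !uncoordK.
Qed.

Lemma TM0_at z : z.2 != 0 -> ch_dom TC (ch_at C z.1) z.
Proof. by move=> z0; split=> //; exact: at_dom. Qed.

Variable F : P -> R.
Hypothesis hF : finsler C F.

Definition energy i (a : V * V) : R := F (ch_inv TC i a) ^+ 2.

Lemma F_smooth i : smooth_on (U i) (fun a => F (ch_inv TC i a)).
Proof.
have := fin_smooth hF i; congr smooth_on; apply/seteqP; split=> a [z [h1 h2] <-];
  exists z => //; split=> //; exact: ch_pts_dom h2.
Qed.

Lemma U_open i : open (U i). Proof. exact: (img_open hT). Qed.

Lemma energy_smooth i : smooth_on (U i) (energy i).
Proof.
move=> k; apply: (ndiff_eq (f := fun a => F (ch_inv TC i a) *: F (ch_inv TC i a))).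
- exact: U_open.
- by move=> a _; rewrite /energy expr2.
- by apply: ndiffZ; [exact: U_open|exact: F_smooth|exact: F_smooth].
Qed.

Lemma energy_homog i : homogeneous (U i) 2 (energy i).
Proof.
move=> [x y] t /TM0_img[/= [p [ip _] <-] y0] t0; rewrite /energy.
by rewrite !(TM0_invE hC)// uncoordZ// (fin_homo hF)// exprMn.
Qed.

(** Over a fixed base point the change to components in chart [i] is linear, so a fibre derivative
    becomes a partial derivative in these components. Agreement of [f] and [H] is required on all
    nonzero vectors of the fibre, so that the lemma can be iterated. *)
Lemma vder_chart i x y w (f : P -> R) (H : V * V -> R) : ch_dom C i x -> y != 0 ->
  (forall a, U i a -> differentiable H a) ->
  (forall y', y' != 0 -> f (x, y') = H (ch_map C i x, tcoord i x y')) ->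
  vder w f (x, y) = 'D_(0, tcoord i x w) H (ch_map C i x, tcoord i x y).
Proof.
move=> ix y0 dH fH; rewrite /vder/=.
pose TM := GRing.isLinear.Build _ _ _ _ _ (tcoord_linear hC ix).
pose T : {linear V -> V} := HB.pack (fun v : V => tcoord i x v) TM.
have cT : continuous T by exact: frame_linear_continuous.
have dT : is_diff y (fun y' : V => (ch_map C i x, T y')) (fun y' => (0, T y')).
  have dTy : is_diff y T T.
    by apply: DiffDef; [exact: linear_differentiable|rewrite diff_lin].
  exact: is_diff_pair.
have o0 : open [set v : V | v != 0].
  rewrite (_ : [set v : V | v != 0] = ~` [set 0]).
    apply: closed_openC.
    exact: accessible_closed_set1 (hausdorff_accessible (@norm_hausdorff _ V)) 0.
  by apply/seteqP; split=> v /eqP.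
rewrite (eq_open_derive (U := [set v : V | v != 0]) (g := fun y' => H (ch_map C i x, T y')) w o0 y0)//.
rewrite (@derive_comp _ _ _ _ (fun y' : V => (ch_map C i x, T y')) H)//.
  by congr ('D_ _ _ _); rewrite deriveE// diff_val.
apply: dH; apply/TM0_img; split; first exact: imgP.
by rewrite /= (tcoord_neq0 hC).
Qed.

Let sG := energy_smooth.

Lemma vder1 i x y w : ch_dom C i x -> y != 0 ->
  vder w (fun p => F p ^+ 2) (x, y) =
  'D_(0, tcoord i x w) (energy i) (ch_map C i x, tcoord i x y).
Proof.
move=> ix y0; apply: (@vder_chart i x y w _ (energy i) ix y0).
  by move=> a Ua; exact: smooth_on_diff.
by move=> y' _; rewrite /energy (TM0_invE hC)// tcoordK.
Qed.

Lemma vder2 i x y v w : ch_dom C i x -> y != 0 ->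
  vder v (vder w (fun p => F p ^+ 2)) (x, y) =
  'D_(0, tcoord i x v) ('D_(0, tcoord i x w) (energy i)) (ch_map C i x, tcoord i x y).
Proof.
move=> ix y0; apply: (@vder_chart i x y v _ _ ix y0).
  by move=> a Ua; apply: (smooth_on_diff _ Ua) => k; exact: (sG i k.+1).2.
by move=> y' y'0; exact: vder1.
Qed.

Lemma vder3 i x y u v w : ch_dom C i x -> y != 0 ->
  vder u (vder v (vder w (fun p => F p ^+ 2))) (x, y) =
  'D_(0, tcoord i x u) ('D_(0, tcoord i x v) ('D_(0, tcoord i x w) (energy i)))
    (ch_map C i x, tcoord i x y).
Proof.
move=> ix y0; apply: (@vder_chart i x y u _ _ ix y0).
  by move=> a Ua; apply: (smooth_on_diff _ Ua) => k; exact: ((sG i k.+2).2 _).2.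
by move=> y' y'0; exact: vder2.
Qed.

Lemma metric_chart i z u w : ch_dom TC i z ->
  metric F z u w = fmetric (energy i) (ch_map TC i z) (tcoord i z.1 u) (tcoord i z.1 w).
Proof.
case: z => x y [ix y0]; rewrite fmetricE; exact: (congr1 (fun r => 2^-1 * r) (vder2 u w ix y0)).
Qed.

Lemma cartan_chart i z u v w : ch_dom TC i z ->
  cartan F z u v w = F z *
    fcartan (energy i) (ch_map TC i z) (tcoord i z.1 u) (tcoord i z.1 v) (tcoord i z.1 w).
Proof.
case: z => x y [ix y0]; rewrite /cartan fcartanE [_ * F _]mulrC -mulrA.
exact: (congr1 (fun r => F (x, y) * (4^-1 * r)) (vder3 u v w ix y0)).
Qed.

Lemma fmetric_gt0 i a w : U i a -> w != 0 -> 0 < fmetric (energy i) a w w.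
Proof.
move=> /TM0_imgP[z [iz <- _]] w0.
have w0' : uncoord i z.1 w != 0.
  by rewrite -(tcoord_neq0 hC _ iz.1) uncoordK//; exact: iz.1.
have := fin_pos hF (ch_pts_dom iz) w0'.
by rewrite (metric_chart _ _ iz) uncoordK//; exact: iz.1.
Qed.

(** Only nonnegativity of F is given; [F = 0] is excluded by F^2 = g(y, y) > 0. *)
Lemma F_gt0 z : z.2 != 0 -> 0 < F z.
Proof.
move=> z0; rewrite lt_neqAle (fin_ge0 hF) andbT eq_sym.
have iz := TM0_at z0; set i := ch_at C z.1 in iz.
have Ui : U i (ch_map TC i z) by exact: imgP.
have T0 : (ch_map TC i z).2 != 0 by rewrite /= (tcoord_neq0 hC)//; exact: iz.1.
have := fmetric_gt0 Ui T0.
rewrite (fmetric_radial (@U_open i) (@TM0_img_cone i) (sG i) (@energy_homog i))//.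
rewrite /energy (at_mapK hT iz).
by apply: contraTneq => ->; rewrite expr0n ltxx.
Qed.

Lemma F_zero x : F (x, 0) = 0.
Proof.
(* Homogeneity with factor 2 gives F(x, 0) = 2 F(x, 0). *)
have := fin_homo hF x 0 (@ltr0Sn R 1); rewrite scaler0 => e.
by move: e; move: (F _) => r; lra.
Qed.

(** On zero vectors both sides are 0, so the identity holds everywhere and [mu] is the derivative of
    the section [p |-> p.2] as a function. *)
Lemma F_ell z : F z *: ell F z = z.2.
Proof.
rewrite /ell scalerA; have [z0|z0] := eqVneq z.2 0; first by rewrite z0 scaler0.
by rewrite divff ?scale1r// gt_eqF// F_gt0.
Qed.

Lemma cartan_zero z u v w : z.2 = 0 -> cartan F z u v w = 0.
Proof. by case: z => x y /= ->; rewrite /cartan F_zero mulr0 mul0r. Qed.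

Let chart_of z (z0 : z.2 != 0) := imgP (TM0_at z0).

Lemma cartan_radial z v w : cartan F z z.2 v w = 0.
Proof.
have [z0|z0] := eqVneq z.2 0; first by rewrite !cartan_zero.
rewrite (cartan_chart _ _ _ (TM0_at z0)).
rewrite -[tcoord _ _ z.2]/((ch_map TC (ch_at C z.1) z).2).
rewrite (fcartan_radial (@U_open _) (@TM0_img_cone _) (@sG _) (@energy_homog _)) ?mulr0//.
exact: chart_of.
Qed.

Lemma cartan_null z v w : cartan F z 0 v w = 0.
Proof.
rewrite /cartan /vder derive0; exact: mulr0.
Qed.

End FinslerChart.
Definition real_frame (R : realType) : frame R.
Proof.
exists unit (fun _ => 1) (fun _ => (@idfun R : {linear R -> R})).
- by move=> _ x; exact: cvg_id.
- by move=> x; rewrite big_const cardT enumT unlock/= addr0 /GRing.scale/= mulr1.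
Defined.

(** * Connections in charts *)

Section ConnectionChart.
Context {R : realType} {V : normedModType R} {M : Type}.
Variables (B : frame V) (C : charts V M).
Hypothesis hC : atlas C.
Hypothesis full : forall x, ch_pts C x.
Notation P := (M * V)%type.
Notation TC := (TM0 C).
Implicit Types i j : ch_idx C.
Let hT : atlas TC := TM0_atlas B hC.
Let BB : frame (V * V)%type := pair_frame B B.
Notation U i := (img (C := TC) i).
Notation T i z := (tcoord (C := C) i z.1).
Notation TT i z := (tcoord (C := TC) i z).

Let Uo i : open (U i). Proof. exact: (img_open hT). Qed.

Lemma trans_fst i j (a : V * V) : overlap (C := TC) i j a -> overlap (C := C) i j a.1.
Proof. by rewrite /overlap (TM0_overlap hC) => -[]. Qed.

Let J i j (a : V * V) (v : V) : V := jac (C := C) i j a.1 v.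

Let J_linear i j a : overlap (C := TC) i j a -> linear (J i j a).
Proof. by move=> /trans_fst; exact: (jac_linear hC). Qed.

Let J_smooth i j w : smooth_on (overlap (C := TC) i j) (fun a => J i j a w).
Proof.
move=> k; apply: (ndiff_comp B (f := fst) (g := fun b => jac (C := C) i j b w) (U' := overlap i j)).
- exact: (overlap_open hT).
- exact: (overlap_open hC).
- exact: trans_fst.
- exact: ndiff_fst.
- exact: (jac_smooth hC).
Qed.

Let Phi_J i j z w : ch_dom TC i z -> ch_dom TC j z ->
  T j z w = J i j (ch_map TC i z) (T i z w).
Proof. by move=> [iz _] [jz _]; rewrite (tcoord_jac hC w iz jz). Qed.

Lemma section_at_of_chart i z (O : set (V * V)) (X : P -> V) : ch_dom TC i z ->
  open O -> O (ch_map TC i z) ->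
  smooth_on (O `&` U i) (fun a => T i (ch_inv TC i a) (X (ch_inv TC i a))) ->
  section_at C X z.
Proof.
move=> iz oO Oz sX.
exact: (@bundle_smooth_at R (V * V)%type P BB TC hT V B
  (fun i z w => T i z w) J J_linear J_smooth Phi_J i z O X).
Qed.

Lemma section_at_chart i z (X : P -> V) : ch_dom TC i z -> section_at C X z ->
  exists O, [/\ open O, O (ch_map TC i z), O `<=` U i &
    smooth_on O (fun a => T i (ch_inv TC i a) (X (ch_inv TC i a)))].
Proof. exact: (@bundle_at_chart R (V * V)%type P TC hT V (fun i z w => T i z w) i z X). Qed.

Lemma inv_map i a : U i a -> ch_dom TC i (ch_inv TC i a) /\ ch_map TC i (ch_inv TC i a) = a.
Proof. by move=> /(img_inv hT)[z [iz <- ->]]. Qed.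

(** Constant components [w] in chart [i]: these sections, and the fields below, are the arguments on
    which the conditions on [D] are evaluated. *)
Definition frame_section i (w : V) : P -> V := fun z => uncoord (C := C) i z.1 w.
Definition frame_field i (u : V * V) : P -> V * V := fun z => uncoord (C := TC) i z u.

Lemma frame_sectionE i z w : ch_dom TC i z -> T i z (frame_section i w z) = w.
Proof. by move=> [iz _]; exact: (uncoordK hC). Qed.

Lemma frame_fieldE i z u : ch_dom TC i z -> TT i z (frame_field i u z) = u.
Proof. by move=> iz; exact: (uncoordK hT). Qed.

Lemma frame_section_at i z w : ch_dom TC i z -> section_at C (frame_section i w) z.
Proof.
move=> iz; apply: (section_at_of_chart (O := U i) iz) => //; first exact: imgP.
rewrite setIid => k; apply: (ndiff_eq (f := fun _ => w)) => //; last exact: ndiff_cst.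
by move=> a /inv_map[ia _]; rewrite frame_sectionE.
Qed.

Lemma frame_field_at i z u : ch_dom TC i z -> field_at TC (frame_field i u) z.
Proof.
move=> iz; apply: (field_at_of_chart BB hT (O := U i) iz) => //; first exact: imgP.
rewrite setIid => k; apply: (ndiff_eq (f := fun _ => u)) => //; last exact: ndiff_cst.
by move=> a /inv_map[ia _]; rewrite frame_fieldE.
Qed.

Lemma near_chart i z (W : set P) : ch_open TC W -> W z -> ch_dom TC i z ->
  exists O, [/\ open O, O (ch_map TC i z), O `<=` U i & forall a, O a -> W (ch_inv TC i a)].
Proof.
move=> oW Wz iz; have [h1 h2 h3 h4] := ch_open_img hT oW Wz iz.
by exists (ch_map TC i @` (W `&` ch_dom TC i)).
Qed.

Lemma section_at_eq (W : set P) (X X' : P -> V) z : ch_open TC W -> W z -> ch_pts TC z ->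
  (forall p, W p -> X p = X' p) -> section_at C X z -> section_at C X' z.
Proof.
move=> oW Wz pz XX' sX; have iz := at_dom hT pz; set i := ch_at TC z in iz.
have [Q [oO Oz OU OW]] := near_chart oW Wz iz.
have [Q' [oO' O'z O'U sX']] := section_at_chart iz sX.
apply: (section_at_of_chart (O := Q `&` Q') iz); [exact: openI|by []|].
move=> k; apply: (ndiff_eq (f := fun a => T i (ch_inv TC i a) (X (ch_inv TC i a)))).
- by apply: openI; [exact: openI|exact: Uo].
- by move=> a [[/OW Wa _] _]; rewrite XX'.
- by apply: ndiff_sub (sX' k) => a [[]].
Qed.

Variable D : connection (V := V) (M := M).
Hypothesis hD : is_connection C D.

(* Multiplying by the indicator function of [W], which is smooth near [z],
   makes the two sections equal without changing their derivative at [z]. *)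
Lemma connection_local (W : set P) (X X' : P -> V) z u : ch_open TC W -> W z ->
  ch_pts TC z -> (forall p, W p -> X p = X' p) -> section_at C X z ->
  D z u X = D z u X'.
Proof.
move=> oW Wz pz XX' sX.
have sX' := section_at_eq oW Wz pz XX' sX.
pose f (p : P) : R := if `[< W p >] then 1 else 0.
have fW p : W p -> f p = 1 by move=> Wp; rewrite /f asboolT.
have iz := at_dom hT pz; set i := ch_at TC z in iz.
have sf : fun_at TC f z.
  exists W; split=> // j k.
  apply: (@ndiff_eq R k (V * V)%type R _ (fun _ => 1 : R)); last exact: ndiff_cst.
  - by case: oW.
  - by move=> _ [p [Wp jp] <-]; rewrite (at_mapK hT)// fW.
have df : der TC z u f = 0.
  have [Q [oO Oz OU OW]] := near_chart oW Wz iz.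
  rewrite /der (@eq_open_derive _ _ _ _ _ (fun _ : V * V => 1 : R) _ u oO Oz).
    exact: derive_cst.
  by move=> a /OW Wa; rewrite fW.
have e Y : section_at C Y z -> D z u (fun p => f p *: Y p) = D z u Y.
  by move=> sY; rewrite (con_leibniz hD)// df scale0r add0r fW// scale1r.
rewrite -(e X sX) -(e X' sX'); congr (D z u _); apply/funext => p.
by rewrite /f; case: asboolP => [/XX' ->//|_]; rewrite !scale0r.
Qed.

Lemma connection_zero z u : ch_pts TC z -> D z u (fun _ => 0) = 0.
Proof.
move=> pz; have iz := at_dom hT pz.
have s0 : section_at C (fun _ => 0) z.
  apply: (section_at_of_chart (O := U (ch_at TC z)) iz) => //; first exact: imgP.
  rewrite setIid => k; apply: (ndiff_eq (f := fun _ => 0)) => //; last exact: ndiff_cst.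
  by move=> a /inv_map[[ia _] _]; rewrite tcoord0.
have := con_add hD u pz s0 s0.
under eq_fun do rewrite addr0.
by move=> /eqP; rewrite -subr_eq subrr eq_sym => /eqP.
Qed.

(* Expanding in the frame makes the connection form linear in [w] by definition. *)
Definition omega i : V * V -> V * V -> V -> V := locked_with chart_key (fun a u w =>
  \sum_k fr_co k w *: T i (ch_inv TC i a)
    (cov D (frame_field i u) (frame_section i (fr_vec (f:=B) k)) (ch_inv TC i a))).

Lemma omegaE i a u w : omega i a u w = \sum_k fr_co k w *: T i (ch_inv TC i a)
  (cov D (frame_field i u) (frame_section i (fr_vec (f:=B) k)) (ch_inv TC i a)).
Proof. by rewrite /omega unlock. Qed.

Lemma omega_linr i a u : linear (omega i a u).
Proof.
move=> c v w; rewrite !omegaE scaler_sumr -big_split/=; apply: eq_bigr => k _.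
by rewrite linearP/= scalerDl scalerA.
Qed.

Lemma omega_linl i a w : U i a -> linear (fun u => omega i a u w).
Proof.
move=> Ua c u v; rewrite !omegaE scaler_sumr -big_split/=; apply: eq_bigr => k _.
have [ia _] := inv_map Ua; set z := ch_inv TC i a in ia *.
rewrite /cov {1}/frame_field (_ : uncoord (C := TC) i z (c *: u + v) =
  c *: frame_field i u z + frame_field i v z); last first.
  exact: (jac_linear hT (overlapP ia (at_dom' hT ia)) c u v).
rewrite (con_lin hD); [|exact: ch_pts_dom ia|exact: frame_section_at].
have [ia1 _] := ia.
by rewrite (tcoordD hC)// (tcoordZ hC)// scalerDr !scalerA mulrC.
Qed.

(** A connection yields a section smooth near each single point; the neighbourhoods depend on the
    point and are glued. *)
Lemma omega_smooth i u w : smooth_on (U i) (fun a => omega i a u w).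
Proof.
under eq_fun do rewrite omegaE.
move=> n; apply: ndiff_sum => // k; apply: ndiffZ => //; first exact: ndiff_cst.
apply: ndiff_local => a Ua; have [ia ea] := inv_map Ua.
have := con_smooth hD (ch_pts_dom ia) (frame_field_at u ia)
  (frame_section_at (fr_vec (f:=B) k) ia).
move=> /(section_at_chart ia) [Q [oO Oa OU sO]]; exists Q; last exact: sO.
by rewrite -ea.
Qed.

(** Near [z] the section is a finite combination of coordinate sections with smooth coefficients;
    locality, additivity and the Leibniz rule turn [D] into a directional derivative plus a
    connection form. *)
Lemma connection_chart i z u (O : set (V * V)) (Z : P -> V) (zeta : V * V -> V) :
  ch_dom TC i z -> open O -> O `<=` U i -> O (ch_map TC i z) ->
  (forall a, O a -> T i (ch_inv TC i a) (Z (ch_inv TC i a)) = zeta a) ->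
  smooth_on O zeta ->
  T i z (D z u Z) = 'D_(TT i z u) zeta (ch_map TC i z)
    + omega i (ch_map TC i z) (TT i z u) (zeta (ch_map TC i z)).
Proof.
move=> iz oO OU Oz eZ sz; have [iz1 iz2] := iz.
have pz := ch_pts_dom iz.
pose W := [set p | ch_dom TC i p /\ O (ch_map TC i p)].
have oW : ch_open TC W by exact: (chart_open hT).
have Wz : W z by [].
have sZ : section_at C Z z.
  apply: (section_at_of_chart iz oO Oz) => k.
  by apply: (ndiff_eq (f := zeta)) => [|a [/eZ]//|]; [exact: openI|apply: ndiff_sub (sz k) => a []].
pose f k p : R := fr_co (f:=B) k (T i p (Z p)).
pose e k : P -> V := frame_section i (fr_vec (f:=B) k).
have fE k a : O a -> f k (ch_inv TC i a) = fr_co k (zeta a) by move=> /eZ; rewrite /f => ->.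
have nf k m : ndifferentiable m (O `&` U i) (fun a => f k (ch_inv TC i a)).
  apply: (ndiff_eq (f := fun a => fr_co k (zeta a))); first exact: openI.
    by move=> a [/fE ->].
  apply: ndiff_lin; [exact: fr_cont|exact: openI|].
  by apply: ndiff_sub (sz m) => a [].
have nzeta : differentiable zeta (ch_map TC i z) by exact: (sz 1).1.
(* Additivity of [D] is available for smooth sections only, so every partial sum has to be
   smooth. *)
have sfe (s : seq (fr_idx B)) : section_at C (fun p => \sum_(k <- s) f k p *: e k p) z.
  apply: (section_at_of_chart iz oO Oz) => m.
  apply: (ndiff_eq (f := fun a => \sum_(k <- s) f k (ch_inv TC i a) *: fr_vec (f:=B) k)).
  - exact: openI.
  - move=> a [Oa Ua]; have [ia _] := inv_map Ua.
    rewrite (tcoord_sum hC); last exact: ia.1.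
    by apply: eq_bigr => k _; rewrite (tcoordZ hC) ?frame_sectionE//; exact: ia.1.
  - apply: ndiff_sum; first exact: openI.
    by move=> k; apply: ndiffZ; [exact: openI|exact: nf|exact: ndiff_cst].
have sf k : fun_at TC (f k) z.
  exact: (fun_at_of_chart BB hT (@real_frame R) iz oO Oz (nf k)).
have de k p : W p -> T i p (e k p) = fr_vec (f:=B) k.
  by move=> [ip _]; exact: frame_sectionE.
have ZE p : W p -> Z p = \sum_k f k p *: e k p.
  move=> [ip Op]; have ip1 := ip.1.
  apply: (tcoord_inj hC ip1); rewrite (tcoord_sum hC)//.
  rewrite {1}(frE B (T i p (Z p))); apply: eq_bigr => k _.
  by rewrite (tcoordZ hC)// de.
have Dsum (s : seq (fr_idx B)) : D z u (fun p => \sum_(k <- s) f k p *: e k p) =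
    \sum_(k <- s) (der TC z u (f k) *: e k z + f k z *: D z u (e k)).
  elim: s => [|k s IH].
    by under eq_fun do rewrite big_nil; rewrite big_nil connection_zero.
  under eq_fun do rewrite big_cons.
  rewrite (con_add hD)//; first by rewrite IH big_cons (con_leibniz hD)//; exact: frame_section_at.
  by have := sfe [:: k]; under eq_fun do rewrite big_seq1.
rewrite (connection_local u oW Wz pz ZE sZ) Dsum (tcoord_sum hC)//.
rewrite (frE B ('D_(TT i z u) zeta (ch_map TC i z))) omegaE -big_split.
apply: eq_bigr => k _; cbv beta.
rewrite (tcoordD hC)// !(tcoordZ hC)// de//; congr (_ *: _ + _).
  have dfk : differentiable (fun a => f k (ch_inv TC i a)) (ch_map TC i z).
    by apply: (nf k 1).1; split=> //; exact: imgP.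
  rewrite (der_chart hT u iz dfk).
  rewrite (eq_open_derive (g := fun a => fr_co (f:=B) k (zeta a)) _ oO Oz); last exact: fE.
  rewrite (derive_comp (g := fr_co (f:=B) k) _ nzeta); last first.
    by apply: linear_differentiable; exact: fr_cont.
  by rewrite derive_linear//; exact: fr_cont.
have fz : fr_co (f:=B) k (zeta (ch_map TC i z)) = f k z.
  by rewrite -(fE _ _ Oz) (at_mapK hT iz).
by rewrite fz (at_mapK hT iz) /cov /frame_field (tcoordK hT iz).
Qed.

End ConnectionChart.
Fact chor_arith (R : realType) (d k1 k2 k3 k4 p q : R) :
  2 * d + - (2 * k1) = 2 * k2 + p + 0 + (2 * k3 + 0 + q) ->
  2 * (d - k4 - k2 - k3) - 2 * (k1 - k4) = p + q.
Proof. by lra. Qed.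

Fact half_double (R : realType) (x y : R) : 2 * x = y + y -> x = y.
Proof. by lra. Qed.

Fact sub_swap (R : realType) (x k1 k2 k3 : R) : x - k1 - k2 - k3 = x - k2 - k1 - k3.
Proof. by ring. Qed.

(** * Coordinate computations *)

Section Core.
Context {R : realType} {V : normedModType R}.
Variables (B : frame V) (U : set (V * V)%type).
Hypothesis oU : open U.
Variables (g : V * V -> V -> V -> R) (c : V * V -> V -> V -> V -> R).
Hypothesis g_sym : forall a u w, U a -> g a u w = g a w u.
Hypothesis g_lin : forall a w, U a -> linear (fun u => g a u w : R).
Hypothesis g_pos : forall a w, U a -> w != 0 -> 0 < g a w w.
Hypothesis g_smooth : forall u w, smooth_on U (fun a => g a u w).
Hypothesis dg : forall a u v w, U a ->
  'D_(0, v) (fun b => g b u w) a = 2 * c a v u w.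
Hypothesis c_sym12 : forall a u v w, U a -> c a u v w = c a v u w.
Hypothesis c_sym23 : forall a u v w, U a -> c a u v w = c a u w v.
Hypothesis c_lin : forall a v w, U a -> linear (fun u => c a u v w : R).
Hypothesis c_smooth : forall u v w, smooth_on U (fun a => c a u v w).
Hypothesis c_radial : forall a u w, U a -> c a a.2 u w = 0.

Variable om : V * V -> V * V -> V -> V.
Hypothesis om_linl : forall a w, U a -> linear (fun X => om a X w).
Hypothesis om_linr : forall a X, U a -> linear (om a X).
Hypothesis om_smooth : forall X w, smooth_on U (fun a => om a X w).

(** The map [mu] in coordinates: the derivative of y along [X], corrected by the connection form
    applied to y. *)
Definition mu_form (a X : V * V) : V := X.2 + om a X a.2.

Hypothesis torsion : forall a X Y x, U a ->
  g a (om a X Y.1 - om a Y X.1) x =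
  c a (mu_form a X) Y.1 x - c a (mu_form a Y) X.1 x.

Arguments g_sym {a}.
Arguments g_lin {a}.
Arguments g_pos {a w}.
Arguments c_sym12 {a}.
Arguments c_sym23 {a}.
Arguments c_lin {a}.
Arguments om_linl {a}.
Arguments om_linr {a}.
Arguments torsion {a}.

(* [nlc a u] is the nonlinear connection N_a(u); [hform] and [vform] are the
   horizontal and vertical coefficients of the connection. *)
Definition nlc (a : V * V) (u : V) : V := om a (u, 0) a.2.
Definition hlift (a : V * V) (u : V) : V * V := (u, - nlc a u).
Definition hform (a : V * V) (u w : V) : V := om a (hlift a u) w.
Definition vform (a : V * V) (u w : V) : V := om a (0, u) w.

Let g_linr a u : U a -> linear (g a u : V -> R).
Proof. by move=> Ua k v w; rewrite !(g_sym u _ Ua) g_lin. Qed.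

Let c_lin2 a u w : U a -> linear (fun v => c a u v w : R).
Proof. by move=> Ua k v v'; rewrite !(c_sym12 u _ _ Ua) c_lin. Qed.

Let c_lin3 a u v : U a -> linear (c a u v : V -> R).
Proof. by move=> Ua k w w'; rewrite !(c_sym23 u v _ Ua) c_lin2. Qed.

Section LinearMaps.
Variables (E W : normedModType R) (f : E -> W).
Hypothesis lf : linear f.
Let fl : {linear E -> W} := HB.pack f (GRing.isLinear.Build _ _ _ _ _ lf).

Lemma lin0 : f 0 = 0. Proof. exact: (linear0 fl). Qed.
Lemma linD x y : f (x + y) = f x + f y. Proof. exact: (linearD fl). Qed.
Lemma linN x : f (- x) = - f x. Proof. exact: (linearN fl). Qed.
Lemma linB x y : f (x - y) = f x - f y. Proof. exact: (linearB fl). Qed.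
Lemma linZ k x : f (k *: x) = k *: f x. Proof. exact: (linearZZ fl). Qed.
End LinearMaps.

Lemma g_inj a v w : U a -> (forall x, g a v x = g a w x) -> v = w.
Proof.
move=> Ua e; apply/eqP; rewrite -subr_eq0; apply: contraT => vw.
have := g_pos Ua vw; rewrite (linB (g_lin (v - w) Ua)).
by rewrite e subrr ltxx.
Qed.

(** Torsion on [(0, u)] and [(y, 0)], where the right side vanishes because c kills y. It follows
    that [mu_form] sends [(0, u)] to [u], which is what identifies the vertical coefficients
    next. *)
Lemma vform_radial a u : U a -> vform a u a.2 = 0.
Proof.
move=> Ua; apply: (g_inj Ua) => x.
have := torsion (0, u) (a.2, 0) x Ua; rewrite /= /vform.
rewrite (lin0 (om_linr _ Ua)) subr0 => ->.
rewrite (c_sym12 _ a.2)// c_radial// (lin0 (c_lin2 _ _ Ua)) subr0.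
by rewrite (lin0 (g_lin _ Ua)).
Qed.

Lemma vform_g a u w x : U a -> g a (vform a u w) x = c a u w x.
Proof.
move=> Ua; have := torsion (0, u) (w, 0) x Ua; rewrite /=.
rewrite (lin0 (om_linr _ Ua)) subr0 => ->.
rewrite (lin0 (c_lin2 _ _ Ua)) subr0.
by rewrite /mu_form/= -[om a (0, u) a.2]/(vform a u a.2) vform_radial// addr0.
Qed.

Lemma om_split a u u' w : U a -> om a (u, u') w = om a (u, 0) w + vform a u' w.
Proof.
move=> Ua; rewrite /vform -(linD (om_linl w Ua)); congr (om a _ w).
by congr pair; rewrite /= ?addr0 ?add0r.
Qed.

Lemma mu_formE a X : U a -> mu_form a X = X.2 + nlc a X.1.
Proof.
case: X => u u' Ua; rewrite /mu_form/= om_split// vform_radial// addr0.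
by [].
Qed.

Lemma mu_hlift a u : U a -> mu_form a (hlift a u) = 0.
Proof. by move=> Ua; rewrite mu_formE//= addNr. Qed.

Lemma hformE a u w : U a -> hform a u w = om a (u, 0) w - vform a (nlc a u) w.
Proof.
move=> Ua; rewrite /hform /hlift om_split//; congr (_ + _).
have lv : linear (fun u' => vform a u' w).
  move=> k x y; rewrite /vform -om_linl//; congr (om a _ w).
  by congr pair; rewrite /= ?scaler0 ?addr0.
exact: (linN lv).
Qed.

Lemma hform_radial a u : U a -> hform a u a.2 = nlc a u.
Proof. by move=> Ua; rewrite hformE// vform_radial// subr0. Qed.

(** The torsion is expressed through [mu_form], which vanishes on horizontal lifts. *)
Lemma hform_sym a u w : U a -> hform a u w = hform a w u.
Proof.
move=> Ua; apply/eqP; rewrite -subr_eq0; apply/eqP; apply: (g_inj Ua) => x.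
have := torsion (hlift a u) (hlift a w) x Ua; rewrite !mu_hlift//= => ->.
by rewrite !(lin0 (c_lin _ _ Ua)) subrr (lin0 (g_lin _ Ua)).
Qed.

Let diffU (W : normedModType R) (f : V * V -> W) a : smooth_on U f -> U a -> differentiable f a.
Proof. by move=> sf; exact: (sf 1).1. Qed.

Let snd_smooth : smooth_on U (snd : V * V -> V).
Proof. by move=> k; exact: ndiff_snd. Qed.

Let dsnd a X : 'D_X (snd : V * V -> V) a = X.2.
Proof. by rewrite derive_linear//; exact: continuous_snd. Qed.

Lemma nlc_smooth u : smooth_on U (fun a => nlc a u).
Proof.
move=> k; apply: (ndiff_fiber_linear B (L := fun a w => om a (u, 0) w)) => //.
  by move=> a Ua; exact: om_linr.
by move=> w; exact: om_smooth.
Qed.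

Lemma vform_smooth u w : smooth_on U (fun a => vform a u w).
Proof. exact: om_smooth. Qed.

Lemma hlift_smooth u : smooth_on U (fun a => hlift a u).
Proof.
move=> k; apply: ndiff_pair => //; first exact: ndiff_cst.
apply: (ndiff_eq (f := fun a => - 1 *: nlc a u)) => //.
  by move=> a _; rewrite scaleN1r.
by apply: ndiffZ => //; [exact: ndiff_cst|exact: nlc_smooth].
Qed.

Lemma hform_smooth u w : smooth_on U (fun a => hform a u w).
Proof.
move=> k; apply: (ndiff_fiber_linear (pair_frame B B) (L := fun a X => om a X w)) => //.
- by move=> a Ua; exact: om_linl.
- by move=> X; exact: om_smooth.
- exact: hlift_smooth.
Qed.

Lemma derive_g2 a X (xi eta : V * V -> V) : U a ->
  differentiable xi a -> differentiable eta a ->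
  'D_X (fun b => g b (xi b) (eta b)) a =
  'D_X (fun b => g b (xi a) (eta a)) a + g a ('D_X xi a) (eta a) + g a (xi a) ('D_X eta a).
Proof.
move=> Ua dxi deta.
have d1 w : differentiable (fun b => g b (xi b) w) a.
  apply: (differentiable_fiber_linear B (L := fun b v => g b v w : R) oU) => //.
    by move=> b Ub; exact: g_lin.
  by move=> v; apply: diffU Ua; exact: g_smooth.
rewrite (derive_fiber_linear B (L := fun b w => g b (xi b) w : R) oU)//; last first.
  by move=> b Ub; exact: g_linr.
congr (_ + _).
rewrite (derive_fiber_linear B (L := fun b w => g b w (eta a) : R) oU)//.
  by move=> b Ub; exact: g_lin.
by move=> v; apply: diffU Ua; exact: g_smooth.
Qed.

Lemma derive_c3 a X (xi eta zeta : V * V -> V) : U a ->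
  differentiable xi a -> differentiable eta a -> differentiable zeta a ->
  differentiable (fun b => c b (xi b) (eta b) (zeta b)) a /\
  'D_X (fun b => c b (xi b) (eta b) (zeta b)) a =
  'D_X (fun b => c b (xi a) (eta a) (zeta a)) a + c a ('D_X xi a) (eta a) (zeta a)
  + c a (xi a) ('D_X eta a) (zeta a) + c a (xi a) (eta a) ('D_X zeta a).
Proof.
move=> Ua dxi deta dzeta.
have d0 u v w : differentiable (fun b => c b u v w) a by apply: diffU Ua; exact: c_smooth.
have l1 v w b : U b -> linear (fun u => c b u v w : R) by exact: c_lin.
have d1 v w : differentiable (fun b => c b (xi b) v w) a.
  by apply: (differentiable_fiber_linear B (L := fun b u => c b u v w : R) oU (l1 v w)).
have l2 w b : U b -> linear (fun v => c b (xi b) v w : R) by exact: c_lin2.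
have d2 w : differentiable (fun b => c b (xi b) (eta b) w) a.
  by apply: (differentiable_fiber_linear B (L := fun b v => c b (xi b) v w : R) oU (l2 w)).
have l3 b : U b -> linear (c b (xi b) (eta b) : V -> R) by exact: c_lin3.
split; first by apply: (differentiable_fiber_linear B (L := fun b w => c b (xi b) (eta b) w : R) oU l3).
rewrite (derive_fiber_linear B (L := fun b w => c b (xi b) (eta b) w : R) oU l3)//.
congr (_ + _).
rewrite (derive_fiber_linear B (L := fun b v => c b (xi b) v (zeta a) : R) oU (l2 _))//.
congr (_ + _).
by rewrite (derive_fiber_linear B (L := fun b u => c b u (eta a) (zeta a) : R) oU (l1 _ _)).
Qed.


(** * The hv-curvature and the horizontal derivative of c in coordinates *)

Definition metric_parallel (a X : V * V) : Prop := forall v w,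
  'D_X (fun b => g b v w) a = g a (om a X v) w + g a v (om a X w).

Definition chor (a : V * V) (u v w x : V) : R :=
  'D_(hlift a u) (fun b => c b v w x) a
  - c a (hform a u v) w x - c a v (hform a u w) x - c a v w (hform a u x).

Definition lform (a : V * V) (u v : V) : V :=
  'D_(0, v) (fun b => nlc b u) a - hform a u v.

(** Coordinate form of P. The last term is the connection form on the bracket of the horizontal lift
    of [u] with the constant field [(0, v)]; this bracket is [(0, d_v N u)]. *)
Definition hvform (a : V * V) (u v w : V) : V :=
  'D_(hlift a u) (fun b => vform b v w) a - 'D_(0, v) (fun b => hform b u w) a
  + om a (hlift a u) (vform a v w) - om a (0, v) (hform a u w)
  - vform a ('D_(0, v) (fun b => nlc b u) a) w.

Notation dhform a v u w := ('D_(0, v) (fun b => hform b u w) a).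

(** Differentiating Gamma(u, y) = N u along the fibre also moves y, which produces exactly the
    Gamma(u, v) subtracted in [lform]. *)
Lemma dhform_right a u v : U a -> dhform a v u a.2 = lform a u v.
Proof.
move=> Ua.
have lh b : U b -> linear (hform b u) by move=> Ub; exact: om_linr.
have dh w : differentiable (fun b => hform b u w) a.
  by apply: diffU Ua; exact: hform_smooth.
have dsn : differentiable (snd : V * V -> V) a by apply: diffU Ua; exact: snd_smooth.
have := derive_fiber_linear B oU lh (0, v) Ua dh dsn; rewrite dsnd/= => e.
rewrite /lform (eq_open_derive (f := fun b => nlc b u) (g := fun b => hform b u b.2) _ oU Ua).
  by rewrite e addrK.
by move=> b Ub; rewrite hform_radial.
Qed.

Lemma dhform_sym a u v w : U a -> dhform a v u w = dhform a v w u.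
Proof. by move=> Ua; apply: (eq_open_derive _ oU Ua) => b Ub; exact: hform_sym. Qed.

Lemma dhform_left a w v : U a -> dhform a v a.2 w = lform a w v.
Proof. by move=> Ua; rewrite dhform_sym// dhform_right. Qed.

(** The vertical form kills y, and y moves by - N u along the lift. Hence the first term of [hvform]
    equals [vform a v (nlc a u)] and cancels the fourth. *)
Lemma hvform_radial a u v : U a -> hvform a u v a.2 = - lform a u v.
Proof.
move=> Ua; rewrite /hvform dhform_right// !vform_radial// hform_radial//.
rewrite (lin0 (om_linr _ Ua)) addr0 subr0.
have lv b : U b -> linear (vform b v) by move=> Ub; exact: om_linr.
have dv w : differentiable (fun b => vform b v w) a.
  by apply: diffU Ua; exact: vform_smooth.
have dsn : differentiable (snd : V * V -> V) a by apply: diffU Ua; exact: snd_smooth.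
have := derive_fiber_linear B oU lv (hlift a u) Ua dv dsn; rewrite dsnd/=.
rewrite (eq_open_derive (g := fun _ => 0) _ oU Ua) => [|b Ub]; last exact: vform_radial.
rewrite derive_cst (linN (lv _ Ua)) => /esym/eqP; rewrite subr_eq0 => /eqP ->.
by rewrite addrAC subrr add0r.
Qed.

(** The identity g(C(v, w), x) = c(v, w, x) is differentiated along the lift of [u], where g is
    parallel. *)
Lemma hvform_metric a u v w x : U a -> metric_parallel a (hlift a u) ->
  g a (hvform a u v w) x =
  chor a u v w x - g a (dhform a v u w) x - c a (lform a u v) w x.
Proof.
move=> Ua met.
have dv : differentiable (fun b => vform b v w) a.
  by apply: diffU Ua; exact: vform_smooth.
have dx : differentiable (fun _ : V * V => x) a by exact: differentiable_cst.
have := derive_g2 (hlift a u) Ua dv dx.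
rewrite derive_cst (lin0 (g_linr _ Ua)) addr0 met.
rewrite (eq_open_derive (g := fun b => c b v w x) _ oU Ua); last first.
  by move=> b Ub; rewrite vform_g.
have gl := g_lin x Ua.
rewrite /hvform /chor /lform (linB gl) (linB gl) (linD gl) (linB gl).
rewrite (linB (c_lin w x Ua)) (vform_g _ _ _ Ua).
rewrite -[om a (0, v) (hform a u w)]/(vform a v (hform a u w)) (vform_g _ _ _ Ua).
rewrite -[om a (hlift a u) x]/(hform a u x) (vform_g _ _ _ Ua) => ->.
by ring.
Qed.

(** Parallelism is required only over [a.2], since this is the case known for arbitrary
    constants. *)
Theorem chor_of_hvform a : U a -> (forall X, X.1 = a.2 -> metric_parallel a X) ->
  (forall u v w, hvform a u v w = 0) -> forall v w x, chor a a.2 v w x = 0.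
Proof.
move=> Ua met P0 v w x.
have L0 u' v' : lform a u' v' = 0.
  by apply/eqP; rewrite -oppr_eq0 -hvform_radial// P0.
have := hvform_metric v w x Ua (met (hlift a a.2) erefl).
rewrite P0 dhform_left// !L0 (lin0 (g_lin _ Ua)) (lin0 (c_lin _ _ Ua)).
by rewrite !subr0.
Qed.

(** * The Landsberg case in coordinates, with g parallel in all directions *)

Section Landsberg.
Hypothesis met : forall a X, U a -> metric_parallel a X.

(** The direction [hlift b u] moves with the fibre variable. With the direction frozen, Schwarz
    turns the derivative of g into 2c; its motion [(0, - d_v N u)] gives the N part of [lform]. On
    the right, the fibre derivatives of g supply the remaining terms of [chor] and the Gamma part of
    [lform]. *)
Lemma chor_metric a u v w x : U a ->
  2 * chor a u v w x - 2 * c a (lform a u v) w x =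
  g a (dhform a v u w) x + g a (dhform a v u x) w.
Proof.
move=> Ua.
have dh w' : differentiable (fun b => hform b u w') a.
  by apply: diffU Ua; exact: hform_smooth.
have dcst (y : V) : differentiable (fun _ : V * V => y) a by exact: differentiable_cst.
have gs := g_smooth w x.
have lD b : U b -> linear (fun X => 'D_X (fun b' => g b' w x) b : R).
  by move=> Ub k X Y; rewrite derive_lin//; exact: diffU Ub.
have dD X : differentiable (fun b => 'D_X (fun b' => g b' w x) b) a.
  by apply: diffU Ua => k; exact: (gs k.+1).2.
have dl : differentiable (fun b => hlift b u) a.
  by apply: diffU Ua; exact: hlift_smooth.
have dn : differentiable (fun b => nlc b u) a by apply: diffU Ua; exact: nlc_smooth.
have eL := derive_fiber_linear (pair_frame B B) oU lD (0, v) Ua dD dl.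
have e1 : 'D_(0, v) ('D_(hlift a u) (fun b => g b w x)) a =
          2 * 'D_(hlift a u) (fun b => c b v w x) a.
  apply: etrans (derive_commute_real _ _ oU Ua (gs 3)) _.
  rewrite (eq_open_derive (g := 2 *: (fun b => c b v w x)) _ oU Ua); last first.
    by move=> b Ub; rewrite dg.
  by rewrite deriveZ//; apply/diff_derivable/(diffU _ Ua); exact: c_smooth.
have e2 : 'D_(0, v) (fun b => hlift b u) a = (0, - 'D_(0, v) (fun b => nlc b u) a).
  have dNn : differentiable (fun b => - nlc b u) a by exact: differentiableN.
  rewrite (derive_pair _ _ dNn)//; congr pair; first exact: derive_cst.
  by apply: deriveN; exact: diff_derivable.
have e3 : 'D_('D_(0, v) (fun b => hlift b u) a) (fun b => g b w x) a =
          - (2 * c a ('D_(0, v) (fun b => nlc b u) a) w x).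
  by rewrite e2 dg// (linN (c_lin _ _ Ua)) mulrN.
have eR1 := derive_g2 (0, v) Ua (dh w) (dcst x).
have eR2 := derive_g2 (0, v) Ua (dcst w) (dh x).
have met2 b : U b -> 'D_(hlift b u) (fun b' => g b' w x) b =
    g b (hform b u w) x + g b w (hform b u x).
  by move=> Ub; rewrite met.
have dg1 : differentiable (fun b => g b (hform b u w) x) a.
  apply: (differentiable_fiber_linear B (L := fun b v => g b v x : R) oU) => //.
    by move=> b Ub; exact: g_lin.
  by move=> v'; apply: diffU Ua; exact: g_smooth.
have dg2 : differentiable (fun b => g b w (hform b u x)) a.
  apply: (differentiable_fiber_linear B (L := fun b v => g b w v : R) oU) => //.
    by move=> b Ub; exact: g_linr.
  by move=> v'; apply: diffU Ua; exact: g_smooth.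
have e4 : 'D_(0, v) (fun b => 'D_(hlift b u) (fun b' => g b' w x) b) a =
    'D_(0, v) (fun b => g b (hform b u w) x) a + 'D_(0, v) (fun b => g b w (hform b u x)) a.
  rewrite (eq_open_derive _ oU Ua met2).
  by apply: deriveD; exact: diff_derivable.
move: e4; rewrite eL e1 e3 eR1 eR2 !derive_cst (lin0 (g_lin _ Ua)) (lin0 (g_linr _ Ua)).
rewrite !dg// (g_sym w _ Ua) /chor /lform (linB (c_lin _ _ Ua)).
rewrite (c_sym23 v (hform a u w) _ Ua) (c_sym23 v x _ Ua).
exact: chor_arith.
Qed.

(** Differentiate c(v, y, x) = 0 along the lift: the derivative - N u of y cancels Gamma(u, y). *)
Lemma chor_radial a u v x : U a -> chor a u v a.2 x = 0.
Proof.
move=> Ua.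
have dcst (y : V) : differentiable (fun _ : V * V => y) a by exact: differentiable_cst.
have dsn : differentiable (snd : V * V -> V) a by apply: diffU Ua; exact: snd_smooth.
have [_] := derive_c3 (hlift a u) Ua (dcst v) dsn (dcst x).
rewrite (eq_open_derive (g := fun _ => 0 : R) _ oU Ua); last first.
  by move=> b Ub; rewrite c_sym12// c_radial.
rewrite dsnd !derive_cst (lin0 (c_lin _ _ Ua)) (lin0 (c_lin3 _ _ Ua)).
rewrite /chor hform_radial// (linN (c_lin2 _ _ Ua)) /=.
rewrite (c_sym12 _ a.2 _ Ua) (c_sym12 _ a.2 _ Ua) !c_radial// addr0 !subr0.
by move=> /esym; rewrite addr0.
Qed.

(** Putting y into the slot [w] of [chor_metric] gives [S1]: g(L(u, v), x) = - g(d_v Gamma(u, x),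
    y), so the left side is symmetric in u and x ([S2]). For u = y the right side is - g(L(x, v), y)
    = - g(L(y, v), x), whence L(y, v) = 0. Then [chor_metric] with u = y reads 0 = g(L(w, v), x) +
    g(L(x, v), w), and by symmetry both terms are equal. *)
Lemma lform_eq0 a v w : U a -> (forall v w x, chor a a.2 v w x = 0) -> lform a w v = 0.
Proof.
move=> Ua ch0.
have S1 u x : g a (lform a u v) x = - g a (dhform a v u x) a.2.
  have := chor_metric u v a.2 x Ua; rewrite chor_radial// dhform_right//.
  rewrite (c_sym12 _ a.2 _ Ua) c_radial// mulr0 subr0 => /esym/eqP.
  by rewrite addr_eq0 => /eqP.
have S2 u x : g a (lform a u v) x = g a (lform a x v) u.
  by rewrite !S1 dhform_sym.
have L0 : lform a a.2 v = 0.
  apply: (g_inj Ua) => x; rewrite (lin0 (g_lin _ Ua)).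
  have := S1 a.2 x; rewrite dhform_left// -S2 => /eqP.
  by rewrite -addr_eq0 -mulr2n mulrn_eq0/= => /eqP.
apply: (g_inj Ua) => x; rewrite (lin0 (g_lin _ Ua)).
have := chor_metric a.2 v w x Ua.
rewrite ch0 L0 (lin0 (c_lin _ _ Ua)) subrr !dhform_left// (S2 x) => /esym/eqP.
by rewrite -mulr2n mulrn_eq0/= => /eqP.
Qed.

(** The assumption is made on all of [U] because the resulting identity Gamma(u, w) = d_w N(u) is
    differentiated. *)
Theorem hvform_of_chor a : U a -> (forall b, U b -> forall v w x, chor b b.2 v w x = 0) ->
  forall u v w, hvform a u v w = 0.
Proof.
move=> Ua ch0 u v w.
have L0 b u' v' : U b -> lform b u' v' = 0 by move=> Ub; apply: lform_eq0 => //; exact: ch0.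
have hn b u' w' : U b -> hform b u' w' = 'D_(0, w') (fun b => nlc b u') b.
  by move=> Ub; apply/esym/eqP; rewrite -subr_eq0; apply/eqP; exact: L0.
have Qs v' u' w' : dhform a v' u' w' = dhform a w' u' v'.
  rewrite (eq_open_derive (g := 'D_(0, w') (fun b => nlc b u')) _ oU Ua); last first.
    by move=> b; exact: hn.
  rewrite (derive_commute B _ _ oU Ua (@nlc_smooth u' 3)).
  by apply: (eq_open_derive _ oU Ua) => b Ub; rewrite hn.
have M u' v' w' x : 2 * chor a u' v' w' x =
    g a (dhform a v' u' w') x + g a (dhform a v' u' x) w'.
  by have := chor_metric u' v' w' x Ua; rewrite L0// (lin0 (c_lin _ _ Ua)) mulr0 subr0.
have chs u' v' w' x : chor a u' v' w' x = chor a u' w' v' x.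
  rewrite /chor (eq_open_derive (g := fun b => c b w' v' x) _ oU Ua); last first.
    by move=> b Ub; exact: c_sym12.
  rewrite (c_sym12 (hform a u' v') _ _ Ua) (c_sym12 v' (hform a u' w') _ Ua).
  by rewrite (c_sym12 v' w' _ Ua); exact: sub_swap.
(* Exchanging [v'] and [w'] in [M] preserves the left side by [chs] and the first summand by [Qs],
   so the second summands agree too. *)
have Q3 u' v' w' x : g a (dhform a v' u' x) w' = g a (dhform a w' u' x) v'.
  have := M u' w' v' x; rewrite -(chs u' v' w' x) M (Qs w' u' v') => h.
  exact: (addrI _ h).
apply: (g_inj Ua) => x; rewrite (lin0 (g_lin _ Ua)) hvform_metric//; last exact: met.
rewrite L0// (lin0 (c_lin _ _ Ua)) subr0; apply/eqP; rewrite subr_eq0; apply/eqP.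
have e : g a (dhform a v u x) w = g a (dhform a v u w) x.
  by rewrite (Qs v u x) Q3 (Qs w u v).
by have := M u v w x; rewrite e; exact: half_double.
Qed.

End Landsberg.

End Core.
Fact met_arith (R : realType) (b x k l : R) :
  b = 0 -> l = 2 * x + k - 2 * (x + b) - k -> l = 0.
Proof. by move=> ->; lra. Qed.

Fact dot_arith (R : realType) (f s t k1 k2 k3 d1 d2 d3 : R) : f * s = 1 ->
  (s * t + d1 + d2 + d3) * f - f * (d1 + s * k1) - f * (d2 + s * k2) - f * (d3 + s * k3)
  = t - k1 - k2 - k3.
Proof.
move=> fs; transitivity ((f * s) * (t - k1 - k2 - k3)); first by ring.
by rewrite fs mul1r.
Qed.

Fact F_arith (R : realType) (d f t p p' q q' : R) :
  d *: f + f *: d = t + p + p' -> t = q + q' -> p = - q -> p' = - q' -> f != 0 -> d = 0.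
Proof.
rewrite /GRing.scale/= => e t0 p0 p0' f0; apply: (mulIf f0).
by rewrite mul0r; move: e; rewrite t0 p0 p0'; lra.
Qed.

Lemma frame_inj (R : realType) (E : normedModType R) (B : frame E) (x y : E) :
  (forall k, fr_co (f:=B) k x = fr_co (f:=B) k y) -> x = y.
Proof. by move=> e; rewrite (frE B x) (frE B y); apply: eq_bigr => k _; rewrite e. Qed.

Fact curv_arith (R : realType) (E : normedModType R) (B : frame E)
    (A B1 B2 O1 O2 p1 p2 q1 q2 r1 r2 : E) :
  (A + B1 + (O1 + p1 + q1) + (q2 + r1)) - (A + B2 + (O2 + p2 + q2) + (q1 + r2))
  - ((B1 - B2) + (p1 - p2)) = O1 - O2 + r1 - r2.
Proof.
by apply: (frame_inj (B := B)) => k; rewrite !(linearD, linearN)/=; ring.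
Qed.

Fact scale_arith (R : realType) (d f f' w w' x : R) :
  d = 0 -> f = f' -> w = w' -> d *: x + f *: w = w' * f'.
Proof. by move=> -> -> ->; rewrite scale0r add0r; exact: mulrC. Qed.

Fact addr_oppDN (E : zmodType) (x y : E) : x + (- x - y) = - y.
Proof. by rewrite addrA subrr add0r. Qed.

Fact subrK_oppK (E : zmodType) (x y : E) : x + - y + - - y = x.
Proof. by rewrite opprK subrK. Qed.

Fact hv_arith (R : realType) (E : normedModType R) (B : frame E) (A Dh q r1 r2 : E) :
  A - (Dh + - q) + r1 - r2 = A - Dh + r1 - r2 - - q.
Proof.
by apply: (frame_inj (B := B)) => k; rewrite !(linearD, linearN)/=; ring.
Qed.

Lemma ndiff_fst_comp (R : realType) (E E1 E2 : normedModType R) k (Q : set E)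
    (f : E -> E1 * E2) :
  open Q -> ndifferentiable k Q f -> ndifferentiable k Q (fun b => (f b).1).
Proof. by move=> oQ; apply: (ndiff_lin (l := fst)) => //; exact: continuous_fst. Qed.

Lemma ndiff_snd_comp (R : realType) (E E1 E2 : normedModType R) k (Q : set E)
    (f : E -> E1 * E2) :
  open Q -> ndifferentiable k Q f -> ndifferentiable k Q (fun b => (f b).2).
Proof. by move=> oQ; apply: (ndiff_lin (l := snd)) => //; exact: continuous_snd. Qed.

(** * Cartan-type connections *)

Section CartanType.
Context {R : realType} {V : normedModType R} {M : Type}.
Variables (B : frame V) (C : charts V M).
Hypothesis hC : atlas C.
Hypothesis full : forall x, ch_pts C x.
Hypothesis riesz : forall h : V -> V -> R,
  (forall w, linear (h ^~ w : V -> R)) -> (forall v, linear (h v : V -> R)) ->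
  (forall w, w != 0 -> 0 < h w w) ->
  forall phi : V -> R, linear phi -> exists s, forall w, h s w = phi w.
Variables (F : M * V -> R) (D : connection (V := V) (M := M)).
Hypothesis hF : finsler C F.
Hypothesis hFD : finsler_connection C F D.
Variables (m : nat) (kappa : 'I_m -> R).
Hypothesis hS : compatible C F D (cartan_type_S C F D kappa) (cartan_form F).

Notation P := (M * V)%type.
Notation TC := (TM0 C).
Implicit Types i j : ch_idx C.
Let hT : atlas TC := TM0_atlas B hC.
Let hD : is_connection C D := hFD.1.
Let BB : frame (V * V)%type := pair_frame B B.
Notation U i := (img (C := TC) i).
Notation T i z := (tcoord (C := C) i z.1).
Notation TT i z := (tcoord (C := TC) i z).
Notation g i := (fmetric (energy F i)).
Notation c i := (fcartan (energy F i)).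
Notation om i := (omega B D i).

Let Uo i : open (U i). Proof. exact: (img_open hT). Qed.
Let sG i : smooth_on (U i) (energy F i). Proof. exact: energy_smooth. Qed.
Let cone i := @TM0_img_cone _ _ _ _ hC i.
Let homG i : homogeneous (U i) 2 (energy F i). Proof. exact: energy_homog. Qed.

Let g_sym i a u w : U i a -> g i a u w = g i a w u.
Proof. exact: (fmetric_sym (@Uo i) (@sG i)). Qed.
Let g_lin i a w : U i a -> linear (fun u => g i a u w : R).
Proof. exact: (fmetric_linl (@sG i)). Qed.
Let g_linr i a u : U i a -> linear (g i a u : V -> R).
Proof. exact: (fmetric_linr (@Uo i) (@sG i)). Qed.
Let g_pos i a w : U i a -> w != 0 -> 0 < g i a w w.
Proof. exact: (fmetric_gt0 B hC hF). Qed.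
Let g_smooth i u w : smooth_on (U i) (fun a => g i a u w).
Proof. exact: (fmetric_smooth (@Uo i) (@sG i)). Qed.
Let dg i a u v w : U i a -> 'D_(0, v) (fun b => g i b u w) a = 2 * c i a v u w.
Proof. exact: (derive_fmetric (@sG i)). Qed.
Let c_sym12 i a u v w : U i a -> c i a u v w = c i a v u w.
Proof. exact: (fcartan_sym12 (@Uo i) (@sG i)). Qed.
Let c_sym23 i a u v w : U i a -> c i a u v w = c i a u w v.
Proof. exact: (fcartan_sym23 (@Uo i) (@sG i)). Qed.
Let c_lin i a v w : U i a -> linear (fun u => c i a u v w : R).
Proof. exact: (fcartan_lin1 (@sG i)). Qed.
Let c_lin3 i a u v : U i a -> linear (c i a u v : V -> R).
Proof. exact: (fcartan_lin3 (@Uo i) (@sG i)). Qed.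
Let c_smooth i u v w : smooth_on (U i) (fun a => c i a u v w).
Proof. exact: (fcartan_smooth (@Uo i) (@sG i)). Qed.
Let c_radial i a u w : U i a -> c i a a.2 u w = 0.
Proof. exact: (fcartan_radial (@Uo i) (@cone i) (@sG i) (@homG i)). Qed.
Let om_linl i a w : U i a -> linear (fun X => om i a X w).
Proof. exact: (omega_linl B hC hD). Qed.
Let om_linr i a X : U i a -> linear (om i a X).
Proof. by move=> _; exact: omega_linr. Qed.
Let om_smooth i X w : smooth_on (U i) (fun a => om i a X w).
Proof. exact: (omega_smooth B hC hD). Qed.

Let diffU (W : normedModType R) i (f : V * V -> W) a :
  smooth_on (U i) f -> U i a -> differentiable f a.
Proof. by move=> sf; exact: (sf 1).1. Qed.

Let sndU k (O : set (V * V)) : ndifferentiable k O (snd : V * V -> V).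
Proof. exact: ndiff_snd. Qed.

Let derive_snd (a X : V * V) : 'D_X (snd : V * V -> V) a = X.2.
Proof. by rewrite derive_linear//; exact: continuous_snd. Qed.

Let pts_at z : ch_pts TC z -> ch_dom TC (ch_at C z.1) z.
Proof. by move=> pz; exact: (at_dom hT). Qed.

Let dom_pts i z : ch_dom TC i z -> ch_pts TC z. Proof. exact: ch_pts_dom. Qed.

Let mapU i z : ch_dom TC i z -> U i (ch_map TC i z). Proof. exact: imgP. Qed.

Let radial_section_at z : ch_pts TC z -> section_at C (fun p => p.2) z.
Proof.
move=> /pts_at iz; apply: (section_at_of_chart B hC (O := U (ch_at C z.1)) iz) => //.
  exact: mapU.
rewrite setIid => k; apply: (@ndiff_eq R k (V * V)%type V _ snd) => // a /(inv_map B hC)[_ ea].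
by rewrite -{1}ea.
Qed.

(** * The defining conditions of [D] in a chart *)

Lemma muE z u : mu F D z u = D z u (fun p => p.2).
Proof.
by rewrite /mu; congr (D z u _); apply/funext => p; exact: (F_ell B hC full hF).
Qed.

Lemma mu_chart i z u : ch_dom TC i z ->
  T i z (mu F D z u) = mu_form (om i) (ch_map TC i z) (TT i z u).
Proof.
move=> iz; rewrite muE.
rewrite (connection_chart B hC hD (O := U i) (zeta := snd : V * V -> V) u iz)//.
- by rewrite derive_linear//; exact: continuous_snd.
- exact: mapU.
- by move=> a /(inv_map B hC)[_ ea]; rewrite -[in RHS]ea.
Qed.

Let frame_val i z w : ch_dom TC i z -> frame_section i (T i z w) z = w.
Proof. by move=> [iz _]; exact: (tcoordK hC). Qed.

(** Since [sharp] is a choice with default 0, its defining property holds once some representative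
    exists; [riesz] supplies one for the positive definite form at [z]. *)
Lemma sharp_cartan X Y z w : ch_pts TC z ->
  metric F z (sharp C F (cartan_form F) X Y z) w = cartan F z (X z) (Y z) w.
Proof.
move=> pz; have iz := pts_at pz; set i := ch_at C z.1 in iz.
have tl := tcoord_linear hC iz.1.
have [s hs] : exists s, forall w, metric F z s w = cartan F z (X z) (Y z) w.
  apply: riesz.
  - move=> w' k u v; rewrite !(metric_chart B hC hF _ _ iz) tl g_lin//; exact: mapU.
  - move=> v k u w'; rewrite !(metric_chart B hC hF _ _ iz) tl g_linr//; exact: mapU.
  - by move=> w'; exact: (fin_pos hF).
  - move=> k u w'; rewrite !(cartan_chart B hC hF _ _ _ iz) tl c_lin3; last exact: mapU.
    exact: mulr_lin.
have hex : [set w' | forall Z, section_at C Z z ->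
    metric F z w' (Z z) = cartan_form F X Y Z z] s.
  by move=> Z _; exact: hs.
have := xgetPex 0 (ex_intro _ s hex).
move=> /(_ (frame_section i (T i z w))) /(_ (frame_section_at B hC _ iz)).
by rewrite /cartan_form (frame_val _ iz).
Qed.

(** In the preferred chart, the components of a coordinate field of chart [i] are directional
    derivatives of a transition map, so the bracket is a difference of mixed second derivatives. *)
Lemma frame_bracket i z X Y : ch_dom TC i z ->
  bracket TC (frame_field i X) (frame_field i Y) z = 0.
Proof.
move=> iz; rewrite /bracket; set j := ch_at TC z.
have jz : ch_dom TC j z by exact: (at_dom' hT iz).
have oij := overlapP iz jz.
have derE X' Y' : der TC z (frame_field i X' z) (fun p => tcoord j p (frame_field i Y' p)) =
    'D_X' ('D_Y' (trans (C := TC) i j)) (ch_map TC i z).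
  have e b : overlap (C := TC) i j b ->
      'D_Y' (trans (C := TC) i j) b = tcoord j (ch_inv TC i b) (frame_field i Y' (ch_inv TC i b)).
    move=> /(overlap_inv hT)[p [ip jp <- ->]].
    by rewrite (tcoord_jac hT _ ip jp) (uncoordK hT ip).
  have dD : differentiable ('D_Y' (trans (C := TC) i j)) (ch_map TC i z).
    by apply: ((trans_smooth hT i j 2).2 Y').1.
  rewrite (der_chart hT _ iz); last first.
    apply: near_eq_differentiable dD; apply: open_near oij _; last exact: e.
    exact: (overlap_open hT).
  rewrite (uncoordK hT iz).
  apply: (eq_open_derive _ (overlap_open hT i j) oij) => b ob.
  by rewrite e.
apply: etrans (congr2 (fun x y => x - y) (derE X Y) (derE Y X)) _.
have comm := derive_commute BB X Y (overlap_open hT i j) oij (trans_smooth hT i j 3).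
exact: etrans (congr1 (fun x => x - _) comm) (subrr _).
Qed.

Lemma conn_frame i z u w : ch_dom TC i z ->
  T i z (D z u (frame_section i w)) = om i (ch_map TC i z) (TT i z u) w.
Proof.
move=> iz; rewrite (connection_chart B hC hD (O := U i) (zeta := fun _ => w) _ iz)//.
- by rewrite derive_cst add0r.
- exact: mapU.
- by move=> a /(inv_map B hC)[ia _]; exact: (frame_sectionE hC).
- by move=> k; exact: ndiff_cst.
Qed.

Let TTfst i z (u : V * V) : ch_dom TC i z -> (TT i z u).1 = T i z u.1.
Proof. exact: (tcoord_TM0_fst B hC). Qed.

Lemma conn_rho_frame i z u Y : ch_dom TC i z ->
  T i z (D z u (fun p => rho p (frame_field i Y p))) = om i (ch_map TC i z) (TT i z u) Y.1.
Proof.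
move=> iz; rewrite (connection_chart B hC hD (O := U i) (zeta := fun _ => Y.1) _ iz)//.
- by rewrite derive_cst add0r.
- exact: mapU.
- by move=> a /(inv_map B hC)[ia _]; rewrite -(TTfst _ ia) (frame_fieldE B hC).
- by move=> k; exact: ndiff_cst.
Qed.

(** Coordinate fields have zero bracket and constant images under [rho]; the factor F^-1 of the
    condition cancels the F in A = F c. *)
Lemma torsion_chart i a X Y x : U i a ->
  g i a (om i a X Y.1 - om i a Y X.1) x =
  c i a (mu_form (om i) a X) Y.1 x - c i a (mu_form (om i) a Y) X.1 x.
Proof.
move=> Ua; have [iz ea] := inv_map B hC Ua; set z := ch_inv TC i a in iz ea.
have pz := dom_pts iz; have iz1 := iz.1.
pose s1 := sharp C F (cartan_form F) (fun p => mu F D p (frame_field i X p))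
  (fun p => rho p (frame_field i Y p)) z.
pose s2 := sharp C F (cartan_form F) (fun p => mu F D p (frame_field i Y p))
  (fun p => rho p (frame_field i X p)) z.
have hE : D z (frame_field i X z) (fun p => rho p (frame_field i Y p))
    - D z (frame_field i Y z) (fun p => rho p (frame_field i X p))
    - rho z (bracket TC (frame_field i X) (frame_field i Y) z)
    = (F z)^-1 *: s1 - (F z)^-1 *: s2.
  exact: (cmp_torsion hS pz (frame_field_at B hC X iz) (frame_field_at B hC Y iz)).
rewrite (frame_bracket _ _ iz) (_ : rho z 0 = 0 :> V)// subr0 in hE.
have e0 : om i a X Y.1 - om i a Y X.1 = T i z ((F z)^-1 *: s1 - (F z)^-1 *: s2).
  have e1 X' Y' : om i a X' Y'.1 =
      T i z (D z (frame_field i X' z) (fun p => rho p (frame_field i Y' p))).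
    apply: etrans _ (esym (conn_rho_frame _ _ iz)).
    by rewrite (frame_fieldE B hC X' iz) ea.
  apply: etrans _ (congr1 (fun v => T i z v) hE).
  apply: etrans _ (esym (tcoordB hC _ _ iz1)).
  exact: (congr2 (fun x y => x - y) (e1 X Y) (e1 Y X)).
pose w := uncoord (C := C) i z.1 x.
have xE : x = T i z w by rewrite /w (uncoordK hC).
have ml : linear (fun u => metric F z u w : R).
  move=> k u v; rewrite !(metric_chart B hC hF _ _ iz) (tcoord_linear hC iz1) g_lin//.
  exact: mapU.
have rf X' : T i z (rho z (frame_field i X' z)) = X'.1.
  by rewrite /rho -(TTfst _ iz) (frame_fieldE B hC X' iz).
have mf X' : T i z (mu F D z (frame_field i X' z)) = mu_form (om i) a X'.
  by rewrite (mu_chart _ iz) (frame_fieldE B hC X' iz) ea.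
have F0 : F z != 0 by rewrite gt_eqF// (F_gt0 B hC full hF)//; exact: iz.2.
have sE X' Y' : (F z)^-1 *: cartan F z (mu F D z (frame_field i X' z)) (rho z (frame_field i Y' z)) w
    = c i a (mu_form (om i) a X') Y'.1 x.
  by rewrite (cartan_chart B hC hF _ _ _ iz) mf rf -xE ea /GRing.scale/= mulrA mulVf// mul1r.
rewrite e0 xE -{1}ea -(metric_chart B hC hF _ _ iz) -xE.
have sE' X' Y' := etrans (linZ ml (F z)^-1 _) (etrans
  (congr1 (fun r : R => (F z)^-1 *: r) (sharp_cartan
    (fun p => mu F D p (frame_field i X' p)) (fun p => rho p (frame_field i Y' p)) w pz))
  (sE X' Y')).
apply: etrans (linB ml _ _) _.
exact: (congr2 (fun x y : R => x - y) (sE' X Y) (sE' Y X)).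
Qed.

Definition kappa_sum : triform :=
  fun X Y Z z => \sum_(l < m) kappa l * cartan_dot C F D l.+1 X Y Z z.

(** The vertical terms of the metric condition cancel because T = A, the horizontal A cancels the A
    in S, and only [kappa_sum] is left on the right. *)
Lemma met_chart i z (Zf : P -> V * V) : ch_dom TC i z -> field_at TC Zf z ->
  (forall Y W, section_at C Y z -> section_at C W z ->
    kappa_sum (fun p => rho p (Zf p)) Y W z = 0) ->
  metric_parallel (g i) (om i) (ch_map TC i z) (TT i z (Zf z)).
Proof.
move=> iz fZ b0 v w; have pz := dom_pts iz.
have sv := frame_section_at B hC v iz; have sw := frame_section_at B hC w iz.
have L0 : der TC z (Zf z) (fun p => metric F p (frame_section i v p) (frame_section i w p))
    - metric F z (cov D Zf (frame_section i v) z) (frame_section i w z)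
    - metric F z (frame_section i v z) (cov D Zf (frame_section i w) z) = 0.
  exact: met_arith (b0 _ _ sv sw) (cmp_metric hS pz fZ sv sw).
move: L0.
have gE b : U i b -> g i b v w =
    metric F (ch_inv TC i b) (frame_section i v (ch_inv TC i b)) (frame_section i w (ch_inv TC i b)).
  move=> /(inv_map B hC)[ib eb].
  by rewrite (metric_chart B hC hF _ _ ib) !(frame_sectionE hC _ ib) eb.
have dgm : differentiable (fun b => g i b v w) (ch_map TC i z).
  by apply: diffU (mapU iz); exact: g_smooth.
have -> : der TC z (Zf z) (fun p => metric F p (frame_section i v p) (frame_section i w p))
    = 'D_(TT i z (Zf z)) (fun b => g i b v w) (ch_map TC i z).
  apply: etrans (der_chart hT _ iz _) _.
    by apply: near_eq_differentiable dgm; apply: open_near (mapU iz) gE; exact: Uo.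
  exact: esym (eq_open_derive _ (@Uo i) (mapU iz) gE).
rewrite !(metric_chart B hC hF _ _ iz) /cov.
rewrite (conn_frame _ _ iz) (conn_frame _ _ iz) !(frame_sectionE hC _ iz).
by move/eqP; rewrite -addrA -opprD subr_eq0 => /eqP.
Qed.

Let muFE i a X : U i a -> mu_form (om i) a X = X.2 + nlc (om i) a X.1.
Proof.
exact: (mu_formE (@g_lin i) (@g_pos i) (@c_sym12 i) (@c_lin i) (@c_radial i)
  (@om_linl i) (@om_linr i) (@torsion_chart i)).
Qed.

Let hlift_lin i a : U i a -> linear (hlift (om i) a).
Proof.
move=> Ua k u v; rewrite /hlift /nlc.
have eX : (k *: u + v, 0) = k *: (u, 0) + (v, 0) :> V * V.
  by congr pair; rewrite /= ?scaler0 ?addr0.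
have -> : om i a (k *: u + v, 0) a.2 = k *: om i a (u, 0) a.2 + om i a (v, 0) a.2.
  exact: etrans (congr1 (fun X => om i a X a.2) eX) (om_linl a.2 Ua k (u, 0) (v, 0)).
by rewrite opprD -scalerN.
Qed.

Let hlift_sm i u : smooth_on (U i) (fun a => hlift (om i) a u).
Proof. by apply: (hlift_smooth B) => // *; exact: om_linr. Qed.

(** * Horizontal vectors and the derivatives of A along [lbar] *)

Lemma mu_eq0 i z u : ch_dom TC i z ->
  mu F D z u = 0 <-> TT i z u = hlift (om i) (ch_map TC i z) (T i z u.1).
Proof.
move=> iz; have Uz := mapU iz; split=> [mu0|e].
  have := mu_chart u iz; rewrite mu0 (tcoord0 iz.1) muFE// => /esym/eqP.
  rewrite addr_eq0 => /eqP e2; rewrite -(TTfst _ iz) /hlift.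
  by rewrite [LHS]surjective_pairing e2.
apply: (tcoord_inj hC iz.1); rewrite (mu_chart _ iz) e muFE//= addNr.
by rewrite (tcoord0 iz.1).
Qed.

(** The horizontal lift of [ell] in a chart shows that the choice defining [lbar] is not its default
    value. *)
Lemma lbarP z : ch_pts TC z -> mu F D z (lbar F D z) = 0 /\ rho z (lbar F D z) = ell F z.
Proof.
move=> pz; have iz := pts_at pz; set i := ch_at C z.1 in iz.
pose u := uncoord (C := TC) i z (hlift (om i) (ch_map TC i z) (T i z (ell F z))).
have uE : TT i z u = hlift (om i) (ch_map TC i z) (T i z (ell F z)) by exact: (uncoordK hT iz).
have u1 : u.1 = ell F z.
  by apply: (tcoord_inj hC iz.1); rewrite -(TTfst _ iz) uE.
have hex : [set v | mu F D z v = 0 /\ rho z v = ell F z] u.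
  by split; [apply/(mu_eq0 _ iz); rewrite uE u1|exact: u1].
exact: (xgetPex 0 (ex_intro _ u hex)).
Qed.

Lemma lbar_chart i z : ch_dom TC i z ->
  TT i z (lbar F D z) = hlift (om i) (ch_map TC i z) ((F z)^-1 *: (ch_map TC i z).2).
Proof.
move=> iz; have [m0 re] := lbarP (dom_pts iz).
rewrite ((mu_eq0 _ iz).1 m0); congr (hlift _ _ _).
by rewrite -[(lbar F D z).1]/(rho z (lbar F D z)) re /ell (tcoordZ hC _ _ iz.1).
Qed.

Let F_neq0 z : ch_pts TC z -> F z != 0.
Proof. by move=> /pts_at iz; rewrite gt_eqF// (F_gt0 B hC full hF)//; exact: iz.2. Qed.

Lemma lbar_field z : ch_pts TC z -> field_at TC (lbar F D) z.
Proof.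
move=> pz; have iz := pts_at pz; set i := ch_at C z.1 in iz.
apply: (field_at_of_chart BB hT (O := U i) iz) => //; first exact: mapU.
rewrite setIid => k.
apply: (@ndiff_eq R k (V * V)%type (V * V)%type _
  (fun b => hlift (om i) b ((F (ch_inv TC i b))^-1 *: b.2))) => //.
  by move=> b /(inv_map B hC)[ib eb]; rewrite (lbar_chart ib) eb.
apply: (ndiff_fiber_linear B (L := hlift (om i)) (@Uo i) (@hlift_lin i)).
  by move=> w; exact: hlift_sm.
apply: ndiffZ => //; apply: ndiff_inv => //; last exact: F_smooth.
by move=> b /(inv_map B hC)[ib _]; apply: F_neq0; exact: dom_pts ib.
Qed.

(** The two cases support each other in the induction: the derivative of y along [lbar] is 0, so the
    correction term in the first slot falls under the zero case. An open set is used because the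
    derivative term needs vanishing near the point. *)
Lemma cartan_dot_null k (W : set P) X Y Z : ch_open TC W ->
  (forall p, W p -> X p = 0) \/ (forall p, W p -> X p = p.2) ->
  forall p, W p -> cartan_dot C F D k X Y Z p = 0.
Proof.
move=> oW; elim: k X Y Z => [|k IH] X Y Z hX p Wp.
  case: hX => hX; rewrite /= /cartan_form hX//; first exact: cartan_null.
  exact: (cartan_radial B hC full hF).
have zero_at q : ch_pts TC q -> section_at C (fun _ => 0) q.
  move=> pq; have sr := radial_section_at pq.
  have iq := pts_at pq; apply: (section_at_of_chart B hC (O := U (ch_at C q.1)) iq) => //.
    exact: mapU.
  rewrite setIid => l; apply: (@ndiff_eq R l (V * V)%type V _ (fun _ => 0)) => //; last exact: ndiff_cst.
  by move=> b /(inv_map B hC)[ib _]; rewrite (tcoord0 ib.1).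
have hX' q : W q -> cov D (lbar F D) X q = 0.
  move=> Wq; have pq := oW.1 _ Wq; rewrite /cov; case: hX => hX.
    have e q' : W q' -> 0 = X q' by move=> /hX ->.
    by rewrite -(connection_local B hC hD _ oW Wq pq e (zero_at _ pq)) (connection_zero B hC hD).
  have e q' : W q' -> q'.2 = X q' by move=> /hX ->.
  rewrite -(connection_local B hC hD _ oW Wq pq e (radial_section_at pq)) -muE.
  by have [] := lbarP pq.
have d0 : der TC p (lbar F D p) (cartan_dot C F D k X Y Z) = 0.
  have ip := pts_at (oW.1 _ Wp).
  have [Q [oQ Qp QU QW]] := near_chart B hC oW Wp ip.
  rewrite /der (@eq_open_derive _ _ _ _ _ (fun _ : V * V => 0 : R) _ _ oQ Qp).
    exact: derive_cst.
  by move=> a /QW Wa; exact: IH.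
rewrite /= d0 !(IH _ _ _ hX)// (IH _ _ _ (or_introl hX'))//.
by rewrite !subr0.
Qed.

Lemma met_radial i a X : U i a -> X.1 = a.2 -> metric_parallel (g i) (om i) a X.
Proof.
move=> Ua Xa; have [iz ea] := inv_map B hC Ua; set z := ch_inv TC i a in iz ea.
(* Extends [X] to a field lying over y at every point, so that the first slot of [kappa_sum] is y on
   a whole chart domain. *)
pose Zf (p : P) := uncoord (C := TC) i p ((ch_map TC i p).2, X.2).
have ZE p : ch_dom TC i p -> TT i p (Zf p) = ((ch_map TC i p).2, X.2).
  by move=> ip; exact: (uncoordK hT ip).
have fZ : field_at TC Zf z.
  apply: (field_at_of_chart BB hT (O := U i) iz) => //; first exact: mapU.
  rewrite setIid => k.
  apply: (@ndiff_eq R k (V * V)%type (V * V)%type _ (fun b => (b.2, X.2))) => //.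
    by move=> b /(inv_map B hC)[ib eb]; rewrite (ZE _ ib) eb.
  by apply: ndiff_pair => //; exact: ndiff_cst.
have XE : TT i z (Zf z) = X by rewrite (ZE _ iz) ea -Xa -surjective_pairing.
rewrite -ea -XE; apply: met_chart => // Y W _ _.
rewrite /kappa_sum big1// => l _.
rewrite (@cartan_dot_null _ (ch_dom TC i)) ?mulr0//; first exact: (ch_dom_open hT).
right=> p ip; apply: (tcoord_inj hC ip.1).
by rewrite /rho -(TTfst _ ip) (ZE _ ip).
Qed.

Let section_open X z : ch_pts TC z -> section_at C X z ->
  exists W, [/\ ch_open TC W, W z & forall p, W p -> section_at C X p].
Proof. by move=> _ [W [oW Wz sW]]; exists W; split=> // p Wp; exists W. Qed.

(** The three sections are smooth on a common open set, where the previous form vanishes, so its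
    derivative is 0; the correction terms involve covariant derivatives along [lbar], which are
    again smooth sections. *)
Lemma landsberg_dot : landsberg C F D -> forall k X Y Z z, ch_pts TC z ->
  section_at C X z -> section_at C Y z -> section_at C Z z ->
  cartan_dot C F D k.+1 X Y Z z = 0.
Proof.
move=> L; elim=> [|k IH] X Y Z z pz sX sY sZ; first exact: L.
have sl W : section_at C W z -> section_at C (cov D (lbar F D) W) z.
  by move=> sW; apply: (con_smooth hD) => //; exact: lbar_field.
have [WX [oX zX hX]] := section_open pz sX.
have [WY [oY zY hY]] := section_open pz sY.
have [WZ [oZ zZ hZ]] := section_open pz sZ.
have oW : ch_open TC (WX `&` WY `&` WZ) by do 2!apply: (ch_openI hT) => //.
have iz := pts_at pz.
have [Q [oQ Qz QU QW]] := near_chart B hC oW (conj (conj zX zY) zZ) iz.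
have d0 : der TC z (lbar F D z) (cartan_dot C F D k.+1 X Y Z) = 0.
  rewrite /der (@eq_open_derive _ _ _ _ _ (fun _ : V * V => 0 : R) _ _ oQ Qz).
    exact: derive_cst.
  move=> a Qa; have [[aX aY] aZ] := QW _ Qa; have [ia _] := inv_map B hC (QU _ Qa).
  by apply: IH; [exact: dom_pts ia|exact: hX|exact: hY|exact: hZ].
have stepE : cartan_dot C F D k.+2 X Y Z z =
    der TC z (lbar F D z) (cartan_dot C F D k.+1 X Y Z)
    - cartan_dot C F D k.+1 (cov D (lbar F D) X) Y Z z
    - cartan_dot C F D k.+1 X (cov D (lbar F D) Y) Z z
    - cartan_dot C F D k.+1 X Y (cov D (lbar F D) Z) z by [].
rewrite stepE d0 (IH _ _ _ _ pz (sl _ sX) sY sZ) (IH _ _ _ _ pz sX (sl _ sY) sZ).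
by rewrite (IH _ _ _ _ pz sX sY (sl _ sZ)) !subr0.
Qed.

Lemma met_landsberg : landsberg C F D -> forall i a X, U i a ->
  metric_parallel (g i) (om i) a X.
Proof.
move=> L i a X Ua; have [iz ea] := inv_map B hC Ua; set z := ch_inv TC i a in iz ea.
have XE : TT i z (frame_field i X z) = X by exact: (frame_fieldE B hC).
rewrite -ea -{1}XE; apply: met_chart => //; first exact: (frame_field_at B hC).
move=> Y W sY sW; rewrite /kappa_sum big1// => l _.
rewrite (landsberg_dot L) ?mulr0//; first exact: dom_pts iz.
apply: (section_at_of_chart B hC (O := U i) iz) => //; first exact: mapU.
rewrite setIid => k; apply: (@ndiff_eq R k (V * V)%type V _ (fun _ => X.1)) => //; last exact: ndiff_cst.
by move=> b /(inv_map B hC)[ib _]; rewrite /rho -(TTfst _ ib) (frame_fieldE B hC).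
Qed.

Let hformR i a u : U i a -> hform (om i) a u a.2 = nlc (om i) a u.
Proof.
exact: (hform_radial (@g_lin i) (@g_pos i) (@c_sym12 i) (@c_lin i) (@c_radial i)
  (@om_linl i) (@om_linr i) (@torsion_chart i)).
Qed.

Let gN1 i a u w : U i a -> g i a (- u) w = - g i a u w.
Proof. by move=> Ua; have := linN (g_lin w Ua) u. Qed.

Let gN2 i a u w : U i a -> g i a u (- w) = - g i a u w.
Proof. by move=> Ua; have := linN (g_linr u Ua) w. Qed.

(** Both g and y are parallel along the lift of y, so F^2 = g(y, y) is constant there. This holds
    for all constants kappa and is what lets F pass through the derivative of A. *)
Lemma F_parallel i a : U i a ->
  'D_(hlift (om i) a a.2) (fun b => F (ch_inv TC i b)) a = 0.
Proof.
move=> Ua; have [ia ea] := inv_map B hC Ua.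
have [X [X1 s2 XE]] : exists X : V * V,
    [/\ X.1 = a.2, X.2 = - nlc (om i) a a.2 & X = hlift (om i) a a.2].
  by exists (hlift (om i) a a.2).
rewrite -XE.
have dsn : differentiable (snd : V * V -> V) a.
  by apply: linear_differentiable; exact: continuous_snd.
have dF : differentiable (fun b => F (ch_inv TC i b)) a by apply: diffU Ua; exact: F_smooth.
have e1 : 'D_X (fun b => g i b b.2 b.2) a =
    'D_X (fun b => g i b a.2 a.2) a + g i a X.2 a.2 + g i a a.2 X.2.
  rewrite -(derive_snd a X).
  exact: (derive_g2 B (@Uo i) (@g_sym i) (@g_lin i) (@g_smooth i) X Ua dsn dsn).
have eX : om i a X a.2 = nlc (om i) a a.2 by rewrite XE; exact: hformR.
have gr : 'D_X (fun b => F (ch_inv TC i b) *: F (ch_inv TC i b)) a =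
    'D_X (fun b => g i b b.2 b.2) a.
  apply: (eq_open_derive _ (@Uo i) Ua) => b Ub.
  apply: etrans _ (esym (fmetric_radial (@Uo i) (@cone i) (@sG i) (@homG i) Ub)).
  by rewrite /energy expr2.
have p1 : g i a X.2 a.2 = - g i a (nlc (om i) a a.2) a.2 by rewrite s2 gN1.
have p2 : g i a a.2 X.2 = - g i a a.2 (nlc (om i) a a.2).
  by rewrite s2; exact: gN2 a.2 (nlc (om i) a a.2) Ua.
apply: (F_arith (etrans (esym (derive_scale X dF dF)) (etrans gr e1))).
- exact: (etrans (@met_radial i a X Ua X1 a.2 a.2) (congr2 (fun x y : R => x + y)
    (congr1 (fun v => g i a v a.2) eX) (congr1 (fun v => g i a a.2 v) eX))).
- exact: p1.
- exact: p2.
- by apply: F_neq0; exact: dom_pts ia.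
Qed.

Let cD1 i a u v w x (s : R) : U i a ->
  c i a (u + s *: v) w x = c i a u w x + s * c i a v w x.
Proof.
by move=> Ua; rewrite (linD (c_lin w x Ua)) (linZ (c_lin w x Ua)).
Qed.

Let cD2 i a u v w x (s : R) : U i a ->
  c i a w (u + s *: v) x = c i a w u x + s * c i a w v x.
Proof.
move=> Ua; apply: etrans (c_sym12 w (u + s *: v) x Ua) _.
apply: etrans (cD1 u v w x s Ua) _.
by rewrite (c_sym12 u w x Ua) (c_sym12 v w x Ua).
Qed.

Let cD3 i a u v w x (s : R) : U i a ->
  c i a w x (u + s *: v) = c i a w x u + s * c i a w x v.
Proof.
move=> Ua; apply: etrans (c_sym23 w x (u + s *: v) Ua) _.
apply: etrans (cD2 u v w x s Ua) _.
by rewrite (c_sym23 w u x Ua) (c_sym23 w v x Ua).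
Qed.

Lemma cov_lbar_chart i z X : ch_dom TC i z -> section_at C X z ->
  let a := ch_map TC i z in let X1 := fun b => T i (ch_inv TC i b) (X (ch_inv TC i b)) in
  differentiable X1 a /\
  T i z (cov D (lbar F D) X z) = 'D_((F z)^-1 *: hlift (om i) a a.2) X1 a
    + (F z)^-1 *: hform (om i) a a.2 (T i z (X z)).
Proof.
move=> iz sX a X1; have Ua : U i a by exact: mapU.
have [Q [oQ Qz QU sQ]] := section_at_chart B hC iz sX.
have xa : X1 a = T i z (X z) by rewrite /X1 (at_mapK hT iz).
have lE : TT i z (lbar F D z) = (F z)^-1 *: hlift (om i) a a.2.
  by rewrite (lbar_chart iz); exact: (linZ (hlift_lin Ua)).
split; first exact: (sQ 1).1.
have cE := connection_chart B hC hD (lbar F D z) iz oQ QU Qz (fun b _ => erefl (X1 b)) sQ.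
apply: etrans cE _; rewrite lE -/a xa; congr (_ + _).
exact: (linZ (om_linl (T i z (X z)) Ua)).
Qed.

(** Here [lbar] is F^-1 times the lift of y and A = F c. As F is constant along this lift, the two
    factors cancel, and the derivatives of the sections cancel between the product rule and the
    correction terms. *)
Lemma cartan_dot1_chart i z X Y Z : ch_dom TC i z ->
  section_at C X z -> section_at C Y z -> section_at C Z z ->
  cartan_dot C F D 1 X Y Z z =
  chor (c i) (om i) (ch_map TC i z) (ch_map TC i z).2
    (T i z (X z)) (T i z (Y z)) (T i z (Z z)).
Proof.
move=> iz sX sY sZ.
have [dX eX] := cov_lbar_chart iz sX.
have [dY eY] := cov_lbar_chart iz sY.
have [dZ eZ] := cov_lbar_chart iz sZ.
have Ua := mapU iz; have pz := dom_pts iz.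
set a := ch_map TC i z in dX eX dY eY dZ eZ Ua *.
set X1 := fun b => T i (ch_inv TC i b) (X (ch_inv TC i b)) in dX eX.
set Y1 := fun b => T i (ch_inv TC i b) (Y (ch_inv TC i b)) in dY eY.
set Z1 := fun b => T i (ch_inv TC i b) (Z (ch_inv TC i b)) in dZ eZ.
have xa : X1 a = T i z (X z) by rewrite /X1 (at_mapK hT iz).
have ya : Y1 a = T i z (Y z) by rewrite /Y1 (at_mapK hT iz).
have za : Z1 a = T i z (Z z) by rewrite /Z1 (at_mapK hT iz).
pose s := (F z)^-1; pose hl := hlift (om i) a a.2.
pose Fc b := F (ch_inv TC i b).
have dF : differentiable Fc a by apply: diffU Ua; exact: F_smooth.
have Fa : Fc a = F z by rewrite /Fc (at_mapK hT iz).
have [dc ec0] := derive_c3 B (@Uo i) (@c_sym12 i) (@c_sym23 i) (@c_lin i) (@c_smooth i)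
  (s *: hl) Ua dX dY dZ.
set x0 := T i z (X z) in xa eX *; set y0 := T i z (Y z) in ya eY *.
set z0 := T i z (Z z) in za eZ *.
have ec := ec0; rewrite xa ya za in ec.
have lE : TT i z (lbar F D z) = s *: hl.
  by rewrite (lbar_chart iz); exact: (linZ (hlift_lin Ua)).
have Dhl (f : V * V -> R) : differentiable f a -> 'D_(s *: hl) f a = s * 'D_hl f a.
  by move=> df; have := derive_lin s hl 0 df; rewrite derive0 !addr0.
have formE b : U i b -> Fc b *: c i b (X1 b) (Y1 b) (Z1 b) =
    cartan_form F X Y Z (ch_inv TC i b).
  move=> /(inv_map B hC)[ib eb]; apply: etrans _ (esym (cartan_chart B hC hF _ _ _ ib)).
  exact: esym (congr1 (fun b' => F (ch_inv TC i b) * c i b' (X1 b) (Y1 b) (Z1 b)) eb).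
have t1 : der TC z (lbar F D z) (cartan_form F X Y Z) =
    (s * 'D_hl (fun b => c i b x0 y0 z0) a + c i a ('D_(s *: hl) X1 a) y0 z0
     + c i a x0 ('D_(s *: hl) Y1 a) z0 + c i a x0 y0 ('D_(s *: hl) Z1 a)) * F z.
  have dform : differentiable (fun b => Fc b *: c i b (X1 b) (Y1 b) (Z1 b)) a.
    exact: differentiable_scale.
  apply: etrans (der_chart hT _ iz _) _.
    by apply: near_eq_differentiable dform; apply: open_near Ua formE; exact: Uo.
  rewrite lE; apply: etrans (esym (eq_open_derive _ (@Uo i) Ua formE)) _.
  apply: etrans (derive_scale _ dF dc) _.
  have dF0 : 'D_(s *: hl) Fc a = 0.
    exact: etrans (Dhl Fc dF) (etrans (congr1 (fun r => s * r) (F_parallel Ua)) (mulr0 s)).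
  have dcc := Dhl _ (diffU (@c_smooth i x0 y0 z0) Ua).
  apply: scale_arith dF0 Fa (etrans ec _).
  exact: (congr1 (fun r => r + _ + _ + _) dcc).
have k1 : cartan F z (cov D (lbar F D) X z) (Y z) (Z z) =
    F z * (c i a ('D_(s *: hl) X1 a) y0 z0 + s * c i a (hform (om i) a a.2 x0) y0 z0).
  apply: etrans (cartan_chart B hC hF _ _ _ iz) (congr1 (fun r => F z * r) _).
  exact: etrans (congr1 (fun v => c i a v y0 z0) eX) (cD1 _ _ _ _ _ Ua).
have k2 : cartan F z (X z) (cov D (lbar F D) Y z) (Z z) =
    F z * (c i a x0 ('D_(s *: hl) Y1 a) z0 + s * c i a x0 (hform (om i) a a.2 y0) z0).
  apply: etrans (cartan_chart B hC hF _ _ _ iz) (congr1 (fun r => F z * r) _).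
  exact: etrans (congr1 (fun v => c i a x0 v z0) eY) (cD2 _ _ _ _ _ Ua).
have k3 : cartan F z (X z) (Y z) (cov D (lbar F D) Z z) =
    F z * (c i a x0 y0 ('D_(s *: hl) Z1 a) + s * c i a x0 y0 (hform (om i) a a.2 z0)).
  apply: etrans (cartan_chart B hC hF _ _ _ iz) (congr1 (fun r => F z * r) _).
  exact: etrans (congr1 (fun v => c i a x0 y0 v) eZ) (cD3 _ _ _ _ _ Ua).
have -> : cartan_dot C F D 1 X Y Z z = der TC z (lbar F D z) (cartan_form F X Y Z)
    - cartan F z (cov D (lbar F D) X z) (Y z) (Z z)
    - cartan F z (X z) (cov D (lbar F D) Y z) (Z z)
    - cartan F z (X z) (Y z) (cov D (lbar F D) Z z) by [].
have fs : F z * s = 1 by rewrite /s mulfV// F_neq0.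
apply: etrans (dot_arith _ _ _ _ _ _ _ fs).
exact: (congr2 (fun x y : R => x - y) (congr2 (fun x y : R => x - y)
  (congr2 (fun x y : R => x - y) t1 k1) k2) k3).
Qed.

(** * The curvature in a chart *)

Lemma cov_chart i (Q : set (V * V)) (X : P -> V * V) (Z : P -> V) xi zt :
  open Q -> Q `<=` U i ->
  (forall b, Q b -> TT i (ch_inv TC i b) (X (ch_inv TC i b)) = xi b) ->
  (forall b, Q b -> T i (ch_inv TC i b) (Z (ch_inv TC i b)) = zt b) ->
  smooth_on Q zt -> forall b, Q b ->
  T i (ch_inv TC i b) (cov D X Z (ch_inv TC i b)) =
  'D_(xi b) zt b + om i b (xi b) (zt b).
Proof.
move=> oQ QU hX hZ sz b Qb; have [ib eb] := inv_map B hC (QU _ Qb).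
have Qz : Q (ch_map TC i (ch_inv TC i b)) by rewrite eb.
have := connection_chart B hC hD (X (ch_inv TC i b)) ib oQ QU Qz hZ sz.
by rewrite eb (hX _ Qb).
Qed.

Lemma om_chart_smooth i (Q : set (V * V)) (xi : V * V -> V * V) (zt : V * V -> V) :
  open Q -> Q `<=` U i -> smooth_on Q xi -> smooth_on Q zt ->
  smooth_on Q (fun b => om i b (xi b) (zt b)).
Proof.
move=> oQ QU sx sz k.
apply: (ndiff_fiber_linear B (L := fun b w => om i b (xi b) w) oQ).
- by move=> b /QU; exact: om_linr.
- move=> w; apply: (ndiff_fiber_linear BB (L := fun b X => om i b X w) oQ).
  + by move=> b /QU; exact: om_linl.
  + by move=> X; apply: ndiff_sub (om_smooth i X w k).
  + exact: sx.
- exact: sz.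
Qed.

Lemma derive_om i (Q : set (V * V)) (xi : V * V -> V * V) (zt : V * V -> V) a w :
  open Q -> Q `<=` U i -> Q a -> smooth_on Q xi -> smooth_on Q zt ->
  'D_w (fun b => om i b (xi b) (zt b)) a =
  'D_w (fun b => om i b (xi a) (zt a)) a + om i a ('D_w xi a) (zt a)
  + om i a (xi a) ('D_w zt a).
Proof.
move=> oQ QU Qa sx sz.
have dx : differentiable xi a by exact: (sx 1).1.
have dz : differentiable zt a by exact: (sz 1).1.
have l1 v b : Q b -> linear (fun X => om i b X v) by move=> /QU; exact: om_linl.
have l2 b : Q b -> linear (om i b (xi b)) by move=> /QU; exact: om_linr.
have d0 X v : differentiable (fun b => om i b X v) a.
  by apply: diffU (QU _ Qa); exact: om_smooth.
have d1 v : differentiable (fun b => om i b (xi b) v) a.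
  exact: (differentiable_fiber_linear BB oQ (l1 v) Qa (fun X => d0 X v) dx).
apply: etrans (derive_fiber_linear B oQ l2 w Qa d1 dz) _.
apply: (congr1 (fun r => r + om i a (xi a) ('D_w zt a))).
exact: (derive_fiber_linear BB oQ (l1 (zt a)) w Qa (fun X => d0 X (zt a)) dx).
Qed.

(** Second derivatives of [zt] cancel by Schwarz, and the derivatives of [xi] and [yi] cancel
    against the bracket term, so all arguments are frozen at [a]. In the preferred chart [tcoord] at
    [z] is the identity, so the value needs no conversion. *)
Lemma curvature_chart z (Q : set (V * V)) (X Y : P -> V * V) (Z : P -> V) xi yi zt :
  ch_pts TC z -> let i := ch_at C z.1 in let a := ch_map TC i z in
  open Q -> Q `<=` U i -> Q a ->
  (forall b, Q b -> TT i (ch_inv TC i b) (X (ch_inv TC i b)) = xi b) ->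
  (forall b, Q b -> TT i (ch_inv TC i b) (Y (ch_inv TC i b)) = yi b) ->
  (forall b, Q b -> T i (ch_inv TC i b) (Z (ch_inv TC i b)) = zt b) ->
  smooth_on Q xi -> smooth_on Q yi -> smooth_on Q zt ->
  curvature C D X Y Z z =
  'D_(xi a) (fun b => om i b (yi a) (zt a)) a - 'D_(yi a) (fun b => om i b (xi a) (zt a)) a
  + om i a (xi a) (om i a (yi a) (zt a)) - om i a (yi a) (om i a (xi a) (zt a)).
Proof.
move=> pz i a oQ QU Qa hX hY hZ sx sy sz; have iz : ch_dom TC i z by exact: pts_at.
have az : ch_inv TC i a = z by exact: (at_mapK hT iz).
have Tid v : T i z v = v by exact: (tcoord_at hC _ (full z.1)).
have TTid u : TT i z u = u by exact: (tcoord_at hT _ pz).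
have Xz : X z = xi a by rewrite -(hX _ Qa) az TTid.
have Yz : Y z = yi a by rewrite -(hY _ Qa) az TTid.
have snab (ui : V * V -> V * V) : smooth_on Q ui ->
    smooth_on Q (fun b => 'D_(ui b) zt b + om i b (ui b) (zt b)).
  move=> su k; apply: ndiffD => //; last exact: om_chart_smooth.
  apply: (ndiff_fiber_linear BB (L := fun b w => 'D_w zt b) oQ).
  - by move=> b Qb e u v; rewrite derive_lin//; exact: (sz 1).1.
  - by move=> w; exact: (sz k.+1).2.
  - exact: su.
have covcov (X' Y' : P -> V * V) (xi' yi' : V * V -> V * V) :
    (forall b, Q b -> TT i (ch_inv TC i b) (X' (ch_inv TC i b)) = xi' b) ->
    (forall b, Q b -> TT i (ch_inv TC i b) (Y' (ch_inv TC i b)) = yi' b) ->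
    smooth_on Q xi' -> smooth_on Q yi' ->
    cov D X' (cov D Y' Z) z =
    'D_(xi' a) ('D_(yi' a) zt) a + 'D_('D_(xi' a) yi' a) zt a
    + ('D_(xi' a) (fun b => om i b (yi' a) (zt a)) a + om i a ('D_(xi' a) yi' a) (zt a)
       + om i a (yi' a) ('D_(xi' a) zt a))
    + (om i a (xi' a) ('D_(yi' a) zt a) + om i a (xi' a) (om i a (yi' a) (zt a))).
  move=> hX' hY' sx' sy'.
  have hN := cov_chart oQ QU hY' hZ sz.
  have := cov_chart oQ QU hX' hN (snab _ sy') Qa; rewrite az Tid => ->.
  have lD b : Q b -> linear (fun w => 'D_w zt b).
    by move=> Qb e u v; rewrite derive_lin//; exact: (sz 1).1.
  have dD w : differentiable (fun b => 'D_w zt b) a by apply: ((sz 2).2 w).1.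
  have dy' : differentiable yi' a by exact: (sy' 1).1.
  have d1 : differentiable (fun b => 'D_(yi' b) zt b) a.
    exact: (differentiable_fiber_linear BB oQ lD Qa dD dy').
  have d2 : differentiable (fun b => om i b (yi' b) (zt b)) a.
    by apply: ((om_chart_smooth oQ QU sy' sz) 1).1.
  have e1 := derive_fiber_linear BB oQ lD (xi' a) Qa dD dy'.
  have e2 := derive_om (xi' a) oQ QU Qa sy' sz.
  have e3 := deriveD (@diff_derivable _ _ _ _ a (xi' a) d1) (@diff_derivable _ _ _ _ a (xi' a) d2).
  apply: (congr2 (fun x y : V => x + y)).
    by apply: etrans e3 _; rewrite e1 e2.
  exact: (linD (om_linr (xi' a) (QU _ Qa))).
have derQ (W : V * V) (Y' : P -> V * V) yi' :
    (forall b, Q b -> TT i (ch_inv TC i b) (Y' (ch_inv TC i b)) = yi' b) ->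
    der TC z W (fun p => TT i p (Y' p)) = 'D_W yi' a.
  by move=> hY'; apply: (eq_open_derive _ oQ Qa).
have br : bracket TC X Y z = 'D_(xi a) yi a - 'D_(yi a) xi a.
  have h : bracket TC X Y z =
    der TC z (X z) (fun p => TT i p (Y p)) - der TC z (Y z) (fun p => TT i p (X p)) by [].
  by rewrite h (derQ _ _ _ hY) (derQ _ _ _ hX) Xz Yz.
have covbr : cov D (bracket TC X Y) Z z =
    ('D_('D_(xi a) yi a) zt a - 'D_('D_(yi a) xi a) zt a)
    + (om i a ('D_(xi a) yi a) (zt a) - om i a ('D_(yi a) xi a) (zt a)).
  have Qz : Q (ch_map TC i z) by exact: Qa.
  have := connection_chart B hC hD (bracket TC X Y z) iz oQ QU Qz hZ sz.
  rewrite Tid TTid /cov => ->; rewrite br -/a; apply: (congr2 (fun x y : V => x + y)).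
    have lD : linear (fun w => 'D_w zt a).
      by move=> e u v; rewrite derive_lin//; exact: (sz 1).1.
    exact: (linB lD).
  exact: (linB (om_linl (zt a) (QU _ Qa))).
have comm : 'D_(yi a) ('D_(xi a) zt) a = 'D_(xi a) ('D_(yi a) zt) a.
  exact: (derive_commute B _ _ oQ Qa (sz 3)).
rewrite /curvature (covcov _ _ _ _ hX hY sx sy) (covcov _ _ _ _ hY hX sy sx) comm covbr.
exact: (curv_arith B).
Qed.

(** The stated vector is a candidate for the choice, and the only one: horizontality of [u - v]
    determines its fibre component from its base component, which is that of [u]. *)
Lemma vproj_chart i z u : ch_dom TC i z ->
  TT i z (vproj F D z u) = (0, mu_form (om i) (ch_map TC i z) (TT i z u)).
Proof.
move=> iz; have Ua := mapU iz; set a := ch_map TC i z in Ua *.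
have muB v : mu F D z (u - v) = 0 <->
    TT i z u - TT i z v = hlift (om i) a (TT i z u - TT i z v).1.
  rewrite -(tcoordB hT _ _ iz) (TTfst _ iz); exact: mu_eq0.
pose v0 := uncoord (C := TC) i z (0, mu_form (om i) a (TT i z u)).
have v0E : TT i z v0 = (0, mu_form (om i) a (TT i z u)) by exact: (uncoordK hT iz).
have hex : [set v | rho z v = 0 /\ mu F D z (u - v) = 0] v0.
  split; first by apply: (tcoord_inj hC iz.1); rewrite (tcoord0 iz.1) /rho -(TTfst _ iz) v0E.
  apply/muB; rewrite v0E muFE//; case: (TT i z u) => p q; rewrite /hlift/=.
  by congr pair; rewrite /= subr0 opprD addr_oppDN.
have [r0 m0] := xgetPex 0 (ex_intro _ v0 hex).
set v := xget 0 _ in r0 m0.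
rewrite -[vproj F D z u]/v; have v1 : (TT i z v).1 = 0.
  by rewrite (TTfst _ iz) -[v.1]/(rho z v) r0 (tcoord0 iz.1).
move/muB: m0; rewrite (muFE _ Ua); move: (TT i z u) (TT i z v) v1 => tu tv v1 m0.
have e2 : tu.2 - tv.2 = - nlc (om i) a (tu.1 - tv.1) by exact: (congr1 snd m0).
rewrite v1 subr0 in e2; rewrite [LHS]surjective_pairing v1; congr pair.
by rewrite -[nlc (om i) a tu.1]opprK -e2 opprB addrC subrK.
Qed.

Lemma hproj_chart i z u : ch_dom TC i z ->
  TT i z (hproj F D z u) = hlift (om i) (ch_map TC i z) (TT i z u).1.
Proof.
move=> iz; rewrite /hproj (tcoordB hT _ _ iz) (vproj_chart _ iz) (muFE _ (mapU iz)).
case: (TT i z u) => p q; rewrite /hlift/=.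
by congr pair; rewrite /= ?subr0// opprD addr_oppDN.
Qed.

(** The general curvature formula freezes the horizontal lift in the fibre derivative, while [hform]
    lets it move. The difference is [vform] of [d_v N u], the last term of [hvform]. *)
Lemma hv_chart z X Y Z : ch_pts TC z -> field_at TC X z -> field_at TC Y z ->
  section_at C Z z -> let i := ch_at C z.1 in let a := ch_map TC i z in
  hv_curvature C F D X Y Z z =
  hvform (om i) a (TT i z (X z)).1 (mu_form (om i) a (TT i z (Y z))) (T i z (Z z)).
Proof.
move=> pz fX fY sZ i a; have iz : ch_dom TC i z by exact: pts_at.
have az : ch_inv TC i a = z by exact: (at_mapK hT iz).
have [QX [oX aX UX smX]] := field_at_chart hT iz fX.
have [QY [oY aY UY smY]] := field_at_chart hT iz fY.
have [QZ [oZ aZ UZ smZ]] := section_at_chart B hC iz sZ.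
pose x b := TT i (ch_inv TC i b) (X (ch_inv TC i b)).
pose y b := TT i (ch_inv TC i b) (Y (ch_inv TC i b)).
pose zt b := T i (ch_inv TC i b) (Z (ch_inv TC i b)).
pose Q := QX `&` QY `&` QZ.
have oQ : open Q by apply: openI => //; exact: openI.
have QU : Q `<=` U i by move=> b [[/UX]].
have Qa : Q a by [].
have sx : smooth_on Q x by move=> k; apply: ndiff_sub (smX k) => b [[]].
have sy : smooth_on Q y by move=> k; apply: ndiff_sub (smY k) => b [[]].
have sz : smooth_on Q zt by move=> k; apply: ndiff_sub (smZ k) => b [].
have hX b : Q b -> TT i (ch_inv TC i b) (hproj F D (ch_inv TC i b) (X (ch_inv TC i b))) =
    hlift (om i) b (x b).1.
  by move=> Qb; have [ib eb] := inv_map B hC (QU _ Qb); rewrite (hproj_chart _ ib) eb.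
have hY b : Q b -> TT i (ch_inv TC i b) (vproj F D (ch_inv TC i b) (Y (ch_inv TC i b))) =
    (0, mu_form (om i) b (y b)).
  by move=> Qb; have [ib eb] := inv_map B hC (QU _ Qb); rewrite (vproj_chart _ ib) eb.
have shl : smooth_on Q (fun b => hlift (om i) b (x b).1).
  move=> k; apply: (ndiff_fiber_linear B (L := hlift (om i)) oQ).
  - by move=> b /QU; exact: hlift_lin.
  - by move=> w; apply: ndiff_sub (hlift_sm i w k).
  - exact: (ndiff_fst_comp oQ (sx k)).
have svp : smooth_on Q (fun b => ((0, mu_form (om i) b (y b)) : V * V)).
  move=> k; apply: ndiff_pair => //; first exact: ndiff_cst.
  apply: (ndiffD oQ (ndiff_snd_comp oQ (sy k))).
  exact: (om_chart_smooth oQ QU sy (fun k => @sndU k Q)).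
have xa : x a = TT i z (X z) by exact: (congr1 (fun p => TT i p (X p)) az).
have ya : y a = TT i z (Y z) by exact: (congr1 (fun p => TT i p (Y p)) az).
have za : zt a = T i z (Z z) by exact: (congr1 (fun p => T i p (Z p)) az).
have hZ b : Q b -> T i (ch_inv TC i b) (Z (ch_inv TC i b)) = zt b by [].
have cur := @curvature_chart z Q (fun p => hproj F D p (X p)) (fun p => vproj F D p (Y p))
  Z (fun b => hlift (om i) b (x b).1) (fun b => (0, mu_form (om i) b (y b))) zt
  pz oQ QU Qa hX hY hZ shl svp sz.
apply: etrans cur _; rewrite -xa -ya -za; cbv zeta beta; rewrite -/i -/a.
move: (x a).1 (mu_form (om i) a (y a)) (zt a) => u v w {xa ya za}.
have Ua := QU _ Qa.
have dn : differentiable (fun b => nlc (om i) b u) a.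
  by apply: diffU Ua; apply: (nlc_smooth B) => // *; exact: om_linr.
have dhl : 'D_(0, v) (fun b => hlift (om i) b u) a =
    (0, - 'D_(0, v) (fun b => nlc (om i) b u) a).
  have dNn : differentiable (fun b => - nlc (om i) b u) a by exact: differentiableN.
  rewrite (derive_pair _ (differentiable_cst _ _) dNn); congr pair; first exact: derive_cst.
  by apply: deriveN; exact: diff_derivable.
have scst : smooth_on (U i) (fun _ : V * V => w) by move=> k; exact: ndiff_cst.
have Dh := derive_om (0, v) (@Uo i) (fun b h => h) Ua (hlift_sm i u) scst.
have lv : linear (fun n => om i a (0, n) w).
  by move=> k n n'; rewrite fibre_lin; exact: (om_linl w Ua).
have qE : om i a ('D_(0, v) (fun b => hlift (om i) b u) a) w =
    - vform (om i) a ('D_(0, v) (fun b => nlc (om i) b u) a) w.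
  by rewrite dhl; exact: (linN lv).
have om0 X' : om i a X' 0 = 0 by exact: (lin0 (om_linr X' Ua)).
have Dh' : 'D_(0, v) (fun b => om i b (hlift (om i) a u) w) a =
    'D_(0, v) (fun b => hform (om i) b u w) a
    + - - vform (om i) a ('D_(0, v) (fun b => nlc (om i) b u) a) w.
  have -> : 'D_(0, v) (fun b => hform (om i) b u w) a =
    'D_(0, v) (fun b => om i b (hlift (om i) a u) w) a
    + - vform (om i) a ('D_(0, v) (fun b => nlc (om i) b u) a) w.
    apply: etrans Dh _; rewrite qE.
    by rewrite (_ : 'D_(0, v) (fun _ => w) a = 0) ?om0 ?addr0//; exact: derive_cst.
  by rewrite subrK_oppK.
rewrite Dh' /hvform; apply: etrans (hv_arith B _ _ _ _ _) _.
by rewrite opprK.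
Qed.

Lemma hv_curvature_landsberg : hv_curvature_vanishes C F D <-> landsberg C F D.
Proof.
split=> [P0 X Y Z z pz sX sY sZ|L X Y Z z pz fX fY sZ].
  have iz := pts_at pz; set i := ch_at C z.1 in iz; have Ua := mapU iz.
  rewrite (cartan_dot1_chart iz sX sY sZ).
  apply: (chor_of_hvform B (@Uo i) (@g_sym i) (@g_lin i) (@g_pos i) (@g_smooth i)
    (@c_sym12 i) (@c_lin i) (@c_radial i) (@om_linl i) (@om_linr i) (@om_smooth i)
    (@torsion_chart i) Ua).
    by move=> X'; exact: met_radial.
  move=> u v w.
  (* The horizontal part of the first field lies over [u], and the vertical part of the second is
     [v], so arbitrary arguments of [hvform] are reached. *)
  have f1 := frame_field_at B hC (u, 0) iz; have f2 := frame_field_at B hC (0, v) iz.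
  have f3 := frame_section_at B hC w iz.
  have e1 := congr1 fst (frame_fieldE B hC (u, 0) iz).
  have e2 : mu_form (om i) (ch_map TC i z) (TT i z (frame_field i (0, v) z)) = v.
    apply: etrans (congr1 (mu_form (om i) (ch_map TC i z)) (frame_fieldE B hC (0, v) iz)) _.
    by rewrite (muFE _ Ua) /nlc (lin0 (om_linl _ Ua)) addr0.
  have e3 := frame_sectionE hC w iz.
  apply: etrans (esym (f_equal3 (hvform (om i) (ch_map TC i z)) e1 e2 e3)) _.
  exact: etrans (esym (hv_chart pz f1 f2 f3)) (P0 _ _ _ _ pz f1 f2 f3).
rewrite (hv_chart pz fX fY sZ); cbv zeta; set i := ch_at C z.1; have Ua : U i (ch_map TC i z).
  by apply: mapU; exact: pts_at.
apply: (hvform_of_chor B (@Uo i) (@g_sym i) (@g_lin i) (@g_pos i) (@g_smooth i) (@dg i)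
  (@c_sym12 i) (@c_sym23 i) (@c_lin i) (@c_smooth i) (@c_radial i) (@om_linl i)
  (@om_linr i) (@om_smooth i) (@torsion_chart i) _ Ua).
  by move=> b X'; exact: met_landsberg.
move=> b /(inv_map B hC)[ib eb] v w x.
have sv u := frame_section_at B hC u ib.
have := cartan_dot1_chart ib (sv v) (sv w) (sv x).
rewrite (L _ _ _ _ (dom_pts ib) (sv v) (sv w) (sv x)) eb !(frame_sectionE hC _ ib).
by move=> <-.
Qed.

End CartanType.

(** The Gram matrix of the form is invertible, since [v A = 0] forces [h v v = 0]; its inverse
    applied to the row of values of [phi] on the basis is the representative. *)
Lemma row_riesz (R : realType) n (h : 'rV[R]_n -> 'rV[R]_n -> R) :
  (forall w, linear (h ^~ w : 'rV[R]_n -> R)) ->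
  (forall v, linear (h v : 'rV[R]_n -> R)) ->
  (forall w, w != 0 -> 0 < h w w) ->
  forall phi : 'rV[R]_n -> R, linear phi -> exists s, forall w, h s w = phi w.
Proof.
move=> hl hr hpos phi lphi.
pose A : 'M[R]_n := \matrix_(i, j) h (delta_mx 0 i) (delta_mx 0 j).
have expand (f : 'rV[R]_n -> R) : linear f ->
    forall w, f w = \sum_j w 0 j * f (delta_mx 0 j).
  move=> lf w; pose fl : {linear 'rV[R]_n -> R} := HB.pack f (GRing.isLinear.Build _ _ _ _ _ lf).
  rewrite -[f]/(fl : _ -> _) {1}(row_sum_delta w) linear_sum.
  by apply: eq_bigr => j _; rewrite linearZ.
have hA u j : h u (delta_mx 0 j) = (u *m A) 0 j.
  by rewrite (expand _ (hl (delta_mx 0 j))) mxE; apply: eq_bigr => k _; rewrite !mxE.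
have Aunit : A \in unitmx.
  rewrite -row_free_unit; apply: inj_row_free => v vA.
  apply/eqP; apply: contraT => /hpos.
  rewrite (expand _ (hr v)) big1 ?ltxx// => j _.
  by rewrite hA vA mxE mulr0.
exists ((\row_j phi (delta_mx 0 j)) *m invmx A) => w.
rewrite (expand _ (hr _)) [RHS](expand _ lphi); apply: eq_bigr => j _.
by rewrite hA mulmxKV// mxE.
Qed.

Theorem theorem5p1 (R : realType) (n : nat) (M : topologicalType)
    (C : charts 'rV[R]_n M) (hM : manifold C)
    (F : M * 'rV[R]_n -> R) (hF : finsler C F)
    (m : nat) (hm : (1 <= m)%N) (kappa : 'I_m -> R)
    (D : connection (V := 'rV[R]_n) (M := M)) (hD : cartan_type C F D kappa) :
  hv_curvature_vanishes C F D <-> landsberg C F D.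
Proof.
have full x : ch_pts C x by exists (ch_at C x) => //; exact: mfd_at.
exact: (hv_curvature_landsberg (@row_frame R n) (manifold_atlas hM) full
  (@row_riesz R n) hF hD.1 hD.2).
Qed.
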